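(* There exist infinitely many $\alpha\in\mathcal{A}$ such that the Hurwitz zeta-function $\zeta(s,\alpha)$ has infinitely many zeros in the strip $D$.
   Context: Write $s=\sigma+it$. For $0<\alpha\le1$, $\zeta(s,\alpha)$ is the Hurwitz zeta-function, defined by $\sum_{n=0}^\infty (n+\alpha)^{-s}$ for $\sigma>1$ and continued meromorphically to $\mathbb{C}$. $D=\{s\in\mathbb{C}: 1/2<\sigma<1\}$, and $\mathcal{A}=\{0<\alpha<1: \alpha \text{ is algebraic and irrational}\}$. *)

(* Defs.v *)
(* Stdlib reals and Coquelicot's complex numbers. *)
From Stdlib Require Import Reals ZArith Finite_sets.
From Coquelicot Require Import Coquelicot.

Open Scope R_scope.

Definition infinite_set (T : Type) (A : T -> Prop) : Prop :=
  ~ Finite_sets.Finite T A.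

Definition algebraic (x : R) : Prop :=
  exists (a : nat -> Z) (n : nat),
    (exists k : nat, (k <= n)%nat /\ a k <> 0%Z) /\
    sum_f_R0 (fun k => IZR (a k) * x ^ k) n = 0.

Definition irrational (x : R) : Prop :=
  ~ exists p q : Z, q <> 0%Z /\ x = IZR p / IZR q.

Definition calA (alpha : R) : Prop :=
  0 < alpha < 1 /\ algebraic alpha /\ irrational alpha.

Definition stripD (s : C) : Prop := 1 / 2 < Re s < 1.

Definition Cexp (z : C) : C :=
  (RtoC (exp (Re z)) * (cos (Im z), sin (Im z)))%C.

(* x ^ s for a real base x > 0, with the real logarithm of x. *)
Definition Rcpow (x : R) (s : C) : C := Cexp (s * RtoC (ln x))%C.

Definition holomorphic_at (f : C -> C) (z : C) : Prop :=
  locally z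
    (fun w : C => @ex_derive C_AbsRing C_NormedModule f w).

(* Functions are total: the value of f at z itself is irrelevant. *)
Definition meromorphic_at (f : C -> C) (z : C) : Prop :=
  exists (m : nat) (g : C -> C),
    holomorphic_at g z /\
    locally' z (fun w : C => ((w - z) ^ m * f w)%C = g w).

(* f is the meromorphic continuation to C of the Hurwitz series.  The
   continuation is holomorphic away from s = 1; requiring differentiability
   there, rather than only meromorphy at every point, excludes junk values at
   isolated points, so that by the identity theorem f is determined everywhere
   except for its (meaningless) value at the pole s = 1. *)
Definition is_Hurwitz_zeta (alpha : R) (f : C -> C) : Prop :=
  (forall s : C, 1 < Re s ->
     @is_series C_AbsRing C_NormedModule
       (fun n : nat => Rcpow (INR n + alpha) (- s)%C) (f s)) /\
  (forall s : C, s <> RtoC 1 -> holomorphic_at f s) /\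
  meromorphic_at f (RtoC 1).

(* Main.v *)
(** Put sigma = 7/8 and let al avoid finitely many values. After a vertical
    shift by tau, zeta(s, al) is near sigma a long Dirichlet polynomial with
    terms (n + al)^(-sigma - i tau) up to a small error. Average over tau in a
    window [3T/2, 5T/2] against the Riesz product
    F(tau) = prod_(n < N) (1 + e_n cos (tau ln (n + al))) with signs e_n: if the
    numbers ln (n + al), n < N', satisfy no linear relation with coefficients at
    most 2, the F-mean of the polynomial is g(s) = 1/2 sum_(n < N) e_n (n + al)^(-s)
    and its F-variance is bounded by an absolute constant (the terms n >= N' are
    handled by the unweighted mean square, because F <= 2^N). The signs are +1 up
    to a crossing index and -1 after it, so that g(sigma) is bounded while
    g'(sigma) has size N^(1/8). For N large the bounded fluctuation is negligible
    and Newton iteration gives a zero near sigma + i tau for some tau in every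
    window. A given nontrivial relation is a polynomial equation in al, so only
    finitely many al are lost, and infinitely many quadratic irrationals remain. *)
Require Import Defs.
From Stdlib Require Import Reals ZArith Finite_sets.
From Stdlib Require Import Lra Lia List FinFun Classical.
From Coquelicot Require Import Coquelicot.
Open Scope R_scope.

(** * Complex exponential and functions of a real variable *)

Lemma C_eq (z w : C) : Re z = Re w -> Im z = Im w -> z = w.
Proof. destruct z, w; simpl; intros; subst; reflexivity. Qed.

Lemma Cexp_plus (z w : C) : Cexp (z + w)%C = (Cexp z * Cexp w)%C.
Proof.
  destruct z as [a b], w as [c d]; unfold Cexp; simpl.
  rewrite exp_plus, cos_plus, sin_plus.
  apply C_eq; simpl; ring.
Qed.

Lemma Cexp_0 : Cexp 0 = 1%C.
Proof. unfold Cexp; simpl. rewrite exp_0, cos_0, sin_0. apply C_eq; simpl; ring. Qed.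

Lemma Cexp_RtoC (x : R) : Cexp (RtoC x) = RtoC (exp x).
Proof. unfold Cexp; simpl. rewrite cos_0, sin_0. apply C_eq; simpl; ring. Qed.

Lemma Cmod_Cexp (z : C) : Cmod (Cexp z) = exp (Re z).
Proof.
  unfold Cexp. rewrite Cmod_mult, Cmod_R, Rabs_pos_eq by (left; apply exp_pos).
  unfold Cmod at 1; simpl fst; simpl snd.
  replace (cos (Im z) ^ 2 + sin (Im z) ^ 2) with 1
    by (generalize (sin2_cos2 (Im z)); unfold Rsqr; simpl; lra).
  rewrite sqrt_1; ring.
Qed.

Lemma Cmod_sqr (z : C) : Cmod z ^ 2 = Re z ^ 2 + Im z ^ 2.
Proof. apply Cmod2_alt. Qed.

Lemma im_le_Cmod (z : C) : Rabs (Im z) <= Cmod z.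
Proof.
  apply Rle_trans with (2 := Rmax_Cmod z). apply Rmax_r.
Qed.

Lemma Re_le_Cmod (z : C) : Re z <= Cmod z.
Proof. apply Rle_trans with (1 := Rle_abs _). apply re_le_Cmod. Qed.

Lemma Cmod_minus_sym (z w : C) : Cmod (z - w)%C = Cmod (w - z)%C.
Proof. rewrite <- Cmod_opp. f_equal. ring. Qed.

Lemma Cmod_triangle_minus (z w : C) : Cmod (z - w)%C <= Cmod z + Cmod w.
Proof. unfold Cminus. rewrite <- (Cmod_opp w). apply Cmod_triangle. Qed.

Lemma Cmod_RtoC_pos (x : R) : 0 <= x -> Cmod (RtoC x) = x.
Proof. intros; rewrite Cmod_R; now apply Rabs_pos_eq. Qed.

Definition is_derive_RC (f : R -> C) (t : R) (l : C) : Prop :=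
  is_derive (fun u => Re (f u)) t (Re l) /\
  is_derive (fun u => Im (f u)) t (Im l).

Lemma is_derive_RC_plus f g t l m :
  is_derive_RC f t l -> is_derive_RC g t m ->
  is_derive_RC (fun u => f u + g u)%C t (l + m)%C.
Proof.
  intros [A B] [A' B']; split; simpl.
  - apply (is_derive_plus (fun u => Re (f u)) (fun u => Re (g u)) t _ _ A A').
  - apply (is_derive_plus (fun u => Im (f u)) (fun u => Im (g u)) t _ _ B B').
Qed.

Lemma is_derive_RC_mult f g t l m :
  is_derive_RC f t l -> is_derive_RC g t m ->
  is_derive_RC (fun u => f u * g u)%C t (l * g t + f t * m)%C.
Proof.
  intros [A B] [A' B']; split; simpl.
  - evar_last. apply (is_derive_minus (fun u => Re (f u) * Re (g u)) (fun u => Im (f u) * Im (g u)) t).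
    apply (is_derive_mult (fun u => Re (f u)) (fun u => Re (g u)) t _ _ A A'). intros; apply Rmult_comm.
    apply (is_derive_mult (fun u => Im (f u)) (fun u => Im (g u)) t _ _ B B'). intros; apply Rmult_comm.
    unfold minus, plus, opp, mult; simpl. unfold Re, Im; ring.
  - evar_last. apply (is_derive_plus (fun u => Re (f u) * Im (g u)) (fun u => Im (f u) * Re (g u)) t).
    apply (is_derive_mult (fun u => Re (f u)) (fun u => Im (g u)) t _ _ A B'). intros; apply Rmult_comm.
    apply (is_derive_mult (fun u => Im (f u)) (fun u => Re (g u)) t _ _ B A'). intros; apply Rmult_comm.
    unfold plus, mult; simpl. unfold Re, Im; ring.
Qed.

Lemma is_derive_RC_const c t : is_derive_RC (fun _ => c) t 0%C.
Proof. split; simpl; apply (is_derive_const (K := R_AbsRing) (V := R_NormedModule)). Qed.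

Lemma is_derive_RC_RtoC (f : R -> R) t l :
  is_derive f t l -> is_derive_RC (fun u => RtoC (f u)) t (RtoC l).
Proof. intros H; split; simpl. exact H. apply (is_derive_const (K := R_AbsRing) (V := R_NormedModule)). Qed.

Lemma is_derive_RC_Cexp f t l :
  is_derive_RC f t l -> is_derive_RC (fun u => Cexp (f u)) t (l * Cexp (f t))%C.
Proof.
  intros [A B].
  assert (E : is_derive (fun u => exp (Re (f u))) t (Re l * exp (Re (f t)))).
  { apply (is_derive_comp exp (fun u => Re (f u))); [apply is_derive_exp | exact A]. }
  assert (Cc : is_derive (fun u => cos (Im (f u))) t (Im l * (- sin (Im (f t))))).
  { apply (is_derive_comp cos (fun u => Im (f u))); [apply is_derive_cos | exact B]. }
  assert (S : is_derive (fun u => sin (Im (f u))) t (Im l * cos (Im (f t)))).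
  { apply (is_derive_comp sin (fun u => Im (f u))); [apply is_derive_sin | exact B]. }
  assert (P : is_derive_RC (fun u => (cos (Im (f u)), sin (Im (f u)))) t
     (Im l * (- sin (Im (f t))), Im l * cos (Im (f t)))) by (split; assumption).
  generalize (is_derive_RC_mult _ _ _ _ _ (is_derive_RC_RtoC _ _ _ E) P).
  unfold Cexp. intros H.
  evar_last; [exact H|].
  apply C_eq; unfold Re, Im; simpl; ring.
Qed.

Lemma is_derive_RC_ext f g t l :
  (forall u, f u = g u) -> is_derive_RC f t l -> is_derive_RC g t l.
Proof.
  intros E [A B]; split; [apply is_derive_ext with (2 := A) | apply is_derive_ext with (2 := B)];
  intros; now rewrite E.
Qed.

Lemma nonpos_derive_le (f df : R -> R) (a b : R) :
  a <= b -> (forall t, a <= t <= b -> is_derive f t (df t)) ->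
  (forall t, a <= t <= b -> df t <= 0) -> f b <= f a.
Proof.
  intros ab D N.
  destruct (MVT_gen f a b df) as [c [Hc E]].
  - intros x Hx. rewrite Rmin_left, Rmax_right in Hx by lra. apply D; lra.
  - intros x Hx. rewrite Rmin_left, Rmax_right in Hx by lra.
    apply derivable_continuous_pt. exists (df x). apply is_derive_Reals, D; lra.
  - rewrite Rmin_left, Rmax_right in Hc by lra.
    specialize (N c Hc). nra.
Qed.

Lemma mean_value_RC (f df : R -> C) (g dg : R -> R) (a b : R) :
  a <= b ->
  (forall t, a <= t <= b -> is_derive_RC f t (df t)) ->
  (forall t, a <= t <= b -> is_derive g t (dg t)) ->
  (forall t, a <= t <= b -> Cmod (df t) <= dg t) ->
  Cmod (f b - f a)%C <= g b - g a.
Proof.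
  intros ab Df Dg L.
  set (w := (f b - f a)%C).
  (* the real function Re (conj w * f) - |w| g is nonincreasing *)
  assert (H : Re (Cconj w * f b)%C - Cmod w * g b <= Re (Cconj w * f a)%C - Cmod w * g a).
  { apply (nonpos_derive_le (fun t => Re (Cconj w * f t)%C - Cmod w * g t)
      (fun t => Re (Cconj w * df t)%C - Cmod w * dg t) a b ab).
    - intros t Ht.
      apply (is_derive_minus (fun t => Re (Cconj w * f t)%C) (fun t => Cmod w * g t)).
      + destruct (is_derive_RC_mult _ _ _ _ _ (is_derive_RC_const (Cconj w) t) (Df t Ht)) as [A _].
        replace (Re (Cconj w * df t)%C) with (Re (0 * f t + Cconj w * df t)%C); [exact A|].
        f_equal; ring.
      + apply is_derive_scal, Dg, Ht.
    - intros t Ht.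
      generalize (Re_le_Cmod (Cconj w * df t)%C). rewrite Cmod_mult, Cmod_conj.
      generalize (L t Ht) (Cmod_ge_0 w). nra. }
  assert (E : Re (Cconj w * f b)%C - Re (Cconj w * f a)%C = Cmod w ^ 2).
  { rewrite Cmod_sqr. unfold w. unfold Re, Im; simpl. ring. }
  destruct (Rle_lt_or_eq_dec _ _ (Cmod_ge_0 w)) as [P|P]; [|rewrite <- P].
  - apply Rmult_le_reg_l with (1 := P). nra.
  - assert (g a <= g b); [|lra].
    assert (Hm := nonpos_derive_le (fun t => - g t) (fun t => - dg t) a b ab).
    assert (- g b <= - g a); [apply Hm|lra].
    + intros t Ht. apply (is_derive_opp g), Dg, Ht.
    + intros t Ht. generalize (L t Ht) (Cmod_ge_0 (df t)). lra.
Qed.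

Fixpoint sumR (f : nat -> R) (n : nat) : R :=
  match n with O => 0 | S m => sumR f m + f m end.
Fixpoint sumC (f : nat -> C) (n : nat) : C :=
  match n with O => RtoC 0 | S m => (sumC f m + f m)%C end.

Definition exp_trunc (J : nat) (z : C) : C :=
  sumC (fun i => RtoC (/ INR (fact i)) * z ^ i)%C J.

Lemma sumC_scal c f n : sumC (fun i => c * f i)%C n = (c * sumC f n)%C.
Proof. induction n as [|n IH]; simpl; [ring|rewrite IH; ring]. Qed.
Lemma sumR_scal c f n : sumR (fun i => c * f i) n = c * sumR f n.
Proof. induction n as [|n IH]; simpl; [ring|rewrite IH; ring]. Qed.

Lemma is_derive_RC_exp_trunc J (z : C) (t : R) :
  is_derive_RC (fun u => exp_trunc J (RtoC u * z)) t
    (z * exp_trunc (pred J) (RtoC t * z))%C.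
Proof.
  induction J as [|J IH].
  - unfold exp_trunc; simpl.
    replace (z * RtoC 0)%C with (RtoC 0) by ring. apply is_derive_RC_const.
  - unfold exp_trunc in *; simpl.
    assert (D : is_derive_RC (fun u => RtoC (/ INR (fact J)) * (RtoC u * z) ^ J)%C t
       (RtoC (INR J * / INR (fact J) * t ^ pred J) * z ^ J)%C).
    { apply is_derive_RC_ext with (f := fun u => (RtoC (/ INR (fact J) * u ^ J) * z ^ J)%C).
      - intros u. rewrite RtoC_mult, RtoC_pow, Cpow_mult_l. ring.
      - replace (RtoC (INR J * / INR (fact J) * t ^ pred J) * z ^ J)%C with
          (RtoC (INR J * / INR (fact J) * t ^ pred J) * z ^ J + RtoC (/ INR (fact J) * t ^ J) * 0)%C by ring.
        apply (is_derive_RC_mult (fun u => RtoC (/ INR (fact J) * u ^ J)) (fun _ => z ^ J)%C);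
          [|apply is_derive_RC_const].
        apply (is_derive_RC_RtoC (fun u => / INR (fact J) * u ^ J)). auto_derive; trivial. ring. }
    destruct J as [|J].
    + apply is_derive_RC_ext with (f := fun u => RtoC 1).
      * intros u; simpl. apply C_eq; simpl; field.
      * simpl. replace (z * RtoC 0)%C with (RtoC 0) by ring. apply is_derive_RC_const.
    + replace (z * (sumC (fun i : nat => RtoC (/ INR (fact i)) * (RtoC t * z) ^ i) (S J)))%C with
       (z * sumC (fun i : nat => RtoC (/ INR (fact i)) * (RtoC t * z) ^ i) (pred (S J)) +
         RtoC (INR (S J) * / INR (fact (S J)) * t ^ pred (S J)) * z ^ (S J))%C.
      * apply is_derive_RC_plus; assumption.
      * simpl pred. cbn [sumC]. rewrite Cpow_mult_l.
        replace (INR (S J) * / INR (fact (S J)) * t ^ J) with (/ INR (fact J) * t ^ J).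
        -- rewrite (RtoC_mult (/ INR (fact J))), RtoC_pow. simpl Cpow. ring.
        -- rewrite fact_simpl, mult_INR. field. split; [apply INR_fact_neq_0|apply not_0_INR; lia].
Qed.

Lemma exp_trunc_0 J : exp_trunc (S J) 0 = RtoC 1.
Proof.
  induction J as [|J IH].
  - unfold exp_trunc; simpl. apply C_eq; simpl; field.
  - unfold exp_trunc in *. simpl in *. rewrite IH. simpl. ring.
Qed.

Lemma Cexp_trunc_bound J (z : C) :
  Cmod (Cexp z - exp_trunc J z)%C <= Cmod z ^ J / INR (fact J) * exp (Cmod z).
Proof.
  revert z. induction J as [|J IH]; intros z.
  - unfold exp_trunc; simpl. replace (Cexp z - RtoC 0)%C with (Cexp z) by ring.
    rewrite Cmod_Cexp. unfold Rdiv; rewrite Rinv_1, !Rmult_1_l.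
    destruct (Re_le_Cmod z) as [H|H]; [left; now apply exp_increasing|right; now rewrite H].
  - assert (H := mean_value_RC (fun t => Cexp (RtoC t * z) - exp_trunc (S J) (RtoC t * z))%C
      (fun t => z * (Cexp (RtoC t * z) - exp_trunc J (RtoC t * z)))%C
      (fun t => t ^ S J * (Cmod z ^ S J / INR (fact (S J)) * exp (Cmod z)))
      (fun t => INR (S J) * t ^ J * (Cmod z ^ S J / INR (fact (S J)) * exp (Cmod z))) 0 1).
    assert (Hz : (RtoC 0 * z)%C = 0%C) by ring. cbv beta in H. rewrite Hz in H.
    assert (H1 : (RtoC 1 * z)%C = z) by ring. rewrite H1 in H.
    rewrite exp_trunc_0, Cexp_0 in H.
    replace (Cexp z - exp_trunc (S J) z)%C with
      (Cexp z - exp_trunc (S J) z - (1 - RtoC 1))%C by (apply C_eq; simpl; ring).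
    eapply Rle_trans; [apply H|].
    + lra.
    + intros t _.
      apply is_derive_RC_ext with (f := fun u => (Cexp (RtoC u * z) + RtoC (-1) * exp_trunc (S J) (RtoC u * z))%C).
      { intros u; apply C_eq; simpl; ring. }
      replace (z * (Cexp (RtoC t * z) - exp_trunc J (RtoC t * z)))%C with
        ((RtoC 1 * z + RtoC t * 0) * Cexp (RtoC t * z) +
          (0 * exp_trunc (S J) (RtoC t * z) + RtoC (-1) * (z * exp_trunc (pred (S J)) (RtoC t * z))))%C
        by (simpl pred; apply C_eq; simpl; ring).
      apply is_derive_RC_plus.
      * apply (is_derive_RC_Cexp (fun u => RtoC u * z)%C).
        apply (is_derive_RC_mult (fun u => RtoC u) (fun _ => z)); [|apply is_derive_RC_const].
        apply (is_derive_RC_RtoC (fun u => u)). apply (is_derive_id (K := R_AbsRing)).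
      * apply (is_derive_RC_mult (fun _ => RtoC (-1)) (fun u => exp_trunc (S J) (RtoC u * z))%C);
          [apply is_derive_RC_const|apply is_derive_RC_exp_trunc].
    + intros t _. auto_derive; trivial. destruct J; simpl; ring.
    + intros t Ht. rewrite Cmod_mult.
      specialize (IH (RtoC t * z)%C). rewrite Cmod_mult, Cmod_RtoC_pos in IH by lra.
      rewrite fact_simpl, mult_INR.
      assert (Pj : 0 < INR (S J)) by (apply lt_0_INR; lia).
      assert (Pf : 0 < INR (fact J)) by apply INR_fact_lt_0.
      replace (INR (S J) * t ^ J * (Cmod z ^ S J / (INR (S J) * INR (fact J)) * exp (Cmod z))) with
        (Cmod z * ((t * Cmod z) ^ J / INR (fact J) * exp (Cmod z)))
        by (rewrite Rpow_mult_distr; simpl pow; field; split; lra).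
      apply Rmult_le_compat_l; [apply Cmod_ge_0|].
      eapply Rle_trans; [apply IH|].
      apply Rmult_le_compat_l.
      * apply Rmult_le_pos; [apply pow_le, Rmult_le_pos; [lra|apply Cmod_ge_0]|left; now apply Rinv_0_lt_compat].
      * assert (t * Cmod z <= Cmod z) by (generalize (Cmod_ge_0 z); nra).
        destruct H0 as [H0|H0]; [left; now apply exp_increasing|right; now rewrite H0].
    + right. simpl pow. rewrite Rmult_0_l, pow1. ring.
Qed.

Lemma exp_le (x y : R) : x <= y -> exp x <= exp y.
Proof. intros [H|H]; [left; now apply exp_increasing|right; now rewrite H]. Qed.

Lemma Cexp_minus_1_bound (z : C) : Cmod (Cexp z - 1)%C <= Cmod z * exp (Cmod z).
Proof.
  generalize (Cexp_trunc_bound 1 z). unfold exp_trunc; simpl.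
  replace (RtoC 0 + RtoC (/ 1) * 1)%C with (RtoC 1) by (apply C_eq; simpl; field).
  intros H. eapply Rle_trans; [apply H|]. right. field.
Qed.

Lemma Cexp_quadratic_bound (z : C) :
  Cmod (Cexp z - 1 - z)%C <= Cmod z ^ 2 * exp (Cmod z).
Proof.
  generalize (Cexp_trunc_bound 2 z). unfold exp_trunc; simpl.
  replace (Cexp z - (RtoC 0 + RtoC (/ 1) * 1 + RtoC (/ 1) * (z * 1)))%C with (Cexp z - 1 - z)%C
    by (apply C_eq; simpl; field).
  intros H. eapply Rle_trans; [apply H|].
  apply Rmult_le_compat_r; [left; apply exp_pos|].
  generalize (pow_le (Cmod z) 2 (Cmod_ge_0 z)). simpl. lra.
Qed.

Lemma is_derive_C_of_quadratic_bound (f : C -> C) (s l : C) (K d : R) :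
  0 < d -> (forall h, Cmod h < d -> Cmod (f (s + h) - f s - h * l)%C <= K * Cmod h ^ 2) ->
  @is_derive C_AbsRing C_NormedModule f s l.
Proof.
  intros dp H. split; [apply is_linear_scal_l|].
  intros x Hx eps.
  apply (is_filter_lim_locally_unique (V := AbsRing_NormedModule C_AbsRing)) in Hx. subst x.
  set (e := Rmin d (eps / (Rabs K + 1))).
  assert (Kp : 0 < Rabs K + 1) by (generalize (Rabs_pos K); lra).
  assert (ep : 0 < e) by (apply Rmin_glb_lt; [lra|apply Rdiv_lt_0_compat; [apply cond_pos|lra]]).
  apply (locally_le_locally_norm (V := AbsRing_NormedModule C_AbsRing)).
  exists (mkposreal e ep). intros y' Hy. set (y := y' : C). change y' with y in Hy |- *.
  assert (Hy' : Cmod (y - s)%C < e) by exact Hy.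
  specialize (H (y - s)%C).
  assert (Hd : Cmod (y - s)%C < d) by (eapply Rlt_le_trans; [exact Hy'|apply Rmin_l]).
  assert (He : Cmod (y - s)%C < eps / (Rabs K + 1)) by (eapply Rlt_le_trans; [exact Hy'|apply Rmin_r]).
  specialize (H Hd). replace (s + (y - s))%C with y in H by (generalize y; intros; ring).
  change (Cmod (f y - f s - (y - s) * l)%C <= eps * Cmod (y - s)%C).
  eapply Rle_trans; [exact H|].
  generalize (Cmod_ge_0 (y - s)%C). intros P.
  assert (Cmod (y - s)%C * (Rabs K + 1) <= eps).
  { apply Rmult_le_reg_r with (/ (Rabs K + 1)); [now apply Rinv_0_lt_compat|].
    rewrite Rmult_assoc, Rinv_r by lra. unfold Rdiv in He. lra. }
  generalize (Rle_abs K). simpl. nra.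
Qed.

(** * Series and integrals of complex functions *)

Lemma Rcpow_plus x s w : Rcpow x (s + w)%C = (Rcpow x s * Rcpow x w)%C.
Proof. unfold Rcpow. rewrite <- Cexp_plus. f_equal. ring. Qed.

Lemma Cmod_Rcpow x s : Cmod (Rcpow x s) = Rpower x (Re s).
Proof. unfold Rcpow. rewrite Cmod_Cexp. unfold Rpower. f_equal. unfold Re, Im; simpl. ring. Qed.

Lemma Rcpow_RtoC x p : Rcpow x (RtoC p) = RtoC (Rpower x p).
Proof. unfold Rcpow. rewrite <- RtoC_mult. apply Cexp_RtoC. Qed.

Lemma is_derive_RC_Rcpow y t s : 0 < y + t ->
  is_derive_RC (fun u => Rcpow (y + u) s) t (s * Rcpow (y + t) (s - 1))%C.
Proof.
  intros H. unfold Rcpow at 1.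
  replace (s * Rcpow (y + t) (s - 1))%C with
   ((0 * RtoC (ln (y + t)) + s * RtoC (/ (y + t))) * Cexp (s * RtoC (ln (y + t))))%C.
  - apply (is_derive_RC_Cexp (fun u => s * RtoC (ln (y + u)))%C).
    apply (is_derive_RC_mult (fun _ => s) (fun u => RtoC (ln (y + u)))).
    + apply is_derive_RC_const.
    + apply (is_derive_RC_RtoC (fun u => ln (y + u))). auto_derive; [exact H|field; lra].
  - unfold Cminus. rewrite Rcpow_plus.
    replace (Rcpow (y + t) (- (1))%C) with (RtoC (/ (y + t))).
    + unfold Rcpow. ring.
    + rewrite <- RtoC_opp, Rcpow_RtoC. rewrite Rpower_Ropp, Rpower_1; auto.
Qed.

Lemma Rpower_pos x p : 0 < Rpower x p.
Proof. apply exp_pos. Qed.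

Lemma Rpower_le_base x y p : 0 <= p -> 0 < x <= y -> Rpower y (- p) <= Rpower x (- p).
Proof.
  intros Hp [Hx Hxy]. apply exp_le.
  assert (ln x <= ln y) by (apply ln_le; lra). nra.
Qed.

Lemma Rpower_telescope p y : 0 < p -> 0 < y ->
  p * Rpower (y + 1) (- (p + 1)) <= Rpower y (- p) - Rpower (y + 1) (- p).
Proof.
  intros Hp Hy.
  assert (E : Rpower y (- p) = Rpower (y + 1) (- p) * exp (p * (ln (y + 1) - ln y))).
  { unfold Rpower. rewrite <- exp_plus. f_equal. ring. }
  assert (E2 : Rpower (y + 1) (- (p + 1)) = Rpower (y + 1) (- p) * / (y + 1)).
  { replace (- (p + 1)) with (- p + - (1)) by ring. rewrite Rpower_plus, (Rpower_Ropp _ 1), Rpower_1; lra. }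
  rewrite E, E2.
  assert (L : / (y + 1) <= ln (y + 1) - ln y).
  { assert (Hq : 0 < y / (y + 1)) by (apply Rdiv_lt_0_compat; lra).
    generalize (exp_ineq1_le (ln (y / (y + 1)))). rewrite exp_ln by exact Hq.
    unfold Rdiv. rewrite ln_mult, ln_Rinv by (try apply Rinv_0_lt_compat; lra).
    replace (y * / (y + 1)) with (1 - / (y + 1)) by (field; lra). lra. }
  generalize (exp_ineq1_le (p * (ln (y + 1) - ln y))) (Rpower_pos (y + 1) (- p)). intros A B.
  assert (0 <= Rpower (y + 1) (- p) * (exp (p * (ln (y + 1) - ln y)) - 1 - p * / (y + 1))); [|lra].
  apply Rmult_le_pos; [lra|]. nra.
Qed.

Lemma sumR_le f g n : (forall i, (i < n)%nat -> f i <= g i) -> sumR f n <= sumR g n.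
Proof.
  induction n as [|n IH]; simpl; intros H; [lra|].
  generalize (H n ltac:(lia)). assert (sumR f n <= sumR g n) by (apply IH; intros; apply H; lia). lra.
Qed.

Lemma sumR_first f n : sumR f (S n) = f O + sumR (fun i => f (S i)) n.
Proof. induction n as [|n IH]; [simpl; ring|]. cbn [sumR] in *. rewrite IH. ring. Qed.

Lemma sumR_telescope f n : sumR (fun i => f i - f (S i)) n = f O - f n.
Proof. induction n as [|n IH]; simpl; [ring|rewrite IH; ring]. Qed.

Lemma sumR_ext f g n : (forall i, (i < n)%nat -> f i = g i) -> sumR f n = sumR g n.
Proof.
  induction n as [|n IH]; simpl; intros H; [auto|].
  rewrite IH, H; auto; intros; apply H; lia.
Qed.

Lemma sum_Rpower_le p a n : 0 < p -> 0 < a ->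
  sumR (fun i => Rpower (a + INR i + 1) (- (p + 1))) n <= Rpower a (- p) / p.
Proof.
  intros Hp Ha.
  apply Rmult_le_reg_l with p; [exact Hp|].
  rewrite <- sumR_scal.
  eapply Rle_trans.
  - apply sumR_le. intros i _. apply Rpower_telescope; [exact Hp|generalize (pos_INR i); lra].
  - rewrite (sumR_ext _ (fun i => Rpower (a + INR i) (- p) - Rpower (a + INR (S i)) (- p))).
    + rewrite (sumR_telescope (fun i => Rpower (a + INR i) (- p))).
      simpl. rewrite Rplus_0_r. generalize (Rpower_pos (a + INR n) (- p)).
      replace (p * (Rpower a (- p) / p)) with (Rpower a (- p)) by (field; lra). lra.
    + intros i _. rewrite S_INR. do 2 f_equal; ring.
Qed.

Lemma sum_n_sumR f n : sum_n f n = sumR f (S n).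
Proof.
  induction n as [|n IH]; [rewrite sum_O; simpl; now rewrite Rplus_0_l|].
  rewrite sum_Sn, IH. reflexivity.
Qed.

Lemma ex_series_bounded (f : nat -> R) (M : R) :
  (forall n, 0 <= f n) -> (forall n, sumR f n <= M) -> ex_series f /\ Series f <= M.
Proof.
  intros P B.
  assert (ex_finite_lim_seq (sum_n f)) as [l Hl].
  { apply ex_finite_lim_seq_incr with M.
    - intros n. rewrite sum_Sn. unfold plus; simpl. generalize (P (S n)); lra.
    - intros n. rewrite sum_n_sumR. apply B. }
  split.
  - exists l. exact Hl.
  - rewrite (is_series_unique f l); [|exact Hl].
    apply (is_lim_seq_le (sum_n f) (fun _ => M) l M); [|exact Hl|apply is_lim_seq_const].
    intros n; rewrite sum_n_sumR; apply B.
Qed.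

Lemma series_Rpower p a : 0 < p -> 0 < a ->
  ex_series (fun i => Rpower (a + INR i + 1) (- (p + 1))) /\
  Series (fun i => Rpower (a + INR i + 1) (- (p + 1))) <= Rpower a (- p) / p.
Proof.
  intros Hp Ha. apply ex_series_bounded.
  - intros n; left; apply Rpower_pos.
  - intros n; now apply sum_Rpower_le.
Qed.

Definition CSeries (f : nat -> C) : C :=
  (Series (fun n => Re (f n)), Series (fun n => Im (f n))).

Definition abs_summable (f : nat -> C) : Prop := ex_series (fun n => Cmod (f n)).

Lemma abs_summable_le f B : (forall n, Cmod (f n) <= B n) -> ex_series B -> abs_summable f.
Proof.
  intros H E. unfold abs_summable.
  apply (ex_series_le (K := R_AbsRing) (V := R_CompleteNormedModule)) with (2 := E). intros n.
  unfold norm; simpl. unfold abs; simpl. rewrite Rabs_pos_eq by apply Cmod_ge_0. apply H.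
Qed.

Lemma abs_summable_Re f : abs_summable f -> ex_series (fun n => Re (f n)).
Proof.
  intros H. apply (ex_series_le (K := R_AbsRing) (V := R_CompleteNormedModule)) with (2 := H).
  intros n. apply re_le_Cmod.
Qed.
Lemma abs_summable_Im f : abs_summable f -> ex_series (fun n => Im (f n)).
Proof.
  intros H. apply (ex_series_le (K := R_AbsRing) (V := R_CompleteNormedModule)) with (2 := H).
  intros n. apply im_le_Cmod.
Qed.

Lemma ex_series_scalR c a : ex_series a -> ex_series (fun n => c * a n).
Proof. intros H. apply (ex_series_scal (V := R_NormedModule) c a H). Qed.

Lemma abs_summable_scal c f : abs_summable f -> abs_summable (fun n => c * f n)%C.
Proof.
  intros H. apply abs_summable_le with (B := fun n => Cmod c * Cmod (f n)).
  - intros n; rewrite Cmod_mult; lra.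
  - apply (ex_series_scalR (Cmod c)), H.
Qed.

Lemma abs_summable_plus f g : abs_summable f -> abs_summable g -> abs_summable (fun n => f n + g n)%C.
Proof.
  intros H H'. apply abs_summable_le with (B := fun n => Cmod (f n) + Cmod (g n)).
  - intros n; apply Cmod_triangle.
  - apply (ex_series_plus (V := R_NormedModule) _ _ H H').
Qed.

Lemma CSeries_scal c f : abs_summable f -> CSeries (fun n => c * f n)%C = (c * CSeries f)%C.
Proof.
  intros H. generalize (abs_summable_Re _ H) (abs_summable_Im _ H); intros HR HI.
  apply C_eq; simpl.
  - rewrite Series_minus, !Series_scal_l; [reflexivity| |].
    + apply (ex_series_scalR (Re c) _ HR).
    + apply (ex_series_scalR (Im c) _ HI).
  - rewrite Series_plus, !Series_scal_l; [reflexivity| |].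
    + apply (ex_series_scalR (Re c) _ HI).
    + apply (ex_series_scalR (Im c) _ HR).
Qed.

Lemma CSeries_minus f g : abs_summable f -> abs_summable g ->
  CSeries (fun n => f n - g n)%C = (CSeries f - CSeries g)%C.
Proof.
  intros H H'. apply C_eq; simpl; apply Series_minus; try apply abs_summable_Re; try apply abs_summable_Im; assumption.
Qed.

Lemma Cmod_le_of_Re_bound (w : C) (M : R) :
  Re (Cconj w * w)%C <= Cmod w * M -> 0 <= M -> Cmod w <= M.
Proof.
  intros H HM. replace (Re (Cconj w * w)%C) with (Cmod w ^ 2) in H
    by (rewrite Cmod_sqr; simpl; unfold Re, Im; ring).
  destruct (Rle_lt_or_eq_dec _ _ (Cmod_ge_0 w)) as [P|P]; [|lra].
  apply Rmult_le_reg_l with (1 := P). lra.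
Qed.

Lemma Series_le_general (a b : nat -> R) :
  (forall n, a n <= b n) -> ex_series a -> ex_series b -> Series a <= Series b.
Proof.
  intros H Ha Hb.
  assert (0 <= Series (fun n => b n - a n)).
  { apply Rle_trans with (Series (fun _ : nat => 0 * 0)).
    - rewrite Series_scal_l. lra.
    - apply Series_le.
      + intros n. generalize (H n); lra.
      + apply (ex_series_minus (V := R_NormedModule) b a Hb Ha). }
  rewrite Series_minus in H0 by assumption. lra.
Qed.

Lemma Cmod_CSeries_le f B : (forall n, Cmod (f n) <= B n) -> ex_series B ->
  Cmod (CSeries f) <= Series B.
Proof.
  intros H E. generalize (abs_summable_le f B H E); intros A.
  assert (P0 : 0 <= Series B).
  { apply Rle_trans with (Series (fun _ : nat => 0 * 0)).
    - rewrite Series_scal_l. lra.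
    - apply Series_le; [|exact E]. intros n. generalize (H n) (Cmod_ge_0 (f n)); lra. }
  apply Cmod_le_of_Re_bound; [|exact P0].
  set (w := CSeries f). rewrite <- Series_scal_l.
  unfold w at 2. rewrite <- CSeries_scal by exact A. simpl.
  assert (E' : ex_series (fun n => Cmod w * Cmod (f n))) by apply (ex_series_scalR (Cmod w)), A.
  apply Rle_trans with (Series (fun n => Cmod w * Cmod (f n))).
  - apply Series_le_general.
    + intros n. eapply Rle_trans; [apply (Re_le_Cmod (Cconj w * f n)%C)|]. rewrite Cmod_mult, Cmod_conj. apply Rle_refl.
    + apply (abs_summable_Re (fun n => Cconj w * f n)%C). now apply abs_summable_scal.
    + exact E'.
  - apply Series_le.
    + intros n; split; [apply Rmult_le_pos; apply Cmod_ge_0|].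
      apply Rmult_le_compat_l; [apply Cmod_ge_0|apply H].
    + apply (ex_series_scalR (Cmod w)), E.
Qed.

Definition cont_RC (f : R -> C) (t : R) : Prop :=
  continuous (fun u => Re (f u)) t /\ continuous (fun u => Im (f u)) t.

Lemma is_derive_RC_cont f t l : is_derive_RC f t l -> cont_RC f t.
Proof.
  intros [A B]; split.
  - apply (ex_derive_continuous (K := R_AbsRing) (V := R_NormedModule)). now exists (Re l).
  - apply (ex_derive_continuous (K := R_AbsRing) (V := R_NormedModule)). now exists (Im l).
Qed.

Lemma cont_RC_mult f g t : cont_RC f t -> cont_RC g t -> cont_RC (fun u => f u * g u)%C t.
Proof.
  intros [A B] [A' B']; split; simpl.
  - apply (continuous_minus (V := R_NormedModule) (fun u => Re (f u) * Re (g u)) (fun u => Im (f u) * Im (g u)));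
    apply (continuous_mult (K := R_AbsRing)); assumption.
  - apply (continuous_plus (V := R_NormedModule) (fun u => Re (f u) * Im (g u)) (fun u => Im (f u) * Re (g u)));
    apply (continuous_mult (K := R_AbsRing)); assumption.
Qed.

Lemma cont_RC_plus f g t : cont_RC f t -> cont_RC g t -> cont_RC (fun u => f u + g u)%C t.
Proof.
  intros [A B] [A' B']; split; simpl.
  - apply (continuous_plus (V := R_NormedModule) (fun u => Re (f u)) (fun u => Re (g u))); assumption.
  - apply (continuous_plus (V := R_NormedModule) (fun u => Im (f u)) (fun u => Im (g u))); assumption.
Qed.

Lemma cont_RC_const c t : cont_RC (fun _ => c) t.
Proof. split; simpl; apply continuous_const. Qed.

Lemma cont_RC_RtoC (f : R -> R) t : continuous f t -> cont_RC (fun u => RtoC (f u)) t.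
Proof. intros H; split; simpl; [exact H|apply continuous_const]. Qed.

Definition cont01 (f : R -> C) : Prop := forall t, 0 <= t <= 1 -> cont_RC f t.

Lemma cont01_plus f g : cont01 f -> cont01 g -> cont01 (fun u => f u + g u)%C.
Proof. intros Hf Hg t Ht. apply cont_RC_plus; [apply Hf|apply Hg]; exact Ht. Qed.

Lemma cont01_scal c f : cont01 f -> cont01 (fun u => c * f u)%C.
Proof. intros Hf t Ht. apply cont_RC_mult; [apply cont_RC_const|apply Hf, Ht]. Qed.

Definition CInt (f : R -> C) : C :=
  (RInt (fun u => Re (f u)) 0 1, RInt (fun u => Im (f u)) 0 1).

Lemma cont01_ex_RInt f : cont01 f ->
  ex_RInt (fun u => Re (f u)) 0 1 /\ ex_RInt (fun u => Im (f u)) 0 1.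
Proof.
  intros H; split; apply (ex_RInt_continuous (V := R_CompleteNormedModule));
  intros z Hz; rewrite Rmin_left, Rmax_right in Hz by lra; apply H; exact Hz.
Qed.

Lemma CInt_derive (F f : R -> C) :
  (forall t, 0 <= t <= 1 -> is_derive_RC F t (f t)) -> cont01 f ->
  CInt f = (F 1 - F 0)%C.
Proof.
  intros D Cf. apply C_eq; simpl.
  - apply is_RInt_unique. apply (is_RInt_derive (V := R_CompleteNormedModule) (fun u => Re (F u)));
    intros z Hz; rewrite Rmin_left, Rmax_right in Hz by lra; [apply D|apply Cf]; exact Hz.
  - apply is_RInt_unique. apply (is_RInt_derive (V := R_CompleteNormedModule) (fun u => Im (F u)));
    intros z Hz; rewrite Rmin_left, Rmax_right in Hz by lra; [apply D|apply Cf]; exact Hz.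
Qed.

Lemma CInt_plus f g : cont01 f -> cont01 g ->
  CInt (fun u => f u + g u)%C = (CInt f + CInt g)%C.
Proof.
  intros Hf Hg. destruct (cont01_ex_RInt _ Hf), (cont01_ex_RInt _ Hg).
  apply C_eq; simpl.
  - apply (RInt_plus (V := R_CompleteNormedModule) (fun u => Re (f u)) (fun u => Re (g u))); assumption.
  - apply (RInt_plus (V := R_CompleteNormedModule) (fun u => Im (f u)) (fun u => Im (g u))); assumption.
Qed.

Lemma CInt_scal c f : cont01 f -> CInt (fun u => c * f u)%C = (c * CInt f)%C.
Proof.
  intros Hf. destruct (cont01_ex_RInt _ Hf) as [HR HI].
  assert (S : forall k (g : R -> R), ex_RInt g 0 1 -> is_RInt (fun u => k * g u) 0 1 (k * RInt g 0 1)).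
  { intros k g Hg. apply (is_RInt_scal (V := R_NormedModule)), (RInt_correct (V := R_CompleteNormedModule)), Hg. }
  apply C_eq; simpl; apply is_RInt_unique.
  - apply (is_RInt_minus (V := R_NormedModule) (fun u => Re c * Re (f u)) (fun u => Im c * Im (f u))); apply S; assumption.
  - apply (is_RInt_plus (V := R_NormedModule) (fun u => Re c * Im (f u)) (fun u => Im c * Re (f u))); apply S; assumption.
Qed.

Lemma Cmod_CInt_le f M : cont01 f -> (forall t, 0 <= t <= 1 -> Cmod (f t) <= M) -> Cmod (CInt f) <= M.
Proof.
  intros Hf HM.
  assert (M0 : 0 <= M) by (generalize (HM 0 ltac:(lra)) (Cmod_ge_0 (f 0)); lra).
  apply Cmod_le_of_Re_bound; [|exact M0].
  set (w := CInt f). unfold w at 2. rewrite <- CInt_scal by exact Hf. simpl.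
  assert (Hc := cont01_scal (Cconj w) f Hf).
  replace (Cmod w * M) with (RInt (fun _ => Cmod w * M) 0 1).
  - apply RInt_le; [lra|apply (cont01_ex_RInt _ Hc)|apply ex_RInt_const|].
    intros t Ht. eapply Rle_trans; [apply (Re_le_Cmod (Cconj w * f t)%C)|].
    rewrite Cmod_mult, Cmod_conj. apply Rmult_le_compat_l; [apply Cmod_ge_0|apply HM; lra].
  - rewrite RInt_const. unfold scal; simpl; unfold mult; simpl. ring.
Qed.

(** * Euler-Maclaurin terms *)

Definition em_term (b : R -> R) (y : R) (s : C) : C :=
  CInt (fun u => RtoC (b u) * Rcpow (y + u) (- s))%C.
Definition em_series (b : R -> R) (a : R) (s : C) : C :=
  CSeries (fun n => em_term b (a + INR n) s).

Lemma cont_RC_Rcpow y s t : 0 < y + t -> cont_RC (fun u => Rcpow (y + u) s) t.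
Proof. intros H. eapply is_derive_RC_cont, is_derive_RC_Rcpow, H. Qed.

Lemma cont01_em (b : R -> R) y s : (forall t, 0 <= t <= 1 -> continuous b t) -> 1 <= y ->
  cont01 (fun u => RtoC (b u) * Rcpow (y + u) (- s))%C.
Proof.
  intros Hb Hy t Ht. apply cont_RC_mult.
  - apply cont_RC_RtoC, Hb, Ht.
  - apply cont_RC_Rcpow; lra.
Qed.

Lemma em_term_bound b B y s : (forall t, 0 <= t <= 1 -> continuous b t) ->
  (forall t, 0 <= t <= 1 -> Rabs (b t) <= B) -> 1 <= y -> 0 <= Re s ->
  Cmod (em_term b y s) <= B * Rpower y (- Re s).
Proof.
  intros Hb HB Hy Hs. apply Cmod_CInt_le; [now apply cont01_em|].
  intros t Ht. rewrite Cmod_mult, Cmod_R, Cmod_Rcpow.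
  replace (Re (- s)%C) with (- Re s) by (destruct s; reflexivity).
  apply Rmult_le_compat; [apply Rabs_pos|left; apply Rpower_pos|apply HB, Ht|].
  apply Rpower_le_base; [exact Hs|lra].
Qed.

Lemma ex_series_Rpower_shift a p : 1 < a -> 1 < p ->
  ex_series (fun n => Rpower (a + INR n) (- p)) /\
  Series (fun n => Rpower (a + INR n) (- p)) <= Rpower (a - 1) (- (p - 1)) / (p - 1).
Proof.
  intros Ha Hp.
  destruct (series_Rpower (p - 1) (a - 1)) as [A B]; [lra|lra|].
  assert (E : forall i, Rpower (a - 1 + INR i + 1) (- (p - 1 + 1)) = Rpower (a + INR i) (- p)).
  { intros i; f_equal; ring. }
  split.
  - revert A; apply ex_series_ext, E.
  - rewrite (Series_ext _ _ E) in B. exact B.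
Qed.

Section EM.
Variables (b : R -> R) (B : R).
Hypothesis Hb : forall t, 0 <= t <= 1 -> continuous b t.
Hypothesis HB : forall t, 0 <= t <= 1 -> Rabs (b t) <= B.

Lemma em_bound_pos : 0 <= B.
Proof. generalize (HB 0 ltac:(lra)) (Rabs_pos (b 0)); lra. Qed.

Lemma em_summable a s : 1 < a -> 1 < Re s -> abs_summable (fun n => em_term b (a + INR n) s).
Proof.
  intros Ha Hs. apply abs_summable_le with (B := fun n => B * Rpower (a + INR n) (- Re s)).
  - intros n. apply em_term_bound; auto; [generalize (pos_INR n); lra|lra].
  - apply ex_series_scalR. now apply ex_series_Rpower_shift.
Qed.

Lemma em_series_bound a s : 1 < a -> 1 < Re s ->
  Cmod (em_series b a s) <= B * (Rpower (a - 1) (- (Re s - 1)) / (Re s - 1)).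
Proof.
  intros Ha Hs. destruct (ex_series_Rpower_shift a (Re s) Ha Hs) as [E L].
  apply Rle_trans with (Series (fun n => B * Rpower (a + INR n) (- Re s))).
  - apply Cmod_CSeries_le.
    + intros n. apply em_term_bound; auto; [generalize (pos_INR n); lra|lra].
    + now apply ex_series_scalR.
  - rewrite Series_scal_l. apply Rmult_le_compat_l; [apply em_bound_pos|exact L].
Qed.

Lemma em_series_shift a s : 1 < a -> 1 < Re s ->
  em_series b a s = (em_term b a s + em_series b (a + 1) s)%C.
Proof.
  intros Ha Hs. generalize (em_summable a s Ha Hs); intros A.
  assert (E : forall n, a + 1 + INR n = a + INR (S n)) by (intros n; rewrite S_INR; ring).
  unfold em_series. apply C_eq; simpl.
  - rewrite Series_incr_1 by (apply (abs_summable_Re _ A)). simpl.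
    rewrite Rplus_0_r. unfold Re. simpl. f_equal. apply Series_ext; intros n; now rewrite E.
  - rewrite Series_incr_1 by (apply (abs_summable_Im _ A)). simpl.
    rewrite Rplus_0_r. unfold Im. simpl. f_equal. apply Series_ext; intros n; now rewrite E.
Qed.

Lemma em_series_shift_n a s N : 1 < a -> 1 < Re s ->
  em_series b a s = (sumC (fun n => em_term b (a + INR n) s) N + em_series b (a + INR N) s)%C.
Proof.
  intros Ha Hs. induction N as [|N IH].
  - simpl. rewrite Rplus_0_r. ring.
  - rewrite IH. rewrite em_series_shift; [|generalize (pos_INR N); lra|exact Hs].
    rewrite S_INR. simpl sumC. replace (a + (INR N + 1)) with (a + INR N + 1) by ring. ring.
Qed.

Definition em_dterm (y : R) (s : C) : C :=
  CInt (fun u => RtoC (b u * - ln (y + u)) * Rcpow (y + u) (- s))%C.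

Lemma cont01_em_d y s : 1 <= y ->
  cont01 (fun u => RtoC (b u * - ln (y + u)) * Rcpow (y + u) (- s))%C.
Proof.
  intros Hy. apply cont01_em with (b := fun u => b u * - ln (y + u)); [|exact Hy].
  intros t Ht. apply (continuous_mult (K := R_AbsRing)); [now apply Hb|].
  apply (ex_derive_continuous (K := R_AbsRing) (V := R_NormedModule)). auto_derive. lra.
Qed.

Lemma em_quadratic y s h d : 1 <= y -> 0 < d -> Cmod h < d -> 2 * d <= Re s ->
  Cmod (em_term b y (s + h) - em_term b y s - h * em_dterm y s)%C <=
  B * (4 / d ^ 2) * Rpower y (- (Re s - 2 * d)) * Cmod h ^ 2.
Proof.
  intros Hy Hd Hh Hs.
  set (f1 := fun u => (RtoC (b u) * Rcpow (y + u) (- (s + h)))%C).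
  set (f2 := fun u => (RtoC (b u) * Rcpow (y + u) (- s))%C).
  set (f3 := fun u => (RtoC (b u * - ln (y + u)) * Rcpow (y + u) (- s))%C).
  assert (C1 : cont01 f1) by exact (cont01_em b y (s + h) Hb Hy).
  assert (C2 : cont01 (fun u => RtoC (-1) * f2 u)%C) by exact (cont01_scal _ f2 (cont01_em b y s Hb Hy)).
  assert (C3 : cont01 (fun u => - h * f3 u)%C) by exact (cont01_scal _ f3 (cont01_em_d y s Hy)).
  assert (C23 := cont01_plus _ _ C2 C3).
  replace (em_term b y (s + h) - em_term b y s - h * em_dterm y s)%C with
   (CInt (fun u => f1 u + (RtoC (-1) * f2 u + - h * f3 u))%C).
  2:{ rewrite (CInt_plus f1 _ C1 C23), (CInt_plus _ _ C2 C3).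
      rewrite (CInt_scal (RtoC (-1)) f2 (cont01_em b y s Hb Hy)), (CInt_scal (- h) f3 (cont01_em_d y s Hy)).
      unfold em_term, em_dterm. fold f1 f2 f3. apply C_eq; simpl; ring. }
  apply Cmod_CInt_le; [exact (cont01_plus _ _ C1 C23)|]. unfold f1, f2, f3.
  intros t Ht. set (L := ln (y + t)).
  assert (L0 : 0 <= L) by (unfold L; rewrite <- ln_1; apply ln_le; lra).
  replace (RtoC (b t) * Rcpow (y + t) (- (s + h)) + (RtoC (-1) * (RtoC (b t) * Rcpow (y + t) (- s)) +
      (- h) * (RtoC (b t * - L) * Rcpow (y + t) (- s))))%C with
    (RtoC (b t) * (Rcpow (y + t) (- s) * (Cexp (- h * RtoC L) - 1 - (- h * RtoC L))))%C.
  2:{ replace (- (s + h))%C with (- s + - h)%C by ring. rewrite Rcpow_plus.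
      change (Rcpow (y + t) (- h)) with (Cexp (- h * RtoC L)%C).
      rewrite RtoC_mult, !RtoC_opp. generalize (Cexp (- h * RtoC L)). intros; ring. }
  rewrite !Cmod_mult, Cmod_R, Cmod_Rcpow.
  replace (Re (- s)%C) with (- Re s) by (destruct s; reflexivity).
  assert (Q := Cexp_quadratic_bound (- h * RtoC L)%C).
  rewrite Cmod_mult, Cmod_opp, Cmod_RtoC_pos in Q by exact L0.
  replace (B * (4 / d ^ 2) * Rpower y (- (Re s - 2 * d)) * Cmod h ^ 2) with
    (B * (Rpower y (- (Re s - 2 * d)) * ((4 / d ^ 2) * Cmod h ^ 2))) by ring.
  apply Rmult_le_compat; [apply Rabs_pos|apply Rmult_le_pos; [left; apply Rpower_pos|apply Cmod_ge_0]|now apply HB|].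
  apply Rle_trans with (Rpower (y + t) (- (Re s - 2 * d)) * ((4 / d ^ 2) * Cmod h ^ 2)).
  2:{ apply Rmult_le_compat_r; [|apply Rpower_le_base; lra].
      apply Rmult_le_pos; [|apply pow_le, Cmod_ge_0]. apply Rdiv_le_0_compat; [lra|now apply pow_lt]. }
  replace (Rpower (y + t) (- (Re s - 2 * d))) with (Rpower (y + t) (- Re s) * (exp (d * L) * exp (d * L))).
  2:{ unfold Rpower. fold L. rewrite <- !exp_plus. f_equal. ring. }
  rewrite Rmult_assoc. apply Rmult_le_compat_l; [left; apply Rpower_pos|].
  eapply Rle_trans; [exact Q|].
  assert (E1 : exp (Cmod h * L) <= exp (d * L)) by (apply exp_le; nra).
  assert (E2 : L ^ 2 <= 4 / d ^ 2 * exp (d * L)).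
  { assert (G : d * L / 2 <= exp (d * L / 2)) by (generalize (exp_ineq1_le (d * L / 2)); lra).
    assert (G2 : (d * L / 2) ^ 2 <= exp (d * L)).
    { replace (exp (d * L)) with (exp (d * L / 2) * exp (d * L / 2)) by (rewrite <- exp_plus; f_equal; field).
      assert (0 <= d * L / 2) by nra. nra. }
    replace (L ^ 2) with (4 / d ^ 2 * (d * L / 2) ^ 2) by (field; lra).
    apply Rmult_le_compat_l; [|exact G2]. apply Rdiv_le_0_compat; [lra|now apply pow_lt]. }
  replace ((Cmod h * L) ^ 2) with (Cmod h ^ 2 * L ^ 2) by ring.
  apply Rle_trans with (Cmod h ^ 2 * (4 / d ^ 2 * exp (d * L)) * exp (d * L)); [|right; ring].
  apply Rmult_le_compat; [|left; apply exp_pos| |exact E1].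
  - apply Rmult_le_pos; apply pow2_ge_0.
  - apply Rmult_le_compat_l; [apply pow2_ge_0|exact E2].
Qed.

Lemma em_dterm_bound y s d : 1 <= y -> 0 < d -> d <= Re s ->
  Cmod (em_dterm y s) <= B / d * Rpower y (- (Re s - d)).
Proof.
  intros Hy Hd Hs. apply Cmod_CInt_le; [now apply cont01_em_d|].
  intros t Ht. rewrite Cmod_mult, Cmod_R, Cmod_Rcpow, Rabs_mult.
  replace (Re (- s)%C) with (- Re s) by (destruct s; reflexivity).
  assert (L0 : 0 <= ln (y + t)) by (rewrite <- ln_1; apply ln_le; lra).
  rewrite (Rabs_Ropp (ln (y + t))), (Rabs_pos_eq (ln (y + t))) by exact L0.
  apply Rle_trans with (B * (Rpower (y + t) (- (Re s - d)) / d)).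
  - rewrite Rmult_assoc. apply Rmult_le_compat; [apply Rabs_pos| |now apply HB|].
    + apply Rmult_le_pos; [exact L0|left; apply Rpower_pos].
    + replace (Rpower (y + t) (- (Re s - d))) with (exp (d * ln (y + t)) * Rpower (y + t) (- Re s)).
      2:{ unfold Rpower. rewrite <- exp_plus. f_equal. ring. }
      unfold Rdiv. rewrite Rmult_assoc, (Rmult_comm (Rpower _ _)), <- Rmult_assoc.
      apply Rmult_le_compat_r; [left; apply Rpower_pos|].
      apply Rmult_le_reg_r with d; [exact Hd|]. rewrite Rmult_assoc, Rinv_l by lra.
      generalize (exp_ineq1_le (d * ln (y + t))). lra.
  - unfold Rdiv. rewrite (Rmult_comm (Rpower _ _)), <- Rmult_assoc.
    apply Rmult_le_compat_l.
    + apply Rmult_le_pos; [apply em_bound_pos|left; now apply Rinv_0_lt_compat].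
    + apply Rpower_le_base; lra.
Qed.

Lemma em_series_derive a s : 1 < a -> 1 < Re s ->
  @is_derive C_AbsRing C_NormedModule (em_series b a) s (CSeries (fun n => em_dterm (a + INR n) s)).
Proof.
  intros Ha Hs. set (d := (Re s - 1) / 4). assert (Hd : 0 < d) by (unfold d; lra).
  assert (Ey : forall n, 1 <= a + INR n) by (intros n; generalize (pos_INR n); lra).
  apply is_derive_C_of_quadratic_bound with (d := d)
    (K := Series (fun n => B * (4 / d ^ 2) * Rpower (a + INR n) (- (Re s - 2 * d)))); [exact Hd|].
  intros h Hh.
  assert (Rh : Rabs (Re h) <= Cmod h) by apply re_le_Cmod.
  apply Rabs_le_between in Rh.
  assert (Sh : 1 < Re (s + h)%C).
  { replace (Re (s + h)%C) with (Re s + Re h) by (destruct s, h; reflexivity). unfold d in *; lra. }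
  assert (A1 := em_summable a (s + h) Ha Sh). assert (A2 := em_summable a s Ha Hs).
  assert (A3 : abs_summable (fun n => em_dterm (a + INR n) s)).
  { apply abs_summable_le with (B := fun n => B / d * Rpower (a + INR n) (- (Re s - d))).
    - intros n. apply em_dterm_bound; auto. unfold d; lra.
    - apply ex_series_scalR. apply ex_series_Rpower_shift; unfold d; lra. }
  unfold em_series.
  rewrite <- CSeries_scal by exact A3.
  rewrite <- CSeries_minus by assumption.
  rewrite <- CSeries_minus.
  - rewrite <- Series_scal_r. apply Cmod_CSeries_le.
    + intros n. apply em_quadratic; auto. unfold d; lra.
    + apply (ex_series_scal_r (Cmod h ^ 2)). apply ex_series_scalR.
      apply ex_series_Rpower_shift; unfold d; lra.
  - apply abs_summable_plus; [exact A1|].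
    apply abs_summable_le with (2 := A2). intros n; rewrite Cmod_opp; lra.
  - now apply abs_summable_scal.
Qed.
End EM.

(** * Analytic continuation *)

Lemma RtoC_m1 : RtoC (-1) = (- RtoC 1)%C.
Proof. apply C_eq; simpl; ring. Qed.

(* [bern k] is B_(k+1)(x) / (k+1)! *)
Fixpoint bern (k : nat) : R -> R :=
  match k with
  | O => fun x => x - 1 / 2
  | S j => fun x => RInt (bern j) 0 x - RInt (fun t => RInt (bern j) 0 t) 0 1
  end.

Lemma RInt_derive_continuous (f : R -> R) x : (forall t, continuous f t) ->
  is_derive (fun x => RInt f 0 x) x (f x).
Proof.
  intros H. apply (is_derive_RInt (V := R_NormedModule) f _ 0); [|apply H].
  exists (mkposreal 1 Rlt_0_1). intros y _. apply (RInt_correct (V := R_CompleteNormedModule)).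
  apply (ex_RInt_continuous (V := R_CompleteNormedModule)). intros; apply H.
Qed.

Lemma bern_continuous k x : continuous (bern k) x.
Proof.
  revert x; induction k as [|k IH]; intros x.
  - apply (ex_derive_continuous (K := R_AbsRing) (V := R_NormedModule)). simpl. auto_derive. trivial.
  - apply (ex_derive_continuous (K := R_AbsRing) (V := R_NormedModule)).
    exists (bern k x - 0). simpl.
    apply (is_derive_minus (fun x => RInt (bern k) 0 x) (fun _ => RInt (fun t => RInt (bern k) 0 t) 0 1)).
    + now apply RInt_derive_continuous.
    + apply (is_derive_const (K := R_AbsRing) (V := R_NormedModule)).
Qed.

Lemma bern_derive k x : is_derive (bern (S k)) x (bern k x).
Proof.
  replace (bern k x) with (bern k x - 0) by ring. simpl.
  apply (is_derive_minus (fun x => RInt (bern k) 0 x) (fun _ => RInt (fun t => RInt (bern k) 0 t) 0 1)).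
  - apply RInt_derive_continuous, bern_continuous.
  - apply (is_derive_const (K := R_AbsRing) (V := R_NormedModule)).
Qed.

Lemma bern_integral_0 k : RInt (bern k) 0 1 = 0.
Proof.
  destruct k as [|k].
  - apply is_RInt_unique. replace 0 with ((1 ^ 2 / 2 - 1 / 2 * 1) - (0 ^ 2 / 2 - 1 / 2 * 0)) at 2 by field.
    apply (is_RInt_derive (V := R_CompleteNormedModule) (fun x => x ^ 2 / 2 - 1 / 2 * x)).
    + intros x _. simpl. auto_derive; trivial. field.
    + intros x _. apply (bern_continuous 0).
  - simpl. rewrite (RInt_minus (V := R_CompleteNormedModule) (fun x => RInt (bern k) 0 x)).
    + rewrite RInt_const. unfold minus, plus, opp, scal; simpl. unfold mult; simpl. ring.
    + apply (ex_RInt_continuous (V := R_CompleteNormedModule)). intros x _.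
      apply (ex_derive_continuous (K := R_AbsRing) (V := R_NormedModule)).
      exists (bern k x). apply RInt_derive_continuous, bern_continuous.
    + apply ex_RInt_const.
Qed.

Lemma bern_periodic k : bern (S k) 1 = bern (S k) 0.
Proof.
  simpl. rewrite bern_integral_0, RInt_point. reflexivity.
Qed.

Lemma bern_bounded k : exists B, forall t, 0 <= t <= 1 -> Rabs (bern k t) <= B.
Proof.
  assert (H : forall x, continuity_pt (fun t => Rabs (bern k t)) x).
  { intros x. apply continuity_pt_filterlim. apply (continuous_comp (bern k) Rabs); [apply bern_continuous|].
    apply continuous_Rabs. }
  destruct (continuity_ab_maj (fun t => Rabs (bern k t)) 0 1) as [M [HM _]]; [lra|intros; apply H|].
  exists (Rabs (bern k M)). exact HM.
Qed.

Lemma bern_0_bound t : 0 <= t <= 1 -> Rabs (bern 0 t) <= 1 / 2.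
Proof. intros H; simpl. apply Rabs_le; lra. Qed.

Lemma em_term_by_parts k y s : 1 <= y ->
  em_term (bern k) y s =
  (s * em_term (bern (S k)) y (s + 1) +
    RtoC (bern (S k) 0) * (Rcpow (y + 1) (- s) - Rcpow y (- s)))%C.
Proof.
  intros Hy.
  assert (C1 := cont01_em (bern k) y s (fun t _ => bern_continuous k t) Hy).
  assert (C2 := cont01_em (bern (S k)) y (s + 1) (fun t _ => bern_continuous (S k) t) Hy).
  assert (D : CInt (fun u => RtoC (bern k u) * Rcpow (y + u) (- s) +
      (- s) * (RtoC (bern (S k) u) * Rcpow (y + u) (- (s + 1))))%C =
    (RtoC (bern (S k) 1) * Rcpow (y + 1) (- s) - RtoC (bern (S k) 0) * Rcpow (y + 0) (- s))%C).
  { apply (CInt_derive (fun u => RtoC (bern (S k) u) * Rcpow (y + u) (- s))%C).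
    - intros t Ht.
      replace (- s * (RtoC (bern (S k) t) * Rcpow (y + t) (- (s + 1))))%C with
       (RtoC (bern (S k) t) * (- s * Rcpow (y + t) (- s - 1)))%C.
      + apply (is_derive_RC_mult (fun u => RtoC (bern (S k) u)) (fun u => Rcpow (y + u) (- s))).
        * apply is_derive_RC_RtoC. apply bern_derive.
        * apply is_derive_RC_Rcpow. lra.
      + replace (- s - 1)%C with (- (s + 1))%C by ring. ring.
    - apply cont01_plus; [exact C1|now apply cont01_scal]. }
  rewrite CInt_plus, CInt_scal in D.
  - rewrite Rplus_0_r, bern_periodic in D. unfold em_term.
    replace (CInt (fun u : R => (bern k u * Rcpow (y + u) (- s))%C)) with
     ((CInt (fun u : R => (bern k u * Rcpow (y + u) (- s))%C) +
     - s * CInt (fun u : R => (bern (S k) u * Rcpow (y + u) (- (s + 1)))%C)) +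
      s * CInt (fun u : R => (bern (S k) u * Rcpow (y + u) (- (s + 1)))%C))%C by ring.
    rewrite D. ring.
  - exact C2.
  - exact C1.
  - now apply cont01_scal.
Qed.

Lemma em_term_base y s : 1 <= y -> s <> RtoC 1 ->
  Rcpow y (- s) = ((Rcpow (y + 1) (1 - s) - Rcpow y (1 - s)) / (1 - s) +
    RtoC (1 / 2) * (Rcpow y (- s) - Rcpow (y + 1) (- s)) - s * em_term (bern 0) y (s + 1))%C.
Proof.
  intros Hy Hs.
  assert (Hs' : (1 - s)%C <> 0%C).
  { intros E. apply Hs. replace s with (1 - (1 - s))%C by ring. rewrite E. ring. }
  assert (C2 := cont01_em (bern 0) y (s + 1) (fun t _ => bern_continuous 0 t) Hy).
  assert (D : (s * em_term (bern 0) y (s + 1))%C =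
    (- (RtoC (bern 0 1) * Rcpow (y + 1) (- s)) + / (1 - s) * Rcpow (y + 1) (1 - s) -
     (- (RtoC (bern 0 0) * Rcpow (y + 0) (- s)) + / (1 - s) * Rcpow (y + 0) (1 - s)))%C).
  { unfold em_term. rewrite <- CInt_scal by exact C2.
    apply (CInt_derive (fun u => (- (RtoC (bern 0 u) * Rcpow (y + u) (- s)) + / (1 - s) * Rcpow (y + u) (1 - s)))%C).
    - intros t Ht.
      replace (s * (RtoC (bern 0 t) * Rcpow (y + t) (- (s + 1))))%C with
        ((0 * (RtoC (bern 0 t) * Rcpow (y + t) (- s)) + RtoC (-1) *
          (RtoC 1 * Rcpow (y + t) (- s) + RtoC (bern 0 t) * (- s * Rcpow (y + t) (- s - 1)))) +
         (0 * Rcpow (y + t) (1 - s) + / (1 - s) * ((1 - s) * Rcpow (y + t) (1 - s - 1))))%C.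
      + apply is_derive_RC_plus.
        * apply is_derive_RC_ext with (f := fun u => (RtoC (-1) * (RtoC (bern 0 u) * Rcpow (y + u) (- s)))%C).
          { intros u. rewrite RtoC_m1. ring. }
          apply (is_derive_RC_mult (fun _ => RtoC (-1)) (fun u => RtoC (bern 0 u) * Rcpow (y + u) (- s))%C);
            [apply is_derive_RC_const|].
          apply (is_derive_RC_mult (fun u => RtoC (bern 0 u)) (fun u => Rcpow (y + u) (- s))).
          -- apply (is_derive_RC_RtoC (bern 0)). change (is_derive (fun x : R => x - 1 / 2) t 1). auto_derive; [trivial|ring].
          -- apply is_derive_RC_Rcpow. lra.
        * apply (is_derive_RC_mult (fun _ => / (1 - s))%C (fun u => Rcpow (y + u) (1 - s))).
          -- apply is_derive_RC_const.
          -- apply is_derive_RC_Rcpow. lra.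
      + replace (- s - 1)%C with (- (s + 1))%C by ring. replace (1 - s - 1)%C with (- s)%C by ring.
        rewrite RtoC_m1. field. exact Hs'.
    - now apply cont01_scal. }
  rewrite D, Rplus_0_r. simpl bern.
  replace (1 - 1 / 2) with (1 / 2) by field. replace (0 - 1 / 2) with (- (1 / 2)) by field.
  rewrite RtoC_opp.
  replace (Rcpow y (- s)) with (RtoC (1 / 2) * Rcpow y (- s) + RtoC (1 / 2) * Rcpow y (- s))%C at 1.
  - field. exact Hs'.
  - apply C_eq; simpl; field.
Qed.

(* [d] integrations by parts applied to the k-th Euler-Maclaurin series: this reaches Re s > - (k + d). *)
Definition em_cont (a : R) : nat -> nat -> C -> C :=
  fix F (d k : nat) (s : C) : C :=
  match d with
  | O => em_series (bern k) a (s + RtoC (INR k + 1))%C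
  | S j => ((s + RtoC (INR k + 1)) * F j (S k) s -
            RtoC (bern (S k) 0) * Rcpow a (- (s + RtoC (INR k + 1))))%C
  end.

Lemma Re_plus_RtoC (s : C) x : Re (s + RtoC x)%C = Re s + x.
Proof. reflexivity. Qed.

Lemma is_lim_Rpower_0 a p : 0 < a -> 0 < p -> is_lim_seq (fun n => Rpower (a + INR n) (- p)) 0.
Proof.
  intros Ha Hp.
  apply is_lim_seq_ext_loc with (u := fun n => exp (- p * ln (a + INR n))).
  { exists O; intros; reflexivity. }
  apply (is_lim_comp_seq exp (fun n => - p * ln (a + INR n)) m_infty 0 is_lim_exp_m).
  { exists O; intros n _; discriminate. }
  apply is_lim_seq_ext with (u := fun n => - p * ln (a + INR n)); [reflexivity|].
  replace m_infty with (Rbar_mult (- p) p_infty).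
  2:{ simpl. destruct (Rle_dec 0 (- p)); [exfalso; lra|reflexivity]. }
  apply is_lim_seq_scal_l.
  apply (is_lim_comp_seq ln (fun n => a + INR n) p_infty p_infty is_lim_ln_p).
  { exists O; intros n _; discriminate. }
  eapply is_lim_seq_plus; [apply is_lim_seq_const|apply is_lim_seq_INR|reflexivity].
Qed.

Definition is_lim_seqC (u : nat -> C) (l : C) : Prop := is_lim_seq (fun n => Cmod (u n - l)%C) 0.

Lemma is_lim_seqC_unique u l m : is_lim_seqC u l -> is_lim_seqC u m -> l = m.
Proof.
  intros H H'.
  assert (L : is_lim_seq (fun n => Cmod (u n - l)%C + Cmod (u n - m)%C) (0 + 0)) by now apply is_lim_seq_plus'.
  assert (E : Cmod (l - m)%C <= 0 + 0).
  { apply (is_lim_seq_le (fun _ => Cmod (l - m)%C) (fun n => Cmod (u n - l)%C + Cmod (u n - m)%C) (Cmod (l - m)%C) (0 + 0)).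
    - intros n. replace (l - m)%C with ((u n - m) - (u n - l))%C by ring.
      rewrite Rplus_comm. apply Cmod_triangle_minus.
    - apply is_lim_seq_const.
    - exact L. }
  assert (Z : Cmod (l - m)%C = 0) by (generalize (Cmod_ge_0 (l - m)%C); lra).
  apply Cmod_eq_0 in Z. replace l with (l - m + m)%C by ring. rewrite Z. ring.
Qed.

Lemma em_series_lim b B a s : (forall t, 0 <= t <= 1 -> continuous b t) ->
  (forall t, 0 <= t <= 1 -> Rabs (b t) <= B) -> 1 < a -> 1 < Re s ->
  is_lim_seqC (fun N => sumC (fun n => em_term b (a + INR n) s) N) (em_series b a s).
Proof.
  intros Hb HB Ha Hs.
  apply is_lim_seq_le_le with (u := fun _ => 0)
    (w := fun N => B * / (Re s - 1) * Rpower (a - 1 + INR N) (- (Re s - 1))).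
  - intros N; split; [apply Cmod_ge_0|].
    rewrite (em_series_shift_n b B Hb HB a s N Ha Hs).
    replace (_ - _)%C with (- em_series b (a + INR N) s)%C by ring.
    rewrite Cmod_opp. eapply Rle_trans.
    + apply (em_series_bound b B Hb HB); [generalize (pos_INR N); lra|exact Hs].
    + replace (a + INR N - 1) with (a - 1 + INR N) by ring. right; field; lra.
  - apply is_lim_seq_const.
  - replace (Finite 0) with (Rbar_mult (B * / (Re s - 1)) 0) by (simpl; now rewrite Rmult_0_r).
    apply is_lim_seq_scal_l. apply is_lim_Rpower_0; lra.
Qed.

Lemma is_lim_seqC_plus u v l m : is_lim_seqC u l -> is_lim_seqC v m ->
  is_lim_seqC (fun n => u n + v n)%C (l + m)%C.
Proof.
  intros H H'. apply is_lim_seq_le_le with (u := fun _ => 0) (w := fun n => Cmod (u n - l)%C + Cmod (v n - m)%C).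
  - intros n; split; [apply Cmod_ge_0|]. replace (u n + v n - (l + m))%C with ((u n - l) + (v n - m))%C by ring.
    apply Cmod_triangle.
  - apply is_lim_seq_const.
  - replace (Finite 0) with (Finite (0 + 0)) by (f_equal; ring). now apply is_lim_seq_plus'.
Qed.

Lemma is_lim_seqC_scal c u l : is_lim_seqC u l -> is_lim_seqC (fun n => c * u n)%C (c * l)%C.
Proof.
  intros H. unfold is_lim_seqC. apply is_lim_seq_ext with (u := fun n => Cmod c * Cmod (u n - l)%C).
  - intros n. rewrite <- Cmod_mult. f_equal. ring.
  - replace (Finite 0) with (Rbar_mult (Cmod c) 0) by (simpl; now rewrite Rmult_0_r).
    now apply is_lim_seq_scal_l.
Qed.

Lemma is_lim_seqC_const c : is_lim_seqC (fun _ => c) c.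
Proof.
  apply is_lim_seq_ext with (u := fun _ => 0); [|apply is_lim_seq_const].
  intros _. replace (c - c)%C with (RtoC 0) by ring. now rewrite Cmod_0.
Qed.

Lemma is_lim_seqC_ext u v l : (forall n, u n = v n) -> is_lim_seqC u l -> is_lim_seqC v l.
Proof. intros E. apply is_lim_seq_ext. intros n; now rewrite E. Qed.

Lemma is_lim_seqC_Rcpow_0 a s : 0 < a -> Re s < 0 -> is_lim_seqC (fun n => Rcpow (a + INR n) s) 0.
Proof.
  intros Ha Hs. apply is_lim_seq_ext with (u := fun n => Rpower (a + INR n) (- - Re s)).
  - intros n. replace (Rcpow (a + INR n) s - 0)%C with (Rcpow (a + INR n) s) by ring.
    rewrite Cmod_Rcpow. f_equal; ring.
  - apply is_lim_Rpower_0; lra.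
Qed.

Lemma em_series_step k a s : 1 < a -> 1 < Re s ->
  em_series (bern k) a s =
  (s * em_series (bern (S k)) a (s + 1) - RtoC (bern (S k) 0) * Rcpow a (- s))%C.
Proof.
  intros Ha Hs.
  destruct (bern_bounded k) as [B HB], (bern_bounded (S k)) as [B' HB'].
  assert (L1 := em_series_lim (bern k) B a s (fun t _ => bern_continuous k t) HB Ha Hs).
  assert (Hs' : 1 < Re (s + 1)%C) by (rewrite Re_plus_RtoC; lra).
  assert (L2 := em_series_lim (bern (S k)) B' a (s + 1) (fun t _ => bern_continuous (S k) t) HB' Ha Hs').
  apply (is_lim_seqC_unique _ _ _ L1).
  assert (L3 : is_lim_seqC (fun n => Rcpow (a + INR n) (- s)) 0).
  { apply is_lim_seqC_Rcpow_0; [lra|]. destruct s; simpl in *; lra. }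
  replace (s * em_series (bern (S k)) a (s + 1) - bern (S k) 0 * Rcpow a (- s))%C with
   (s * em_series (bern (S k)) a (s + 1) + RtoC (bern (S k) 0) * (0 + RtoC (-1) * Rcpow a (- s)))%C
   by (rewrite RtoC_m1; ring).
  apply is_lim_seqC_ext with (u := fun N => (s * sumC (fun n => em_term (bern (S k)) (a + INR n) (s + 1)) N +
    RtoC (bern (S k) 0) * (Rcpow (a + INR N) (- s) + RtoC (-1) * Rcpow a (- s)))%C).
  - intros N. induction N as [|N IH].
    + simpl. rewrite Rplus_0_r, RtoC_m1. ring.
    + cbn [sumC]. rewrite <- IH. rewrite (em_term_by_parts k) by (generalize (pos_INR N); lra).
      rewrite S_INR. replace (a + (INR N + 1)) with (a + INR N + 1) by ring. ring.
  - apply is_lim_seqC_plus; apply is_lim_seqC_scal; [exact L2|].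
    apply is_lim_seqC_plus; [exact L3|apply is_lim_seqC_const].
Qed.

Lemma em_cont_step a d k s : 1 < a -> - INR (k + d) < Re s ->
  em_cont a d k s = em_cont a (S d) k s.
Proof.
  intros Ha. revert k. induction d as [|d IH]; intros k Hs.
  - simpl em_cont. rewrite Nat.add_0_r in Hs. rewrite em_series_step; [|exact Ha|rewrite Re_plus_RtoC; lra].
    replace (s + RtoC (INR k + 1) + 1)%C with (s + RtoC (INR (S k) + 1))%C; [reflexivity|].
    rewrite S_INR. rewrite (RtoC_plus (INR k + 1)). ring.
  - assert (IH' := IH (S k)). rewrite Nat.add_succ_comm in IH'.
    specialize (IH' Hs). cbn [em_cont] in IH' |- *. now rewrite IH'.
Qed.

Lemma em_cont_stable a d e k s : 1 < a -> (d <= e)%nat -> - INR (k + d) < Re s ->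
  em_cont a d k s = em_cont a e k s.
Proof.
  intros Ha Hde Hs. induction Hde as [|e Hde IH]; [reflexivity|].
  rewrite IH. apply em_cont_step; [exact Ha|].
  apply Rle_lt_trans with (2 := Hs). apply Ropp_le_contravar, le_INR. lia.
Qed.

Definition em_depth (s : C) : nat := Z.to_nat (up (Rabs (Re s)) + 1).

Lemma em_depth_spec s : 1 - Re s < INR (em_depth s).
Proof.
  unfold em_depth. destruct (archimed (Rabs (Re s))) as [H _].
  assert (P := Rabs_pos (Re s)).
  assert (0 <= up (Rabs (Re s)) + 1)%Z by (apply le_IZR; rewrite plus_IZR; lra).
  rewrite INR_IZR_INZ, Z2Nat.id by assumption. rewrite plus_IZR.
  generalize (Rle_abs (- Re s)). rewrite Rabs_Ropp. lra.
Qed.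

Definition em_entire (a : R) (s : C) : C := em_cont a (em_depth s) 0 s.

Lemma em_entire_eq a d s : 1 < a -> - INR d < Re s -> em_entire a s = em_cont a d 0 s.
Proof.
  intros Ha Hd. unfold em_entire. generalize (em_depth_spec s); intros P.
  destruct (Nat.le_ge_cases d (em_depth s)) as [H|H].
  - symmetry. apply em_cont_stable; assumption.
  - apply em_cont_stable; [assumption..|simpl; lra].
Qed.

Definition hurwitz (al : R) (s : C) : C :=
  (Rcpow al (- s) + Rcpow (1 + al) (1 - s) / (s - 1) + RtoC (1 / 2) * Rcpow (1 + al) (- s)
   - s * em_entire (1 + al) s)%C.

Definition em_rem (a : R) (s : C) : C :=
  (Rcpow a (1 - s) / (s - 1) + RtoC (1 / 2) * Rcpow a (- s) - s * em_series (bern 0) a (s + 1))%C.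

Lemma C_neq_1 (s : C) : s <> RtoC 1 -> (s - 1)%C <> 0%C.
Proof. intros H E. apply H. replace s with (s - 1 + 1)%C by ring. rewrite E. ring. Qed.

Lemma C_neq_1' (s : C) : s <> RtoC 1 -> (1 - s)%C <> 0%C.
Proof. intros H E. apply H. replace s with (1 - (1 - s))%C by ring. rewrite E. ring. Qed.

Lemma em_rem_step a s : 1 < a -> 0 < Re s -> s <> RtoC 1 ->
  em_rem a s = (Rcpow a (- s) + em_rem (a + 1) s)%C.
Proof.
  intros Ha Hs H1. unfold em_rem.
  rewrite (em_series_shift (bern 0) (1 / 2) (fun t _ => bern_continuous 0 t) bern_0_bound a (s + 1) Ha)
    by (rewrite Re_plus_RtoC; lra).
  assert (E := em_term_base a s ltac:(lra) H1).
  set (J := em_term (bern 0) a (s + 1)) in *.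
  assert (E2 : (s * J)%C = ((Rcpow (a + 1) (1 - s) - Rcpow a (1 - s)) / (1 - s) +
      RtoC (1 / 2) * (Rcpow a (- s) - Rcpow (a + 1) (- s)) - Rcpow a (- s))%C).
  { rewrite E at 2. ring. }
  rewrite Cmult_plus_distr_l, E2. field. split; (now apply C_neq_1') || now apply C_neq_1.
Qed.

Lemma hurwitz_rem al s : 0 < al -> 0 < Re s ->
  hurwitz al s = (Rcpow al (- s) + em_rem (1 + al) s)%C.
Proof.
  intros Ha Hs. unfold hurwitz, em_rem. rewrite (em_entire_eq (1 + al) 0); [|lra|simpl; lra].
  cbn [em_cont]. replace (INR 0 + 1) with 1 by (simpl; ring). ring.
Qed.

Lemma hurwitz_em al s N : 0 < al -> 0 < Re s -> s <> RtoC 1 ->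
  hurwitz al s = (sumC (fun n => Rcpow (INR n + al) (- s)) (S N) + em_rem (INR (S N) + al) s)%C.
Proof.
  intros Ha Hs H1. induction N as [|N IH].
  - rewrite hurwitz_rem by assumption. simpl. rewrite Rplus_0_l. ring.
  - rewrite IH. cbn [sumC]. rewrite (em_rem_step (INR (S N) + al)); trivial.
    + rewrite (S_INR (S N)). replace (INR (S N) + al + 1) with (INR (S N) + 1 + al) by ring. ring.
    + rewrite S_INR. generalize (pos_INR N). lra.
Qed.

Lemma em_rem_lim al s : 0 < al -> 1 < Re s ->
  is_lim_seqC (fun N => em_rem (INR (S N) + al) s) 0.
Proof.
  intros Ha Hs.
  assert (E : forall N, INR (S N) + al = 1 + al + INR N) by (intros; rewrite S_INR; ring).
  assert (Hs1 : 1 < Re (s + 1)%C) by (rewrite Re_plus_RtoC; lra).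
  replace (RtoC 0) with (/ (s - 1) * 0 + (RtoC (1 / 2) * 0 + - s * 0))%C by ring.
  apply is_lim_seqC_ext with (u := fun N => (/ (s - 1) * Rcpow (1 + al + INR N) (1 - s) +
    (RtoC (1 / 2) * Rcpow (1 + al + INR N) (- s) + - s * em_series (bern 0) (1 + al + INR N) (s + 1)))%C).
  { intros N. rewrite E. unfold em_rem, Cdiv. ring. }
  apply is_lim_seqC_plus; [|apply is_lim_seqC_plus]; apply is_lim_seqC_scal.
  - apply is_lim_seqC_Rcpow_0; [lra|]. destruct s; simpl in *; lra.
  - apply is_lim_seqC_Rcpow_0; [lra|]. destruct s; simpl in *; lra.
  - apply is_lim_seq_le_le with (u := fun _ => 0)
      (w := fun N => 1 / 2 * / (Re (s + 1)%C - 1) * Rpower (al + INR N) (- (Re (s + 1)%C - 1))).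
    + intros N; split; [apply Cmod_ge_0|].
      replace (_ - 0)%C with (em_series (bern 0) (1 + al + INR N) (s + 1)) by ring.
      eapply Rle_trans.
      * apply (em_series_bound (bern 0) (1 / 2) (fun t _ => bern_continuous 0 t) bern_0_bound); [generalize (pos_INR N); lra|exact Hs1].
      * replace (1 + al + INR N - 1) with (al + INR N) by ring. right; field; lra.
    + apply is_lim_seq_const.
    + replace (Finite 0) with (Rbar_mult (1 / 2 * / (Re (s + 1)%C - 1)) 0) by (simpl; now rewrite Rmult_0_r).
      apply is_lim_seq_scal_l. apply is_lim_Rpower_0; lra.
Qed.

Lemma sum_n_sumC (f : nat -> C) n : @sum_n C_AbelianMonoid f n = sumC f (S n).
Proof.
  induction n as [|n IH].
  - rewrite sum_O. simpl. now rewrite Cplus_0_l.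
  - rewrite sum_Sn, IH. reflexivity.
Qed.

Lemma is_series_of_lim (f : nat -> C) l : is_lim_seqC (fun N => sumC f (S N)) l ->
  @is_series C_AbsRing C_NormedModule f l.
Proof.
  intros H. apply filterlim_locally. intros eps.
  apply is_lim_seq_spec in H. destruct (H eps) as [N HN].
  exists N. intros n Hn. change (ball l eps (@sum_n C_AbelianMonoid f n)). rewrite sum_n_sumC. apply C_NormedModule_mixin_compat1.
  specialize (HN n Hn). rewrite Rminus_0_r, Rabs_pos_eq in HN by apply Cmod_ge_0. exact HN.
Qed.

Lemma hurwitz_series al s : 0 < al -> 1 < Re s ->
  @is_series C_AbsRing C_NormedModule (fun n => Rcpow (INR n + al) (- s)%C) (hurwitz al s).
Proof.
  intros Ha Hs. apply is_series_of_lim.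
  assert (H1 : s <> RtoC 1) by (intros ->; simpl in Hs; lra).
  replace (hurwitz al s) with (hurwitz al s + - (1) * 0)%C by ring.
  apply is_lim_seqC_ext with (u := fun N => (hurwitz al s + - (1) * em_rem (INR (S N) + al) s)%C).
  - intros N. rewrite (hurwitz_em al s N) by (assumption || lra). ring.
  - apply is_lim_seqC_plus; [apply is_lim_seqC_const|].
    apply is_lim_seqC_scal, em_rem_lim; assumption.
Qed.

Definition ex_derC (f : C -> C) (s : C) : Prop := @ex_derive C_AbsRing C_NormedModule f s.

Lemma ex_derC_plus f g s : ex_derC f s -> ex_derC g s -> ex_derC (fun z => f z + g z)%C s.
Proof.
  intros [a A] [b B]. exists (a + b)%C.
  apply (is_derive_plus (K := C_AbsRing) (V := C_NormedModule) f g s a b A B).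
Qed.
(* Coquelicot puts two normed module structures on C, with the same norm but different balls. *)
Lemma is_derive_C_AbsRing (f : C -> C) (s l : C) :
  @is_derive C_AbsRing C_NormedModule f s l <->
  @is_derive C_AbsRing (AbsRing_NormedModule C_AbsRing) f s l.
Proof.
  split; intros [_ H]; (split; [apply is_linear_scal_l|exact H]).
Qed.

Lemma ex_derC_mult f g s : ex_derC f s -> ex_derC g s -> ex_derC (fun z => f z * g z)%C s.
Proof.
  intros [a A] [b B]. apply is_derive_C_AbsRing in A, B. eexists. apply is_derive_C_AbsRing.
  apply (is_derive_mult (K := C_AbsRing) f g s a b A B). apply Cmult_comm.
Qed.
Lemma ex_derC_const c s : ex_derC (fun _ => c) s.
Proof. exists zero. apply (is_derive_const (K := C_AbsRing) (V := C_NormedModule)). Qed.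
Lemma ex_derC_id s : ex_derC (fun z => z) s.
Proof. exists one. apply is_derive_C_AbsRing, (is_derive_id (K := C_AbsRing)). Qed.
Lemma ex_derC_ext f g s : (forall z, f z = g z) -> ex_derC f s -> ex_derC g s.
Proof. intros E [l L]. exists l. revert L. apply is_derive_ext, E. Qed.

Lemma ex_derC_Rcpow_opp x c s : ex_derC (fun z => Rcpow x (c - z)) s.
Proof.
  set (L := - ln x).
  exists (RtoC L * Rcpow x (c - s))%C.
  apply is_derive_C_of_quadratic_bound with (d := 1) (K := Rpower x (Re (c - s)%C) * (L ^ 2 * exp (Rabs L))); [lra|].
  intros h Hh.
  replace (Rcpow x (c - (s + h)) - Rcpow x (c - s) - h * (RtoC L * Rcpow x (c - s)))%C with
    (Rcpow x (c - s) * (Cexp (h * RtoC L) - 1 - h * RtoC L))%C.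
  - rewrite Cmod_mult, Cmod_Rcpow, Rmult_assoc. apply Rmult_le_compat_l; [left; apply Rpower_pos|].
    eapply Rle_trans; [apply Cexp_quadratic_bound|]. rewrite Cmod_mult, Cmod_R.
    replace ((Cmod h * Rabs L) ^ 2) with (L ^ 2 * Cmod h ^ 2) by (rewrite Rpow_mult_distr, <- (pow2_abs L); ring).
    assert (exp (Cmod h * Rabs L) <= exp (Rabs L)) by (apply exp_le; generalize (Rabs_pos L); nra).
    assert (0 <= L ^ 2 * Cmod h ^ 2) by (apply Rmult_le_pos; apply pow2_ge_0).
    nra.
  - replace (c - (s + h))%C with (c - s + - h)%C by ring. rewrite Rcpow_plus.
    replace (Rcpow x (- h)) with (Cexp (h * RtoC L)); [ring|].
    unfold Rcpow, L. f_equal. rewrite RtoC_opp. ring.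
Qed.

Lemma ex_derC_inv s : s <> RtoC 1 -> ex_derC (fun z => / (z - 1))%C s.
Proof.
  intros H. assert (H0 := C_neq_1 s H). set (w := (s - 1)%C) in *.
  assert (P : 0 < Cmod w) by now apply Cmod_gt_0.
  exists (- / (w * w))%C.
  apply is_derive_C_of_quadratic_bound with (d := Cmod w / 2) (K := 2 / Cmod w ^ 3); [lra|].
  intros h Hh.
  assert (Q : Cmod w / 2 <= Cmod (w + h)%C).
  { assert (Cmod w <= Cmod (w + h)%C + Cmod h); [|lra].
    replace w with ((w + h) - h)%C at 1 by ring. apply Cmod_triangle_minus. }
  assert (H2 : (w + h)%C <> 0%C) by (apply Cmod_gt_0; lra).
  change (s - 1)%C with w.
  replace (s + h - 1)%C with (w + h)%C by (unfold w; ring).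
  replace (/ (w + h) - / w - h * - / (w * w))%C with (h * h * / (w * w * (w + h)))%C by (field; split; assumption).
  rewrite !Cmod_mult, Cmod_inv by (repeat apply Cmult_neq_0; assumption). rewrite !Cmod_mult.
  replace (2 / Cmod w ^ 3 * Cmod h ^ 2) with (Cmod h * Cmod h * (2 / Cmod w ^ 3)) by ring.
  apply Rmult_le_compat_l; [apply Rmult_le_pos; apply Cmod_ge_0|].
  replace (2 / Cmod w ^ 3) with (/ (Cmod w * Cmod w * (Cmod w / 2))) by (field; lra).
  apply Rinv_le_contravar; [apply Rmult_lt_0_compat; nra|]. apply Rmult_le_compat_l; nra.
Qed.

Lemma ex_derC_em_series k a c s : 1 < a -> 1 < Re (s + c)%C ->
  ex_derC (fun z => em_series (bern k) a (z + c)%C) s.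
Proof.
  intros Ha Hs. destruct (bern_bounded k) as [B HB].
  assert (D := em_series_derive (bern k) B (fun t _ => bern_continuous k t) HB a _ Ha Hs).
  eexists. apply (is_derive_comp (K := C_AbsRing) (V := C_NormedModule) (em_series (bern k) a) (fun z => z + c)%C s _ one D).
  replace one with (plus one zero : C_AbsRing) by apply plus_zero_r.
  apply (is_derive_plus (K := C_AbsRing) (V := AbsRing_NormedModule C_AbsRing) (fun z => z) (fun _ => c)).
  - apply (is_derive_id (K := C_AbsRing)).
  - apply (is_derive_const (K := C_AbsRing) (V := AbsRing_NormedModule C_AbsRing)).
Qed.

Lemma ex_derC_em_cont a d k s : 1 < a -> - INR (k + d) < Re s -> ex_derC (em_cont a d k) s.
Proof.
  intros Ha. revert k. induction d as [|d IH]; intros k Hs.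
  - rewrite Nat.add_0_r in Hs. apply ex_derC_em_series; [exact Ha|rewrite Re_plus_RtoC; lra].
  - rewrite <- Nat.add_succ_comm in Hs. specialize (IH (S k) Hs).
    apply ex_derC_ext with (f := fun z => ((z + RtoC (INR k + 1)) * em_cont a d (S k) z +
            - RtoC (bern (S k) 0) * Rcpow a (- RtoC (INR k + 1) - z))%C).
    + intros z. cbn [em_cont]. replace (- RtoC (INR k + 1) - z)%C with (- (z + RtoC (INR k + 1)))%C by ring. ring.
    + apply ex_derC_plus; apply ex_derC_mult.
      * apply ex_derC_plus; [apply ex_derC_id|apply ex_derC_const].
      * exact IH.
      * apply ex_derC_const.
      * apply ex_derC_Rcpow_opp.
Qed.

Lemma locally_C_ball (s : C) (P : C -> Prop) d : 0 < d -> (forall z, Cmod (z - s)%C < d -> P z) -> locally s P.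
Proof.
  intros Hd H. apply (locally_le_locally_norm (V := C_NormedModule)).
  exists (mkposreal d Hd). intros y Hy. apply H. exact Hy.
Qed.

Lemma ex_derC_em_entire a s : 1 < a -> ex_derC (em_entire a) s.
Proof.
  intros Ha.
  assert (D := em_depth_spec s).
  assert (E := ex_derC_em_cont a (em_depth s) 0 s Ha ltac:(simpl; lra)).
  revert E. apply ex_derive_ext_loc.
  apply locally_C, locally_C_ball with (d := 1); [lra|].
  intros z Hz. symmetry. apply em_entire_eq; [exact Ha|].
  generalize (re_le_Cmod (z - s)%C). replace (Re (z - s)%C) with (Re z - Re s) by (destruct z, s; reflexivity).
  intros H. assert (H' := Rle_lt_trans _ _ _ H Hz). apply Rabs_lt_between in H'. lra.
Qed.

Lemma ex_derC_regular_part al s : 0 < al ->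
  ex_derC (fun s => Rcpow al (- s) + RtoC (1 / 2) * Rcpow (1 + al) (- s) - s * em_entire (1 + al) s)%C s.
Proof.
  intros Ha.
  apply ex_derC_ext with (f := fun z => (Rcpow al (0 - z) + RtoC (1 / 2) * Rcpow (1 + al) (0 - z) +
     - (1) * (z * em_entire (1 + al) z))%C).
  { intros z. replace (0 - z)%C with (- z)%C by ring. ring. }
  apply ex_derC_plus; [apply ex_derC_plus|].
  - apply ex_derC_Rcpow_opp.
  - apply ex_derC_mult; [apply ex_derC_const|apply ex_derC_Rcpow_opp].
  - apply ex_derC_mult; [apply ex_derC_const|]. apply ex_derC_mult; [apply ex_derC_id|].
    apply ex_derC_em_entire; lra.
Qed.

Lemma hurwitz_is_zeta al : 0 < al -> is_Hurwitz_zeta al (hurwitz al).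
Proof.
  intros Ha. split; [|split].
  - intros s Hs. now apply hurwitz_series.
  - intros s Hs. assert (P := C_neq_1 s Hs). apply Cmod_gt_0 in P.
    apply locally_C_ball with (d := Cmod (s - 1)%C); [exact P|].
    intros z Hz.
    assert (Hz1 : z <> RtoC 1).
    { intros ->. rewrite Cmod_minus_sym in Hz. lra. }
    apply ex_derC_ext with (f := fun s => (Rcpow (1 + al) (1 - s) * / (s - 1) +
      (Rcpow al (- s) + RtoC (1 / 2) * Rcpow (1 + al) (- s) - s * em_entire (1 + al) s))%C).
    { intros w. unfold hurwitz, Cdiv. ring. }
    apply ex_derC_plus; [|now apply ex_derC_regular_part].
    apply ex_derC_mult; [apply ex_derC_Rcpow_opp|now apply ex_derC_inv].
  - exists 1%nat. exists (fun s => (Rcpow (1 + al) (1 - s) + (s - 1) *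
      (Rcpow al (- s) + RtoC (1 / 2) * Rcpow (1 + al) (- s) - s * em_entire (1 + al) s))%C).
    split.
    + apply locally_C_ball with (d := 1); [lra|]. intros z _.
      apply ex_derC_plus; [apply ex_derC_Rcpow_opp|].
      apply ex_derC_mult; [|now apply ex_derC_regular_part].
      apply ex_derC_plus; [apply ex_derC_id|apply ex_derC_const].
    + apply locally_C_ball with (d := 1); [lra|]. intros z _ Hz.
      unfold hurwitz. simpl Cpow. field. now apply C_neq_1.
Qed.

(** * Size of the Euler-Maclaurin remainder *)

Lemma ln_nonneg x : 1 <= x -> 0 <= ln x.
Proof. intros H. rewrite <- ln_1. apply ln_le; lra. Qed.

Lemma ln_le_Rpower x d : 0 < d -> ln x <= / d * Rpower x d.
Proof.
  intros Hd. apply Rmult_le_reg_l with d; [exact Hd|].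
  rewrite <- Rmult_assoc, Rinv_r, Rmult_1_l by lra.
  unfold Rpower. generalize (exp_ineq1_le (d * ln x)). lra.
Qed.

Lemma Rpower_le_exp x p q : 1 <= x -> p <= q -> Rpower x p <= Rpower x q.
Proof. intros Hx H. apply exp_le. generalize (ln_nonneg x Hx). nra. Qed.

Lemma Rpower_le_base_pos x y p : 0 <= p -> 0 < x <= y -> Rpower x p <= Rpower y p.
Proof.
  intros Hp [Hx Hxy]. apply exp_le.
  assert (ln x <= ln y) by (apply ln_le; lra). nra.
Qed.

Lemma Rcpow_lipschitz a (s s' : C) M : 1 <= a -> Re s <= M -> Re s' <= M ->
  Cmod (Rcpow a s - Rcpow a s')%C <= Cmod (s - s')%C * (ln a * Rpower a M).
Proof.
  intros Ha Hs Hs'. assert (L0 := ln_nonneg a Ha).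
  set (D := Cmod (s - s')%C * (ln a * Rpower a M)).
  assert (H := mean_value_RC (fun t => Rcpow a (s' + RtoC t * (s - s')))
    (fun t => (s - s') * RtoC (ln a) * Rcpow a (s' + RtoC t * (s - s')))%C
    (fun t => t * D) (fun _ => D) 0 1). cbv beta in H.
  replace (s' + RtoC 1 * (s - s'))%C with s in H by ring.
  replace (s' + RtoC 0 * (s - s'))%C with s' in H by ring.
  replace (1 * D - 0 * D) with D in H by ring. apply H.
  - lra.
  - intros t Ht. unfold Rcpow at 1.
    replace ((s - s') * RtoC (ln a) * Rcpow a (s' + RtoC t * (s - s')))%C with
      ((((0 + (RtoC 1 * (s - s') + RtoC t * 0)) * RtoC (ln a) + (s' + RtoC t * (s - s')) * 0) *
       Cexp ((s' + RtoC t * (s - s')) * RtoC (ln a))))%C by (unfold Rcpow; ring).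
    apply (is_derive_RC_Cexp (fun u => (s' + RtoC u * (s - s')) * RtoC (ln a))%C).
    apply (is_derive_RC_mult (fun u => s' + RtoC u * (s - s'))%C (fun _ => RtoC (ln a))); [|apply is_derive_RC_const].
    apply (is_derive_RC_plus (fun _ => s') (fun u => RtoC u * (s - s'))%C); [apply is_derive_RC_const|].
    apply (is_derive_RC_mult RtoC (fun _ => s - s')%C); [|apply is_derive_RC_const].
    apply (is_derive_RC_RtoC (fun u => u)). apply (is_derive_id (K := R_AbsRing)).
  - intros t Ht. auto_derive; trivial. ring.
  - intros t Ht. rewrite !Cmod_mult, (Cmod_RtoC_pos _ L0), Cmod_Rcpow. unfold D. rewrite Rmult_assoc.
    apply Rmult_le_compat_l; [apply Cmod_ge_0|]. apply Rmult_le_compat_l; [exact L0|].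
    apply Rpower_le_exp; [exact Ha|].
    replace (Re (s' + RtoC t * (s - s'))%C) with (t * Re s + (1 - t) * Re s')
      by (destruct s, s'; simpl; ring).
    nra.
Qed.

Lemma em_term_lipschitz b B y (s s' : C) q d : (forall t, 0 <= t <= 1 -> continuous b t) ->
  (forall t, 0 <= t <= 1 -> Rabs (b t) <= B) -> 1 <= y -> 0 < d -> d <= q -> q <= Re s -> q <= Re s' ->
  Cmod (em_term b y s - em_term b y s')%C <= B * (Cmod (s - s')%C * (/ d * Rpower y (- (q - d)))).
Proof.
  intros Hb HB Hy Hd Hq Hs Hs'.
  assert (C1 := cont01_em b y s Hb Hy). assert (C2 := cont01_em b y s' Hb Hy).
  replace (em_term b y s - em_term b y s')%C with
    (CInt (fun u => RtoC (b u) * Rcpow (y + u) (- s) + RtoC (-1) * (RtoC (b u) * Rcpow (y + u) (- s')))%C).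
  2:{ rewrite CInt_plus, CInt_scal, RtoC_m1; [unfold em_term; ring|assumption..|].
      now apply cont01_scal. }
  apply Cmod_CInt_le.
  { apply cont01_plus; [exact C1|now apply cont01_scal]. }
  intros t Ht.
  replace (_ + _)%C with (RtoC (b t) * (Rcpow (y + t) (- s) - Rcpow (y + t) (- s')))%C
    by (rewrite RtoC_m1; ring).
  rewrite Cmod_mult, Cmod_R. apply Rmult_le_compat; [apply Rabs_pos|apply Cmod_ge_0|now apply HB|].
  eapply Rle_trans.
  - apply (Rcpow_lipschitz (y + t) (- s) (- s') (- q)); [lra|destruct s; simpl in *; lra|destruct s'; simpl in *; lra].
  - replace (- s - - s')%C with (- (s - s'))%C by ring. rewrite Cmod_opp.
    apply Rmult_le_compat_l; [apply Cmod_ge_0|].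
    apply Rle_trans with (/ d * Rpower (y + t) d * Rpower (y + t) (- q)).
    + apply Rmult_le_compat_r; [left; apply Rpower_pos|now apply ln_le_Rpower].
    + rewrite Rmult_assoc, <- Rpower_plus. replace (d + - q) with (- (q - d)) by ring.
      apply Rmult_le_compat_l; [left; now apply Rinv_0_lt_compat|]. apply Rpower_le_base; lra.
Qed.

Lemma em_series_lipschitz b B a (s s' : C) q d : (forall t, 0 <= t <= 1 -> continuous b t) ->
  (forall t, 0 <= t <= 1 -> Rabs (b t) <= B) -> 1 < a -> 0 < d -> 1 < q - d -> q <= Re s -> q <= Re s' ->
  Cmod (em_series b a s - em_series b a s')%C <=
   B * (Cmod (s - s')%C * (/ d * (Rpower (a - 1) (- (q - d - 1)) / (q - d - 1)))).
Proof.
  intros Hb HB Ha Hd Hq Hs Hs'. destruct (ex_series_Rpower_shift a (q - d) Ha Hq) as [E L].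
  unfold em_series. rewrite <- CSeries_minus by (apply (em_summable b B Hb HB); lra).
  apply Rle_trans with (Series (fun n => B * (Cmod (s - s')%C * (/ d * Rpower (a + INR n) (- (q - d)))))).
  - apply Cmod_CSeries_le.
    + intros n. apply em_term_lipschitz; auto; [generalize (pos_INR n)|]; lra.
    + do 3 apply ex_series_scalR. exact E.
  - rewrite !Series_scal_l. apply Rmult_le_compat_l; [apply (em_bound_pos b B HB)|].
    apply Rmult_le_compat_l; [apply Cmod_ge_0|].
    apply Rmult_le_compat_l; [left; now apply Rinv_0_lt_compat|exact L].
Qed.

(* Here [a - 1] is k^16 up to O(1) and heights are of order T = k^10: then T a^(-3/4) and a^(1/4) / T
   both tend to 0, while a^(1/2) is still o(T), as the mean square below requires. *)
Section Remainder.
Variables (k : nat) (a : R).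
Hypothesis Hk : (1 <= k)%nat.
Hypothesis Ha : INR k ^ 16 + 1 <= a <= INR k ^ 16 + 2.

Let K1 : 1 <= INR k.
Proof. apply (le_INR 1 k Hk). Qed.

Let K16 : 1 <= INR k ^ 16.
Proof. apply pow_R1_Rle, K1. Qed.

Lemma Rpower_k16 p : Rpower (INR k ^ 16) p = Rpower (INR k) (16 * p).
Proof.
  rewrite <- Rpower_pow by lra. rewrite Rpower_mult. f_equal. simpl. ring.
Qed.

Lemma em_cutoff_quarter : Rpower a (1 / 4) <= 3 * INR k ^ 4.
Proof.
  apply Rle_trans with (Rpower (81 * INR k ^ 16) (1 / 4)).
  - apply Rpower_le_base_pos; lra.
  - rewrite <- Rpower_mult_distr by lra. rewrite Rpower_k16.
    replace (16 * (1 / 4)) with (INR 4) by (simpl; lra). rewrite Rpower_pow by lra.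
    replace 81 with (3 ^ 4) by ring. rewrite <- Rpower_pow, Rpower_mult by lra.
    replace (INR 4 * (1 / 4)) with 1 by (simpl; lra). rewrite Rpower_1 by lra. lra.
Qed.

Lemma em_cutoff_neg p : 3 / 4 <= p -> Rpower (a - 1) (- p) <= / INR k ^ 12.
Proof.
  intros Hp. apply Rle_trans with (Rpower (INR k ^ 16) (- (3 / 4))).
  - eapply Rle_trans; [apply (Rpower_le_exp _ _ (- (3 / 4))); lra|]. apply Rpower_le_base; lra.
  - rewrite Rpower_k16. replace (16 * - (3 / 4)) with (- INR 12) by (simpl; lra).
    rewrite Rpower_Ropp, Rpower_pow by lra. lra.
Qed.

Definition em_region (s : C) : Prop :=
  13 / 16 <= Re s <= 15 / 16 /\ INR k ^ 10 <= Im s <= 3 * INR k ^ 10.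

Let K10 : 1 <= INR k ^ 10.
Proof. apply pow_R1_Rle, K1. Qed.

Lemma em_region_mod s : em_region s -> Cmod s <= 4 * INR k ^ 10 /\ INR k ^ 10 <= Cmod (s - 1)%C.
Proof.
  intros [Hr Hi]. split.
  - replace s with (RtoC (Re s) + Ci * RtoC (Im s))%C by (apply C_eq; destruct s; simpl; ring).
    eapply Rle_trans; [apply Cmod_triangle|]. rewrite Cmod_mult, Cmod_Ci, !Cmod_RtoC_pos by lra. lra.
  - generalize (im_le_Cmod (s - 1)%C). replace (Im (s - 1)%C) with (Im s) by (destruct s; simpl; ring).
    generalize (Rle_abs (Im s)). lra.
Qed.

Lemma inv_pow_k n m : (n <= m)%nat -> / INR k ^ m <= / INR k ^ n.
Proof. intros H. apply Rinv_le_contravar; [apply pow_lt; lra|apply Rle_pow; [exact K1|exact H]]. Qed.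

Lemma em_series_cutoff s : em_region s -> Cmod (em_series (bern 0) a (s + 1)) <= / INR k ^ 12.
Proof.
  intros [Hr Hi].
  assert (H := em_series_bound (bern 0) (1 / 2) (fun t _ => bern_continuous 0 t) bern_0_bound a (s + 1)
    ltac:(lra) ltac:(rewrite Re_plus_RtoC; lra)).
  rewrite Re_plus_RtoC in H. replace (Re s + 1 - 1) with (Re s) in H by ring.
  eapply Rle_trans; [exact H|].
  assert (H2 := em_cutoff_neg (Re s) ltac:(lra)).
  apply Rle_trans with (1 / 2 * (/ INR k ^ 12 * 2)); [|lra].
  apply Rmult_le_compat_l; [lra|]. unfold Rdiv.
  apply Rmult_le_compat; [left; apply Rpower_pos|left; apply Rinv_0_lt_compat; lra|exact H2|].
  replace 2 with (/ (1 / 2)) by field. apply Rinv_le_contravar; lra.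
Qed.

Lemma em_rem_small s : em_region s -> Cmod (em_rem a s) <= 10 / INR k.
Proof.
  intros Hs. destruct (em_region_mod s Hs) as [M1 M2]. assert (Sc := em_series_cutoff s Hs).
  destruct Hs as [Hr Hi]. unfold em_rem.
  assert (N0 : (s - 1)%C <> 0%C) by (apply Cmod_gt_0; lra).
  assert (I1 := inv_pow_k 1 2 ltac:(lia)). assert (I2 := inv_pow_k 1 12 ltac:(lia)).
  assert (I6 := inv_pow_k 1 6 ltac:(lia)). rewrite pow_1 in I1, I2, I6.
  eapply Rle_trans; [apply Cmod_triangle_minus|].
  assert (T1 : Cmod (Rcpow a (1 - s) / (s - 1))%C <= 3 * / INR k).
  { rewrite Cmod_div, Cmod_Rcpow by exact N0.
    replace (Re (1 - s)%C) with (1 - Re s) by (destruct s; simpl; ring).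
    apply Rle_trans with (3 * INR k ^ 4 * / INR k ^ 10).
    - apply Rmult_le_compat; [left; apply Rpower_pos|left; apply Rinv_0_lt_compat; lra| |apply Rinv_le_contravar; lra].
      eapply Rle_trans; [|apply em_cutoff_quarter]. apply Rpower_le_exp; lra.
    - replace (3 * INR k ^ 4 * / INR k ^ 10) with (3 * / INR k ^ 6) by (field; lra). lra. }
  assert (T2 : Cmod (RtoC (1 / 2) * Rcpow a (- s))%C <= / INR k).
  { rewrite Cmod_mult, Cmod_RtoC_pos, Cmod_Rcpow by lra.
    replace (Re (- s)%C) with (- Re s) by (destruct s; simpl; ring).
    assert (H := em_cutoff_neg (Re s) ltac:(lra)).
    assert (Rpower a (- Re s) <= Rpower (a - 1) (- Re s)) by (apply Rpower_le_base; lra).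
    generalize (Rpower_pos a (- Re s)). lra. }
  assert (T3 : Cmod (s * em_series (bern 0) a (s + 1))%C <= 4 * / INR k).
  { rewrite Cmod_mult.
    apply Rle_trans with (4 * INR k ^ 10 * / INR k ^ 12).
    - apply Rmult_le_compat; try apply Cmod_ge_0; assumption.
    - replace (4 * INR k ^ 10 * / INR k ^ 12) with (4 * / INR k ^ 2) by (field; lra). lra. }
  generalize (Cmod_triangle (Rcpow a (1 - s) / (s - 1))%C (RtoC (1 / 2) * Rcpow a (- s))%C).
  assert (0 < / INR k) by (apply Rinv_0_lt_compat; lra). unfold Rdiv. lra.
Qed.

Lemma em_rem_lipschitz s s' : em_region s -> em_region s' ->
  Cmod (em_rem a s - em_rem a s')%C <= 150 / INR k * Cmod (s - s')%C.
Proof.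
  intros Hs Hs'. destruct (em_region_mod s Hs) as [M1 M2]. destruct (em_region_mod s' Hs') as [M1' M2'].
  assert (Sc := em_series_cutoff s Hs). destruct Hs as [Hr Hi], Hs' as [Hr' Hi'].
  set (d := Cmod (s - s')%C). assert (d0 : 0 <= d) by apply Cmod_ge_0.
  assert (N0 : (s - 1)%C <> 0%C) by (apply Cmod_gt_0; lra).
  assert (N0' : (s' - 1)%C <> 0%C) by (apply Cmod_gt_0; lra).
  assert (P10 : 0 < / INR k ^ 10) by (apply Rinv_0_lt_compat; lra).
  assert (P1 : 0 < / INR k) by (apply Rinv_0_lt_compat; lra).
  assert (I1 := inv_pow_k 1 2 ltac:(lia)). assert (I2 := inv_pow_k 1 12 ltac:(lia)).
  assert (I6 := inv_pow_k 1 6 ltac:(lia)). assert (I16 := inv_pow_k 1 16 ltac:(lia)).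
  rewrite pow_1 in I1, I2, I6, I16.
  assert (J1 : / Cmod (s - 1)%C <= / INR k ^ 10) by (apply Rinv_le_contravar; lra).
  assert (J1' : / Cmod (s' - 1)%C <= / INR k ^ 10) by (apply Rinv_le_contravar; lra).
  assert (J0 : 0 <= / Cmod (s - 1)%C) by (left; apply Rinv_0_lt_compat; lra).
  assert (J0' : 0 <= / Cmod (s' - 1)%C) by (left; apply Rinv_0_lt_compat; lra).
  assert (La : ln a <= 16 * Rpower a (1 / 16)).
  { generalize (ln_le_Rpower a (1 / 16) ltac:(lra)). replace (/ (1 / 16)) with 16 by field. lra. }
  assert (T1 : Cmod (Rcpow a (1 - s) / (s - 1) - Rcpow a (1 - s') / (s' - 1))%C <= d * (51 * / INR k)).
  { replace (Rcpow a (1 - s) / (s - 1) - Rcpow a (1 - s') / (s' - 1))%C with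
     ((Rcpow a (1 - s) - Rcpow a (1 - s')) * / (s - 1) +
       Rcpow a (1 - s') * ((s' - s) * (/ (s - 1) * / (s' - 1))))%C by (field; split; assumption).
    eapply Rle_trans; [apply Cmod_triangle|]. rewrite !Cmod_mult, !Cmod_inv, Cmod_Rcpow by assumption.
    replace (Re (1 - s')%C) with (1 - Re s') by (destruct s'; simpl; ring).
    rewrite (Cmod_minus_sym s' s). fold d.
    assert (Q1 : Cmod (Rcpow a (1 - s) - Rcpow a (1 - s'))%C <= d * (48 * INR k ^ 4)).
    { eapply Rle_trans; [apply (Rcpow_lipschitz a _ _ (3 / 16)); [lra|destruct s; simpl in *; lra|destruct s'; simpl in *; lra]|].
      replace (1 - s - (1 - s'))%C with (- (s - s'))%C by ring. rewrite Cmod_opp. fold d.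
      apply Rmult_le_compat_l; [exact d0|].
      apply Rle_trans with (16 * Rpower a (1 / 16) * Rpower a (3 / 16)).
      - apply Rmult_le_compat_r; [left; apply Rpower_pos|exact La].
      - rewrite Rmult_assoc, <- Rpower_plus. replace (1 / 16 + 3 / 16) with (1 / 4) by field.
        generalize em_cutoff_quarter. lra. }
    assert (Q2 : Rpower a (1 - Re s') <= 3 * INR k ^ 4).
    { eapply Rle_trans; [|apply em_cutoff_quarter]. apply Rpower_le_exp; lra. }
    assert (Q3 : Cmod (Rcpow a (1 - s) - Rcpow a (1 - s'))%C * / Cmod (s - 1)%C <= d * (48 * / INR k)).
    { apply Rle_trans with (d * (48 * INR k ^ 4) * / INR k ^ 10).
      - apply Rmult_le_compat; auto; apply Cmod_ge_0.
      - replace (d * (48 * INR k ^ 4) * / INR k ^ 10) with (d * (48 * / INR k ^ 6)) by (field; lra).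
        apply Rmult_le_compat_l; lra. }
    assert (Q4 : Rpower a (1 - Re s') * (d * (/ Cmod (s - 1)%C * / Cmod (s' - 1)%C)) <= d * (3 * / INR k)).
    { apply Rle_trans with (3 * INR k ^ 4 * (d * (/ INR k ^ 10 * / INR k ^ 10))).
      - apply Rmult_le_compat; [left; apply Rpower_pos| |exact Q2|].
        + apply Rmult_le_pos; [exact d0|now apply Rmult_le_pos].
        + apply Rmult_le_compat_l; [exact d0|]. now apply Rmult_le_compat.
      - replace (3 * INR k ^ 4 * (d * (/ INR k ^ 10 * / INR k ^ 10))) with (d * (3 * / INR k ^ 16)) by (field; lra).
        apply Rmult_le_compat_l; lra. }
    lra. }
  assert (T2 : Cmod (RtoC (1 / 2) * (Rcpow a (- s) - Rcpow a (- s')))%C <= d * (8 * / INR k)).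
  { rewrite Cmod_mult, Cmod_RtoC_pos by lra.
    assert (Cmod (Rcpow a (- s) - Rcpow a (- s'))%C <= d * (16 * / INR k)); [|lra].
    eapply Rle_trans; [apply (Rcpow_lipschitz a _ _ (- (13 / 16))); [lra|destruct s; simpl in *; lra|destruct s'; simpl in *; lra]|].
    replace (- s - - s')%C with (- (s - s'))%C by ring. rewrite Cmod_opp. fold d.
    apply Rmult_le_compat_l; [exact d0|].
    apply Rle_trans with (16 * Rpower a (1 / 16) * Rpower a (- (13 / 16))).
    - apply Rmult_le_compat_r; [left; apply Rpower_pos|exact La].
    - rewrite Rmult_assoc, <- Rpower_plus. replace (1 / 16 + - (13 / 16)) with (- (3 / 4)) by field.
      generalize (em_cutoff_neg (3 / 4) ltac:(lra)).
      assert (Rpower a (- (3 / 4)) <= Rpower (a - 1) (- (3 / 4))) by (apply Rpower_le_base; lra). lra. }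
  assert (T3 : Cmod (s * em_series (bern 0) a (s + 1) - s' * em_series (bern 0) a (s' + 1))%C <= d * (65 * / INR k)).
  { replace (s * em_series (bern 0) a (s + 1) - s' * em_series (bern 0) a (s' + 1))%C with
     ((s - s') * em_series (bern 0) a (s + 1) + s' * (em_series (bern 0) a (s + 1) - em_series (bern 0) a (s' + 1)))%C by ring.
    eapply Rle_trans; [apply Cmod_triangle|]. rewrite !Cmod_mult. fold d.
    assert (Q1 : Cmod (em_series (bern 0) a (s + 1)) <= / INR k) by lra.
    assert (L := em_series_lipschitz (bern 0) (1 / 2) a (s + 1) (s' + 1) (29 / 16) (1 / 16)
      (fun t _ => bern_continuous 0 t) bern_0_bound ltac:(lra) ltac:(lra) ltac:(lra)
      ltac:(rewrite Re_plus_RtoC; lra) ltac:(rewrite Re_plus_RtoC; lra)).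
    replace (s + 1 - (s' + 1))%C with (s - s')%C in L by ring. fold d in L.
    replace (29 / 16 - 1 / 16 - 1) with (3 / 4) in L by field.
    assert (H2 := em_cutoff_neg (3 / 4) ltac:(lra)).
    assert (Q2 : Cmod (em_series (bern 0) a (s + 1) - em_series (bern 0) a (s' + 1))%C <= d * (16 * / INR k ^ 12)).
    { eapply Rle_trans; [exact L|].
      replace (1 / 2 * (d * (/ (1 / 16) * (Rpower (a - 1) (- (3 / 4)) / (3 / 4))))) with
       (d * (32 / 3 * Rpower (a - 1) (- (3 / 4)))) by field.
      apply Rmult_le_compat_l; [exact d0|]. generalize (Rpower_pos (a - 1) (- (3 / 4))); lra. }
    assert (Q3 : Cmod s' * Cmod (em_series (bern 0) a (s + 1) - em_series (bern 0) a (s' + 1))%C <= d * (64 * / INR k)).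
    { apply Rle_trans with (4 * INR k ^ 10 * (d * (16 * / INR k ^ 12))).
      - apply Rmult_le_compat; auto; apply Cmod_ge_0.
      - replace (4 * INR k ^ 10 * (d * (16 * / INR k ^ 12))) with (d * (64 * / INR k ^ 2)) by (field; lra).
        apply Rmult_le_compat_l; lra. }
    assert (Q4 : d * Cmod (em_series (bern 0) a (s + 1)) <= d * / INR k) by now apply Rmult_le_compat_l.
    lra. }
  unfold em_rem.
  match goal with |- Cmod ?x <= _ => replace x with
    ((Rcpow a (1 - s) / (s - 1) - Rcpow a (1 - s') / (s' - 1)) +
     RtoC (1 / 2) * (Rcpow a (- s) - Rcpow a (- s')) -
     (s * em_series (bern 0) a (s + 1) - s' * em_series (bern 0) a (s' + 1)))%C by ring end.
  eapply Rle_trans; [apply Cmod_triangle_minus|].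
  generalize (Cmod_triangle (Rcpow a (1 - s) / (s - 1) - Rcpow a (1 - s') / (s' - 1))%C
     (RtoC (1 / 2) * (Rcpow a (- s) - Rcpow a (- s')))%C).
  assert (0 <= d * / INR k) by (apply Rmult_le_pos; lra).
  unfold Rdiv. lra.
Qed.
End Remainder.

(** * A quadratic form controlling Dirichlet polynomials *)

Lemma sumR_plus f g n : sumR (fun i => f i + g i) n = sumR f n + sumR g n.
Proof. induction n as [|n IH]; simpl; [ring|rewrite IH; ring]. Qed.
Lemma sumC_plus f g n : sumC (fun i => f i + g i)%C n = (sumC f n + sumC g n)%C.
Proof. induction n as [|n IH]; simpl; [ring|rewrite IH; ring]. Qed.
Lemma sumC_minus f g n : sumC (fun i => f i - g i)%C n = (sumC f n - sumC g n)%C.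
Proof. induction n as [|n IH]; simpl; [ring|rewrite IH; ring]. Qed.
Lemma sumC_ext f g n : (forall i, (i < n)%nat -> f i = g i) -> sumC f n = sumC g n.
Proof.
  induction n as [|n IH]; simpl; intros H; [auto|].
  rewrite IH, H; auto; intros; apply H; lia.
Qed.
Lemma sumR_nonneg f n : (forall i, (i < n)%nat -> 0 <= f i) -> 0 <= sumR f n.
Proof.
  induction n as [|n IH]; simpl; intros H; [lra|].
  generalize (H n ltac:(lia)). assert (0 <= sumR f n) by (apply IH; intros; apply H; lia). lra.
Qed.
Lemma Cmod_sumC_le f n : Cmod (sumC f n) <= sumR (fun i => Cmod (f i)) n.
Proof.
  induction n as [|n IH]; simpl; [rewrite Cmod_0; lra|].
  eapply Rle_trans; [apply Cmod_triangle|]. lra.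
Qed.
Lemma Rabs_sumR_le f n : Rabs (sumR f n) <= sumR (fun i => Rabs (f i)) n.
Proof.
  induction n as [|n IH]; simpl; [rewrite Rabs_R0; lra|].
  eapply Rle_trans; [apply Rabs_triang|]. lra.
Qed.
Lemma sumR_swap (f : nat -> nat -> R) n m :
  sumR (fun i => sumR (fun j => f i j) m) n = sumR (fun j => sumR (fun i => f i j) n) m.
Proof.
  induction n as [|n IH]; simpl.
  - symmetry. induction m as [|m IHm]; simpl; [auto|rewrite IHm; ring].
  - rewrite IH, <- sumR_plus. reflexivity.
Qed.
Lemma sumC_first (f : nat -> C) n : sumC f (S n) = (f O + sumC (fun i => f (S i)) n)%C.
Proof. induction n as [|n IH]; [simpl; ring|]. cbn [sumC] in *. rewrite IH. ring. Qed.
Lemma sumC_swap (f : nat -> nat -> C) n m :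
  sumC (fun i => sumC (fun j => f i j) m) n = sumC (fun j => sumC (fun i => f i j) n) m.
Proof.
  induction n as [|n IH]; simpl.
  - symmetry. induction m as [|m IHm]; simpl; [auto|rewrite IHm; ring].
  - rewrite IH, <- sumC_plus. reflexivity.
Qed.

Lemma sumR_cauchy_schwarz x y n :
  (sumR (fun i => x i * y i) n) ^ 2 <= sumR (fun i => x i ^ 2) n * sumR (fun i => y i ^ 2) n.
Proof.
  induction n as [|n IH]; [simpl; lra|]. cbn [sumR].
  set (A := sumR (fun i => x i * y i) n) in *.
  set (S := sumR (fun i => x i ^ 2) n) in *. set (T := sumR (fun i => y i ^ 2) n) in *.
  assert (S0 : 0 <= S) by (apply sumR_nonneg; intros; apply pow2_ge_0).
  assert (T0 : 0 <= T) by (apply sumR_nonneg; intros; apply pow2_ge_0).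
  assert (H : 2 * A * (x n * y n) <= S * y n ^ 2 + T * x n ^ 2); [|nra].
  apply Rle_trans with (1 := Rle_abs _). apply Rsqr_incr_0_var.
  - rewrite <- Rsqr_abs. unfold Rsqr.
    assert (Q : A ^ 2 * (x n * y n) ^ 2 <= S * T * (x n * y n) ^ 2)
      by (apply Rmult_le_compat_r; [apply pow2_ge_0|exact IH]).
    generalize (pow2_ge_0 (S * y n ^ 2 - T * x n ^ 2)). simpl in Q |- *. nra.
  - generalize (pow2_ge_0 (x n)) (pow2_ge_0 (y n)). nra.
Qed.

Lemma Cmod_sum_sqr (b : nat -> C) (x : nat -> R) M :
  Cmod (sumC (fun n => b n * RtoC (x n))%C M) ^ 2 =
  sumR (fun n => sumR (fun m => Re (b n * Cconj (b m))%C * (x n * x m)) M) M.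
Proof.
  rewrite Cmod_sqr.
  assert (E1 : Re (sumC (fun n => b n * RtoC (x n))%C M) = sumR (fun n => Re (b n) * x n) M).
  { induction M as [|M IH]; simpl; [reflexivity|]. rewrite <- IH. unfold Re; simpl. ring. }
  assert (E2 : Im (sumC (fun n => b n * RtoC (x n))%C M) = sumR (fun n => Im (b n) * x n) M).
  { clear E1. induction M as [|M IH]; simpl; [reflexivity|]. rewrite <- IH. unfold Im; simpl. ring. }
  rewrite E1, E2. symmetry.
  transitivity (sumR (fun n => Re (b n) * x n * sumR (fun m => Re (b m) * x m) M +
     Im (b n) * x n * sumR (fun m => Im (b m) * x m) M) M).
  - apply sumR_ext. intros n _. rewrite <- !sumR_scal, <- sumR_plus. apply sumR_ext. intros m _.
    simpl. unfold Re, Im; simpl. ring.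
  - assert (F : forall f c, sumR (fun n => f n * c) M = sumR f M * c).
    { intros f c. rewrite (sumR_ext _ (fun n => c * f n)) by (intros; ring). rewrite sumR_scal. ring. }
    rewrite sumR_plus, !F. simpl. ring.
Qed.

(* By Taylor expansion at 0 and Cauchy-Schwarz, these weights make [quad_form kernel] dominate the
   derivative of a Dirichlet polynomial on the disc of radius 1/64, while the kernel stays
   positive semidefinite and of size at most exp ((|u| + |v|) / 32). *)
Definition kernel_coef (i : nat) : R := ((1 / 32) ^ i / INR (fact i)) ^ 2.
Definition kernel_trunc (J : nat) (x : R) : R := 1 + x * sumR (fun i => kernel_coef i * x ^ i) J.
Definition kernel (x : R) : R := 1 + x * Series (fun i => kernel_coef i * x ^ i).
Definition kernel_majorant (l : R) : R := (1 + Rabs l) * exp (Rabs l / 32).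

Lemma exp_partial_le x J : 0 <= x -> sumR (fun i => x ^ i / INR (fact i)) J <= exp x.
Proof.
  intros Hx. apply Rle_trans with (Series (fun i => x ^ i / INR (fact i))).
  - assert (E : is_series (fun i => x ^ i / INR (fact i)) (exp x)).
    { generalize (is_exp_Reals x). unfold is_pseries. apply is_series_ext. intros n.
      rewrite pow_n_pow. unfold scal; simpl. unfold mult; simpl. unfold Rdiv. ring. }
    rewrite (is_series_unique _ _ E).
    destruct J as [|J]; [simpl; left; apply exp_pos|].
    rewrite <- sum_n_sumR.
    apply (is_lim_seq_incr_compare _ _ E).
    intros n. rewrite sum_Sn. unfold plus; simpl.
    assert (0 <= x ^ S n / INR (fact (S n))); [|simpl in *; lra].
    apply Rdiv_le_0_compat; [now apply pow_le|apply INR_fact_lt_0].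
  - right. apply is_series_unique.
    generalize (is_exp_Reals x). unfold is_pseries. apply is_series_ext. intros n.
    rewrite pow_n_pow. unfold scal; simpl. unfold mult; simpl. unfold Rdiv. ring.
Qed.

Lemma sumR_prod_le f g n : (forall i, 0 <= f i) -> (forall i, 0 <= g i) ->
  sumR (fun i => f i * g i) n <= sumR f n * sumR g n.
Proof.
  intros F G. induction n as [|n IH]; simpl; [lra|].
  assert (0 <= sumR f n) by (apply sumR_nonneg; auto). assert (0 <= sumR g n) by (apply sumR_nonneg; auto).
  generalize (F n) (G n). nra.
Qed.

Lemma kernel_abs_partial u v J :
  sumR (fun i => Rabs (kernel_coef i * (u * v) ^ i)) J <= exp (Rabs u / 32) * exp (Rabs v / 32).
Proof.
  assert (N : forall w i, 0 <= (Rabs w / 32) ^ i / INR (fact i)).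
  { intros w i. apply Rdiv_le_0_compat; [|apply INR_fact_lt_0]. apply pow_le.
    generalize (Rabs_pos w); lra. }
  apply Rle_trans with (sumR (fun i => ((Rabs u / 32) ^ i / INR (fact i)) * ((Rabs v / 32) ^ i / INR (fact i))) J).
  - right. apply sumR_ext. intros i _.
    rewrite Rabs_mult, Rabs_pos_eq by apply pow2_ge_0. rewrite <- RPow_abs, Rabs_mult.
    unfold kernel_coef, Rdiv. rewrite !Rpow_mult_distr, !pow1. ring.
  - eapply Rle_trans; [apply sumR_prod_le; apply N|].
    apply Rmult_le_compat; try (apply sumR_nonneg; intros; apply N).
    + apply exp_partial_le. generalize (Rabs_pos u); lra.
    + apply exp_partial_le. generalize (Rabs_pos v); lra.
Qed.

Lemma kernel_ex_series x : ex_series (fun i => kernel_coef i * x ^ i).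
Proof.
  apply (ex_series_le (K := R_AbsRing) (V := R_CompleteNormedModule)) with
    (b := fun i => Rabs (kernel_coef i * (x * 1) ^ i)).
  - intros i. rewrite Rmult_1_r. apply Rle_refl.
  - eapply proj1. apply ex_series_bounded; [intros; apply Rabs_pos|].
    intros J. apply kernel_abs_partial.
Qed.

Lemma kernel_lim x : is_lim_seq (fun J => kernel_trunc J x) (kernel x).
Proof.
  unfold kernel_trunc, kernel.
  apply is_lim_seq_plus'; [apply is_lim_seq_const|].
  apply (is_lim_seq_scal_l _ x (Series (fun i => kernel_coef i * x ^ i))).
  apply is_lim_seq_incr_1.
  apply is_lim_seq_ext with (u := sum_n (fun i => kernel_coef i * x ^ i)).
  { intros n; apply sum_n_sumR. }
  apply (Series_correct _ (kernel_ex_series x)).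
Qed.

Lemma kernel_bound u v : Rabs (kernel (u * v)) <= kernel_majorant u * kernel_majorant v.
Proof.
  assert (H : forall J, Rabs (kernel_trunc J (u * v)) <= kernel_majorant u * kernel_majorant v).
  { intros J. unfold kernel_trunc, kernel_majorant.
    eapply Rle_trans; [apply Rabs_triang|]. rewrite Rabs_R1, !Rabs_mult.
    assert (P := Rle_trans _ _ _ (Rabs_sumR_le _ J) (kernel_abs_partial u v J)).
    assert (E : forall w, 1 <= exp (Rabs w / 32)) by (intros w; generalize (exp_ineq1_le (Rabs w / 32)) (Rabs_pos w); lra).
    generalize (E u) (E v) (Rabs_pos u) (Rabs_pos v) (Rabs_pos (sumR (fun i => kernel_coef i * (u * v) ^ i) J)).
    set (eu := exp (Rabs u / 32)) in *. set (ev := exp (Rabs v / 32)) in *.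
    set (S := Rabs (sumR _ J)) in *. intros.
    assert (1 <= eu * ev) by nra.
    assert (0 <= Rabs u * Rabs v) by nra.
    apply Rle_trans with (eu * ev + Rabs u * Rabs v * (eu * ev)); [nra|].
    replace ((1 + Rabs u) * eu * ((1 + Rabs v) * ev)) with
     (eu * ev + Rabs u * Rabs v * (eu * ev) + (Rabs u + Rabs v) * (eu * ev)) by ring.
    nra. }
  assert (L := kernel_lim (u * v)). apply is_lim_seq_abs in L.
  apply (is_lim_seq_le _ (fun _ => kernel_majorant u * kernel_majorant v) _ (kernel_majorant u * kernel_majorant v) H L).
  apply is_lim_seq_const.
Qed.

Definition quad_form (K : R -> R) (l : nat -> R) (b : nat -> C) (M : nat) : R :=
  sumR (fun n => sumR (fun m => Re (b n * Cconj (b m))%C * K (l n * l m)) M) M.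

Lemma quad_form_trunc J l b M :
  quad_form (kernel_trunc J) l b M =
  Cmod (sumC b M) ^ 2 +
  sumR (fun i => kernel_coef i * Cmod (sumC (fun n => b n * RtoC (l n ^ S i))%C M) ^ 2) J.
Proof.
  assert (E0 : Cmod (sumC b M) ^ 2 = sumR (fun n => sumR (fun m => Re (b n * Cconj (b m))%C) M) M).
  { rewrite (sumC_ext b (fun n => b n * RtoC 1)%C) by (intros; ring).
    rewrite (Cmod_sum_sqr b (fun _ => 1)). apply sumR_ext; intros n _; apply sumR_ext; intros m _; ring. }
  induction J as [|J IH].
  - change (sumR (fun i => kernel_coef i * Cmod (sumC (fun n => b n * RtoC (l n ^ S i))%C M) ^ 2) 0) with 0. rewrite Rplus_0_r, E0.
    apply sumR_ext; intros n _; apply sumR_ext; intros m _. unfold kernel_trunc; simpl sumR. ring.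
  - cbn [sumR]. rewrite <- Rplus_assoc, <- IH, Cmod_sum_sqr.
    rewrite <- sumR_scal. unfold quad_form. rewrite <- sumR_plus. apply sumR_ext; intros n _.
    rewrite <- sumR_scal, <- sumR_plus. apply sumR_ext; intros m _.
    unfold kernel_trunc. cbn [sumR]. rewrite !Rpow_mult_distr. simpl pow. ring.
Qed.

Lemma is_lim_seq_sumR (f : nat -> nat -> R) (g : nat -> R) M :
  (forall n, is_lim_seq (fun J => f J n) (g n)) -> is_lim_seq (fun J => sumR (f J) M) (sumR g M).
Proof.
  intros H. induction M as [|M IH]; simpl; [apply is_lim_seq_const|].
  apply is_lim_seq_plus'; [exact IH|apply H].
Qed.

Lemma quad_form_lim l b M : is_lim_seq (fun J => quad_form (kernel_trunc J) l b M) (quad_form kernel l b M).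
Proof.
  unfold quad_form.
  apply (is_lim_seq_sumR (fun J n => sumR (fun m => Re (b n * Cconj (b m))%C * kernel_trunc J (l n * l m)) M)).
  intros n. apply (is_lim_seq_sumR (fun J m => Re (b n * Cconj (b m))%C * kernel_trunc J (l n * l m))).
  intros m. apply (is_lim_seq_scal_l _ _ (kernel (l n * l m))). apply kernel_lim.
Qed.

Lemma quad_form_ge_sum l b M : Cmod (sumC b M) ^ 2 <= quad_form kernel l b M.
Proof.
  apply (is_lim_seq_le (fun _ => Cmod (sumC b M) ^ 2) (fun J => quad_form (kernel_trunc J) l b M)
     (Cmod (sumC b M) ^ 2) (quad_form kernel l b M)).
  - intros J. rewrite quad_form_trunc.
    assert (0 <= sumR (fun i => kernel_coef i * Cmod (sumC (fun n => b n * RtoC (l n ^ S i))%C M) ^ 2) J); [|lra].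
    apply sumR_nonneg. intros i _. apply Rmult_le_pos; apply pow2_ge_0.
  - apply is_lim_seq_const.
  - apply quad_form_lim.
Qed.

Lemma Cpow_lipschitz (z w : C) r i : Cmod z <= r -> Cmod w <= r ->
  Cmod (z ^ S i - w ^ S i)%C <= INR (S i) * r ^ i * Cmod (z - w)%C.
Proof.
  intros Hz Hw. assert (r0 : 0 <= r) by (generalize (Cmod_ge_0 z); lra).
  induction i as [|i IH].
  - simpl. rewrite !Cmult_1_r. lra.
  - replace (z ^ S (S i) - w ^ S (S i))%C with (z * (z ^ S i - w ^ S i) + (z - w) * w ^ S i)%C by (simpl; ring).
    eapply Rle_trans; [apply Cmod_triangle|]. rewrite !Cmod_mult, Cmod_pow.
    assert (Q : Cmod w ^ S i <= r ^ S i) by (apply pow_incr; split; [apply Cmod_ge_0|exact Hw]).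
    rewrite (S_INR (S i)).
    assert (P := Cmod_ge_0 (z - w)%C).
    apply Rle_trans with (r * (INR (S i) * r ^ i * Cmod (z - w)%C) + Cmod (z - w)%C * r ^ S i).
    + apply Rplus_le_compat; [|now apply Rmult_le_compat_l].
      apply Rmult_le_compat; auto; apply Cmod_ge_0.
    + right. simpl pow. ring.
Qed.

Definition dpoly (l : nat -> R) (b : nat -> C) (M : nat) (z : C) : C :=
  sumC (fun n => b n * Cexp (- z * RtoC (l n)))%C M.

Lemma geom_quarter J : sumR (fun i => ((1 / 2) ^ i) ^ 2) J <= 2.
Proof.
  assert (H : sumR (fun i => ((1 / 2) ^ i) ^ 2) J <= 2 - 4 / 3 * ((1 / 2) ^ J) ^ 2).
  { induction J as [|J IH]; cbn [sumR]; [simpl; lra|].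
    replace ((1 / 2) ^ S J) with (1 / 2 * (1 / 2) ^ J) by reflexivity.
    rewrite Rpow_mult_distr. lra. }
  generalize (pow2_ge_0 ((1 / 2) ^ J)). lra.
Qed.

Lemma dpoly_trunc_lipschitz l b M J z w : Cmod z <= 1 / 64 -> Cmod w <= 1 / 64 ->
  Cmod (sumC (fun n => b n * exp_trunc (S J) (- z * RtoC (l n)))%C M -
        sumC (fun n => b n * exp_trunc (S J) (- w * RtoC (l n)))%C M)%C ^ 2 <=
  2 * Cmod (z - w)%C ^ 2 * quad_form (kernel_trunc J) l b M.
Proof.
  intros Hz Hw. set (Ci := fun i => sumC (fun n => b n * RtoC (l n ^ i))%C M).
  assert (E : forall z, sumC (fun n => b n * exp_trunc (S J) (- z * RtoC (l n)))%C M =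
     sumC (fun i => RtoC (/ INR (fact i)) * (- z) ^ i * Ci i)%C (S J)).
  { intros x. unfold Ci.
    rewrite (sumC_ext (fun i => RtoC (/ INR (fact i)) * (- x) ^ i * sumC (fun n => b n * RtoC (l n ^ i)) M)%C
      (fun i => sumC (fun n => RtoC (/ INR (fact i)) * (- x) ^ i * (b n * RtoC (l n ^ i)))%C M)).
    2:{ intros i _. now rewrite sumC_scal. }
    rewrite sumC_swap. apply sumC_ext. intros n _. unfold exp_trunc.
    rewrite <- sumC_scal. apply sumC_ext. intros i _. rewrite Cpow_mult_l, <- RtoC_pow. ring. }
  rewrite !E, <- sumC_minus.
  rewrite sumC_first.
  set (d := Cmod (z - w)%C). assert (d0 : 0 <= d) by apply Cmod_ge_0.
  replace (_ + _)%C with (sumC (fun i => RtoC (/ INR (fact (S i))) * ((- z) ^ S i - (- w) ^ S i) * Ci (S i))%C J).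
  2:{ simpl. rewrite (sumC_ext _ (fun i => RtoC (/ INR (fact (S i))) * ((- z) ^ S i) * Ci (S i) -
         RtoC (/ INR (fact (S i))) * (- w) ^ S i * Ci (S i))%C) by (intros; simpl; ring). simpl. ring. }
  set (y := fun i => (1 / 32) ^ i / INR (fact i) * Cmod (Ci (S i))).
  assert (B1 : Cmod (sumC (fun i => RtoC (/ INR (fact (S i))) * ((- z) ^ S i - (- w) ^ S i) * Ci (S i))%C J) <=
     d * sumR (fun i => (1 / 2) ^ i * y i) J).
  { eapply Rle_trans; [apply Cmod_sumC_le|]. rewrite <- sumR_scal. apply sumR_le. intros i _.
    rewrite !Cmod_mult, Cmod_RtoC_pos by (left; apply Rinv_0_lt_compat, INR_fact_lt_0).
    assert (L := Cpow_lipschitz (- z) (- w) (1 / 64) i ltac:(now rewrite Cmod_opp) ltac:(now rewrite Cmod_opp)).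
    replace (- z - - w)%C with (- (z - w))%C in L by ring. rewrite Cmod_opp in L. fold d in L.
    unfold y. rewrite <- !Rmult_assoc. apply Rmult_le_compat_r; [apply Cmod_ge_0|].
    apply Rle_trans with (/ INR (fact (S i)) * (INR (S i) * (1 / 64) ^ i * d)).
    - apply Rmult_le_compat_l; [left; apply Rinv_0_lt_compat, INR_fact_lt_0|exact L].
    - right. rewrite fact_simpl, mult_INR.
      replace (1 / 64) with (1 / 2 * (1 / 32)) by field. rewrite Rpow_mult_distr.
      field. split; [apply INR_fact_neq_0|apply not_0_INR; lia]. }
  assert (CS := sumR_cauchy_schwarz (fun i => (1 / 2) ^ i) y J).
  assert (G := geom_quarter J).
  assert (Y0 : 0 <= sumR (fun i => y i ^ 2) J) by (apply sumR_nonneg; intros; apply pow2_ge_0).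
  assert (Y1 : sumR (fun i => y i ^ 2) J <= quad_form (kernel_trunc J) l b M).
  { rewrite quad_form_trunc.
    apply Rle_trans with (sumR (fun i => kernel_coef i * Cmod (sumC (fun n => b n * RtoC (l n ^ S i))%C M) ^ 2) J).
    - right. apply sumR_ext. intros i _. unfold y, kernel_coef, Ci. ring.
    - generalize (pow2_ge_0 (Cmod (sumC b M))); lra. }
  eapply Rle_trans; [apply pow_incr; split; [apply Cmod_ge_0|exact B1]|].
  rewrite Rpow_mult_distr.
  apply Rle_trans with (d ^ 2 * (2 * quad_form (kernel_trunc J) l b M)); [|right; ring].
  apply Rmult_le_compat_l; [apply pow2_ge_0|].
  eapply Rle_trans; [exact CS|].
  apply Rle_trans with (2 * sumR (fun i => y i ^ 2) J); [|lra].
  now apply Rmult_le_compat_r.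
Qed.

Lemma exp_trunc_lim z : is_lim_seqC (fun J => exp_trunc J z) (Cexp z).
Proof.
  apply is_lim_seq_le_le with (u := fun _ => 0) (w := fun J => exp (Cmod z) * (Cmod z ^ J / INR (fact J))).
  - intros J. split; [apply Cmod_ge_0|]. rewrite Cmod_minus_sym. rewrite Rmult_comm. apply Cexp_trunc_bound.
  - apply is_lim_seq_const.
  - replace (Finite 0) with (Rbar_mult (exp (Cmod z)) 0) by (simpl; now rewrite Rmult_0_r).
    apply is_lim_seq_scal_l. apply is_lim_seq_Reals, cv_speed_pow_fact.
Qed.

Lemma is_lim_seqC_sumC (f : nat -> nat -> C) (g : nat -> C) M :
  (forall n, is_lim_seqC (fun J => f J n) (g n)) -> is_lim_seqC (fun J => sumC (f J) M) (sumC g M).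
Proof.
  intros H. induction M as [|M IH]; simpl; [apply is_lim_seqC_const|].
  apply (is_lim_seqC_plus (fun J => sumC (f J) M)); [exact IH|apply H].
Qed.

Lemma is_lim_seqC_Cmod u l : is_lim_seqC u l -> is_lim_seq (fun n => Cmod (u n)) (Cmod l).
Proof.
  intros H. apply is_lim_seq_le_le with (u := fun n => Cmod l - Cmod (u n - l)%C) (w := fun n => Cmod l + Cmod (u n - l)%C).
  - intros n. generalize (Cmod_triangle (u n - l)%C l) (Cmod_triangle_minus (u n) (u n - l)%C).
    replace (u n - l + l)%C with (u n) by ring. replace (u n - (u n - l))%C with l by ring. lra.
  - replace (Finite (Cmod l)) with (Finite (Cmod l - 0)) by (f_equal; ring).
    apply is_lim_seq_minus'; [apply is_lim_seq_const|exact H].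
  - replace (Finite (Cmod l)) with (Finite (Cmod l + 0)) by (f_equal; ring).
    apply is_lim_seq_plus'; [apply is_lim_seq_const|exact H].
Qed.

Lemma dpoly_lipschitz l b M z w : Cmod z <= 1 / 64 -> Cmod w <= 1 / 64 ->
  Cmod (dpoly l b M z - dpoly l b M w)%C ^ 2 <= 2 * Cmod (z - w)%C ^ 2 * quad_form kernel l b M.
Proof.
  intros Hz Hw.
  assert (L : forall x, is_lim_seqC (fun J => sumC (fun n => b n * exp_trunc (S J) (- x * RtoC (l n)))%C M) (dpoly l b M x)).
  { intros x. apply (is_lim_seqC_sumC (fun J n => b n * exp_trunc (S J) (- x * RtoC (l n)))%C). intros n.
    apply is_lim_seqC_scal.
    apply (is_lim_seq_incr_1 (fun J => Cmod (exp_trunc J (- x * RtoC (l n)) - Cexp (- x * RtoC (l n)))%C)).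
    apply exp_trunc_lim. }
  assert (D : is_lim_seq (fun J => Cmod (sumC (fun n => b n * exp_trunc (S J) (- z * RtoC (l n)))%C M -
        sumC (fun n => b n * exp_trunc (S J) (- w * RtoC (l n)))%C M)%C ^ 2) (Cmod (dpoly l b M z - dpoly l b M w)%C ^ 2)).
  { assert (D0 : is_lim_seq (fun J => Cmod (sumC (fun n => b n * exp_trunc (S J) (- z * RtoC (l n)))%C M -
        sumC (fun n => b n * exp_trunc (S J) (- w * RtoC (l n)))%C M)%C) (Cmod (dpoly l b M z - dpoly l b M w)%C)).
    { apply is_lim_seqC_Cmod.
      replace (dpoly l b M z - dpoly l b M w)%C with (dpoly l b M z + - (1) * dpoly l b M w)%C by ring.
      eapply is_lim_seqC_ext; [|apply is_lim_seqC_plus; [apply (L z)|apply (is_lim_seqC_scal (- (1)) _ _ (L w))]].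
      intros n; cbv beta. ring. }
    simpl pow. apply is_lim_seq_mult'; [exact D0|]. apply is_lim_seq_mult'; [exact D0|apply is_lim_seq_const]. }
  apply (is_lim_seq_le _ (fun J => 2 * Cmod (z - w)%C ^ 2 * quad_form (kernel_trunc J) l b M) _
    (2 * Cmod (z - w)%C ^ 2 * quad_form kernel l b M)
    (fun J => dpoly_trunc_lipschitz l b M J z w Hz Hw) D).
  apply (is_lim_seq_scal_l _ _ (quad_form kernel l b M)). apply quad_form_lim.
Qed.

(** * Means of trigonometric sums and Riesz products *)

(* A primitive of [f] is [m * t + O(1)]: this makes [m] the mean of [f] without any integral. *)
Definition primitive_near (f : R -> R) (m B : R) : Prop :=
  exists G : R -> R, (forall t, is_derive G t (f t)) /\ forall t, Rabs (G t - m * t) <= B.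
Definition has_mean (f : R -> R) (m : R) : Prop := exists B, primitive_near f m B.

Lemma primitive_near_plus f g m m' B B' : primitive_near f m B -> primitive_near g m' B' ->
  primitive_near (fun t => f t + g t) (m + m') (B + B').
Proof.
  intros [G [D E]] [G' [D' E']]. exists (fun t => G t + G' t). split.
  - intros t. apply (is_derive_plus G G'); auto.
  - intros t. replace (G t + G' t - (m + m') * t) with ((G t - m * t) + (G' t - m' * t)) by ring.
    eapply Rle_trans; [apply Rabs_triang|]. apply Rplus_le_compat; auto.
Qed.

Lemma primitive_near_scal c f m B : primitive_near f m B ->
  primitive_near (fun t => c * f t) (c * m) (Rabs c * B).
Proof.
  intros [G [D E]]. exists (fun t => c * G t). split.
  - intros t. apply is_derive_scal, D.
  - intros t. replace (c * G t - c * m * t) with (c * (G t - m * t)) by ring.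
    rewrite Rabs_mult. apply Rmult_le_compat_l; [apply Rabs_pos|apply E].
Qed.

Lemma primitive_near_ext f g m B : (forall t, f t = g t) -> primitive_near f m B -> primitive_near g m B.
Proof.
  intros H [G [D E]]. exists G. split; [|exact E]. intros t. rewrite <- H. apply D.
Qed.

Lemma primitive_near_const c : primitive_near (fun _ => c) c 0.
Proof.
  exists (fun t => c * t). split.
  - intros t. auto_derive; trivial. ring.
  - intros t. rewrite Rminus_diag. rewrite Rabs_R0. lra.
Qed.

Lemma primitive_near_cos mu p : mu <> 0 -> primitive_near (fun t => cos (mu * t + p)) 0 (/ Rabs mu).
Proof.
  intros H. exists (fun t => / mu * sin (mu * t + p)). split.
  - intros t. auto_derive; trivial. field. exact H.
  - intros t. rewrite Rmult_0_l, Rminus_0_r, Rabs_mult, Rabs_inv.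
    rewrite <- (Rmult_1_r (/ Rabs mu)) at 2. apply Rmult_le_compat_l.
    + left; apply Rinv_0_lt_compat, Rabs_pos_lt, H.
    + apply Rabs_le, SIN_bound.
Qed.

Lemma primitive_near_sum (f : nat -> R -> R) m B n : (forall i, (i < n)%nat -> primitive_near (f i) (m i) (B i)) ->
  primitive_near (fun t => sumR (fun i => f i t) n) (sumR m n) (sumR B n).
Proof.
  induction n as [|n IH]; intros H; simpl.
  - apply primitive_near_const.
  - apply primitive_near_plus; [apply IH; intros; apply H; lia|apply H; lia].
Qed.

Lemma has_mean_plus f g m m' : has_mean f m -> has_mean g m' -> has_mean (fun t => f t + g t) (m + m').
Proof. intros [B H] [B' H']. eexists. apply primitive_near_plus; eassumption. Qed.
Lemma has_mean_scal c f m : has_mean f m -> has_mean (fun t => c * f t) (c * m).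
Proof. intros [B H]. eexists. apply primitive_near_scal; eassumption. Qed.
Lemma has_mean_ext f g m : (forall t, f t = g t) -> has_mean f m -> has_mean g m.
Proof. intros E [B H]. exists B. revert H. now apply primitive_near_ext. Qed.

Lemma has_mean_sum (f : nat -> R -> R) m n : (forall i, (i < n)%nat -> has_mean (f i) (m i)) ->
  has_mean (fun t => sumR (fun i => f i t) n) (sumR m n).
Proof.
  induction n as [|n IH]; intros H; simpl.
  - eexists. apply primitive_near_const.
  - apply has_mean_plus; [apply IH; intros; apply H; lia|apply H; lia].
Qed.

Fixpoint prodR (f : nat -> R) (n : nat) : R :=
  match n with O => 1 | S m => prodR f m * f m end.

Lemma prodR_ext f g n : (forall i, (i < n)%nat -> f i = g i) -> prodR f n = prodR g n.
Proof.
  induction n as [|n IH]; simpl; intros H; [auto|].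
  rewrite IH, H; auto; intros; apply H; lia.
Qed.

Lemma prodR_mult f g n : prodR (fun i => f i * g i) n = prodR f n * prodR g n.
Proof. induction n as [|n IH]; simpl; [ring|rewrite IH; ring]. Qed.

Lemma prodR_const_1 n : prodR (fun _ => 1) n = 1.
Proof. induction n as [|n IH]; simpl; [reflexivity|rewrite IH; ring]. Qed.

Lemma prodR_single (g : nat -> R) j n : (j < n)%nat -> prodR (fun i => if Nat.eqb i j then g i else 1) n = g j.
Proof.
  intros H. induction n as [|n IH]; [lia|]. simpl.
  destruct (Nat.eqb_spec n j) as [->|E].
  - rewrite (prodR_ext _ (fun _ => 1)), prodR_const_1; [ring|].
    intros i Hi. destruct (Nat.eqb_spec i j); [lia|auto].
  - rewrite IH by lia. ring.
Qed.

Lemma prodR_zero f n j : (j < n)%nat -> f j = 0 -> prodR f n = 0.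
Proof.
  induction n as [|n IH]; intros H E; [lia|]. simpl.
  destruct (Nat.eq_dec j n) as [->|D]; [rewrite E; ring|rewrite IH by (auto; lia); ring].
Qed.

Lemma sumR_delta (f : nat -> R) n N : (n < N)%nat -> sumR (fun m => if Nat.eqb n m then f m else 0) N = f n.
Proof.
  intros H. induction N as [|N IH]; [lia|]. simpl.
  destruct (Nat.eqb_spec n N) as [->|D].
  - rewrite (sumR_ext _ (fun _ => 0 * 0)), sumR_scal; [ring|].
    intros i Hi. destruct (Nat.eqb_spec N i); [lia|ring].
  - rewrite IH by lia. ring.
Qed.

Definition no_relation (l : nat -> R) (n : nat) : Prop :=
  forall k : nat -> Z, (forall i, (Z.abs (k i) <= 2)%Z) ->
    sumR (fun i => IZR (k i) * l i) n = 0 -> forall i, (i < n)%nat -> k i = 0%Z.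

Definition trig_degree2 (q : R -> R) (a : R) : Prop :=
  exists c1 p1 c2 p2, forall x, q x = a + c1 * cos (x + p1) + c2 * cos (2 * x + p2).

Section Independence.
Variables (l : nat -> R) (q : nat -> R -> R) (a : nat -> R).
Hypothesis Hq : forall i, trig_degree2 (q i) (a i).

Lemma has_mean_shifted_product n : forall mu p,
  (forall k : nat -> Z, (forall i, (Z.abs (k i) <= 2)%Z) ->
     mu + sumR (fun i => IZR (k i) * l i) n <> 0) ->
  has_mean (fun t => cos (mu * t + p) * prodR (fun i => q i (t * l i)) n) 0.
Proof.
  induction n as [|n IH]; intros mu p H.
  - exists (/ Rabs mu). eapply primitive_near_ext; [|apply (primitive_near_cos mu p)].
    + intros t; simpl; ring.
    + specialize (H (fun _ => 0%Z) ltac:(intros; simpl; lia)). simpl in H. lra.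
  - destruct (Hq n) as (c1 & p1 & c2 & p2 & E).
    assert (S : forall (j : Z) p', (Z.abs j <= 2)%Z ->
       has_mean (fun t => cos ((mu + IZR j * l n) * t + p') * prodR (fun i => q i (t * l i)) n) 0).
    { intros j p' Hj. apply IH. intros k Hk.
      specialize (H (fun i => if Nat.eqb i n then j else k i)).
      assert (Hk' : forall i, (Z.abs (if Nat.eqb i n then j else k i) <= 2)%Z).
      { intros i. destruct (Nat.eqb i n); auto. }
      specialize (H Hk'). simpl in H. rewrite Nat.eqb_refl in H.
      rewrite (sumR_ext _ (fun i => IZR (k i) * l i)) in H; [lra|].
      intros i Hi. destruct (Nat.eqb_spec i n); [lia|auto]. }
    apply has_mean_ext with (f := fun t =>
      a n * (cos ((mu + IZR 0 * l n) * t + p) * prodR (fun i => q i (t * l i)) n) +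
      (c1 / 2 * (cos ((mu + IZR 1 * l n) * t + (p + p1)) * prodR (fun i => q i (t * l i)) n) +
      (c1 / 2 * (cos ((mu + IZR (-1) * l n) * t + (p - p1)) * prodR (fun i => q i (t * l i)) n) +
      (c2 / 2 * (cos ((mu + IZR 2 * l n) * t + (p + p2)) * prodR (fun i => q i (t * l i)) n) +
       c2 / 2 * (cos ((mu + IZR (-2) * l n) * t + (p - p2)) * prodR (fun i => q i (t * l i)) n))))).
    + intros t. simpl prodR. rewrite E. set (P := prodR _ n).
      replace ((mu + 0 * l n) * t + p) with (mu * t + p) by ring.
      replace ((mu + 1 * l n) * t + (p + p1)) with ((mu * t + p) + (t * l n + p1)) by ring.
      replace ((mu + -1 * l n) * t + (p - p1)) with ((mu * t + p) - (t * l n + p1)) by ring.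
      replace ((mu + 2 * l n) * t + (p + p2)) with ((mu * t + p) + (2 * (t * l n) + p2)) by ring.
      replace ((mu + -2 * l n) * t + (p - p2)) with ((mu * t + p) - (2 * (t * l n) + p2)) by ring.
      rewrite !cos_plus, !cos_minus. rewrite !cos_plus, !sin_plus. field.
    + evar_last; [repeat apply has_mean_plus; apply has_mean_scal, S; simpl; lia|ring].
Qed.

Lemma has_mean_product n : no_relation l n ->
  has_mean (fun t => prodR (fun i => q i (t * l i)) n) (prodR a n).
Proof.
  induction n as [|n IH]; intros H.
  - simpl. eexists. apply primitive_near_const.
  - assert (H' : no_relation l n).
    { intros k Hk E i Hi.
      assert (X := H (fun i => if Nat.eqb i n then 0%Z else k i)).
      assert (Y : (if Nat.eqb i n then 0%Z else k i) = 0%Z).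
      { apply X; [|simpl|lia].
        - intros j. destruct (Nat.eqb j n); [simpl; lia|auto].
        - rewrite Nat.eqb_refl. rewrite (sumR_ext _ (fun i => IZR (k i) * l i)); [rewrite E; ring|].
          intros j Hj. destruct (Nat.eqb_spec j n); [lia|auto]. }
      destruct (Nat.eqb_spec i n); [lia|auto]. }
    destruct (Hq n) as (c1 & p1 & c2 & p2 & E).
    assert (S : forall (j : Z) p', (Z.abs j <= 2)%Z -> j <> 0%Z ->
       has_mean (fun t => cos (IZR j * l n * t + p') * prodR (fun i => q i (t * l i)) n) 0).
    { intros j p' Hj Nj. apply has_mean_shifted_product. intros k Hk Z0. apply Nj.
      assert (X := H (fun i => if Nat.eqb i n then j else k i)).
      assert (Y : (if Nat.eqb n n then j else k n) = 0%Z).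
      { apply (X); [|simpl|lia].
        - intros i. destruct (Nat.eqb i n); auto.
        - rewrite Nat.eqb_refl. rewrite (sumR_ext _ (fun i => IZR (k i) * l i)); [lra|].
          intros i Hi. destruct (Nat.eqb_spec i n); [lia|auto]. }
      now rewrite Nat.eqb_refl in Y. }
    apply has_mean_ext with (f := fun t => a n * prodR (fun i => q i (t * l i)) n +
       (c1 * (cos (IZR 1 * l n * t + p1) * prodR (fun i => q i (t * l i)) n) +
        c2 * (cos (IZR 2 * l n * t + p2) * prodR (fun i => q i (t * l i)) n))).
    + intros t. simpl prodR. rewrite E.
      replace (1 * l n * t + p1) with (t * l n + p1) by ring.
      replace (2 * l n * t + p2) with (2 * (t * l n) + p2) by ring. ring.
    + simpl prodR. replace (prodR a n * a n) with (a n * prodR a n + (c1 * 0 + c2 * 0)) by ring.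
      apply has_mean_plus; [apply has_mean_scal, IH, H'|].
      apply has_mean_plus; apply has_mean_scal, S; simpl; lia.
Qed.
End Independence.

Lemma trig_riesz d : trig_degree2 (fun x => 1 + d * cos x) 1.
Proof.
  exists d, 0, 0, 0. intros x. rewrite Rplus_0_r. ring.
Qed.

Lemma trig_riesz_cos d : trig_degree2 (fun x => (1 + d * cos x) * (cos x - d / 2)) 0.
Proof.
  exists (1 - d ^ 2 / 2), 0, (d / 2), 0. intros x. rewrite !Rplus_0_r, cos_2a_cos. field.
Qed.

Lemma trig_riesz_sin d : trig_degree2 (fun x => (1 + d * cos x) * sin x) 0.
Proof.
  exists 1, (- (PI / 2)), (d / 2), (- (PI / 2)). intros x.
  assert (E : forall y, cos (y + - (PI / 2)) = sin y).
  { intros y. rewrite <- cos_shift. rewrite <- cos_neg. f_equal. ring. }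
  rewrite !E, sin_2a. field.
Qed.

Lemma trig_riesz_square d : trig_degree2 (fun x => (1 + d * cos x) * (1 + d ^ 2 / 4 - d * cos x)) (1 - d ^ 2 / 4).
Proof.
  exists (d ^ 3 / 4), 0, (- (d ^ 2 / 2)), 0. intros x. rewrite !Rplus_0_r, cos_2a_cos. field.
Qed.

Definition riesz (l d : nat -> R) (n : nat) (t : R) : R :=
  prodR (fun i => 1 + d i * cos (t * l i)) n.

(* [d n / 2] is the mean of the n-th phase against the Riesz product with signs [d]. *)
Definition rotating (l w d : nat -> R) (t : R) (n : nat) : C :=
  (RtoC (w n) * (Cexp (- (Ci * RtoC t) * RtoC (l n)) - RtoC (d n / 2)))%C.

Lemma Cexp_rot t x : Cexp (- (Ci * RtoC t) * RtoC x)%C = (cos (t * x), - sin (t * x)).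
Proof.
  unfold Cexp. apply C_eq; simpl.
  - replace (- (0 * t - 1 * 0) * x - - (0 * 0 + 1 * t) * 0) with 0 by ring.
    replace (- (0 * t - 1 * 0) * 0 + - (0 * 0 + 1 * t) * x) with (- (t * x)) by ring.
    rewrite exp_0, cos_neg. ring.
  - replace (- (0 * t - 1 * 0) * x - - (0 * 0 + 1 * t) * 0) with 0 by ring.
    replace (- (0 * t - 1 * 0) * 0 + - (0 * 0 + 1 * t) * x) with (- (t * x)) by ring.
    rewrite exp_0, sin_neg. ring.
Qed.

Lemma rotating_product l w d t n m :
  Re (rotating l w d t n * Cconj (rotating l w d t m))%C =
  w n * w m * ((cos (t * l n) - d n / 2) * (cos (t * l m) - d m / 2) + sin (t * l n) * sin (t * l m)).
Proof.
  unfold rotating. rewrite !Cexp_rot. unfold Re; simpl. ring.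
Qed.

Lemma riesz_mean l d n : no_relation l n -> has_mean (riesz l d n) 1.
Proof.
  intros H.
  assert (M := has_mean_product l (fun i x => 1 + d i * cos x) (fun _ => 1) (fun i => trig_riesz (d i)) n H).
  rewrite prodR_const_1 in M. exact M.
Qed.

Lemma riesz_rotating_mean l w d N n m : no_relation l N -> (n < N)%nat -> (m < N)%nat ->
  has_mean (fun t => riesz l d N t * Re (rotating l w d t n * Cconj (rotating l w d t m))%C)
    (if Nat.eqb n m then w n ^ 2 * (1 - d n ^ 2 / 4) else 0).
Proof.
  intros H Hn Hm. destruct (Nat.eqb_spec n m) as [<-|D].
  - set (q := fun i x => (1 + d i * cos x) * (if Nat.eqb i n then 1 + d i ^ 2 / 4 - d i * cos x else 1)).
    set (a := fun i => if Nat.eqb i n then 1 - d i ^ 2 / 4 else 1).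
    assert (Hq : forall i, trig_degree2 (q i) (a i)).
    { intros i. unfold q, a. destruct (Nat.eqb i n).
      - apply trig_riesz_square.
      - destruct (trig_riesz (d i)) as (c1 & p1 & c2 & p2 & E). exists c1, p1, c2, p2. intros x.
        rewrite <- E. ring. }
    assert (M := has_mean_product l q a Hq N H). unfold a in M.
    rewrite (prodR_single (fun i => 1 - d i ^ 2 / 4)) in M by exact Hn.
    apply (has_mean_scal (w n ^ 2)) in M. revert M. apply has_mean_ext. intros t.
    unfold q. rewrite prodR_mult, (prodR_single (fun i => 1 + d i ^ 2 / 4 - d i * cos (t * l i))) by exact Hn.
    rewrite rotating_product. unfold riesz.
    assert (E : sin (t * l n) * sin (t * l n) = 1 - cos (t * l n) * cos (t * l n)).
    { generalize (sin2_cos2 (t * l n)). unfold Rsqr. lra. }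
    rewrite E. field.
  - assert (T : forall g : nat -> R -> R, (forall i, trig_degree2 (fun x => (1 + d i * cos x) * g i x) 0) ->
      has_mean (fun t => riesz l d N t * (g n (t * l n) * g m (t * l m))) 0).
    { intros g Hg.
      set (q := fun i x => (1 + d i * cos x) * ((if Nat.eqb i n then g i x else 1) * (if Nat.eqb i m then g i x else 1))).
      set (a := fun i => if Nat.eqb i n then 0 else if Nat.eqb i m then 0 else 1).
      assert (Hq : forall i, trig_degree2 (q i) (a i)).
      { intros i. unfold q, a. destruct (Nat.eqb_spec i n) as [->|Ei].
        - destruct (Nat.eqb_spec n m); [lia|].
          destruct (Hg n) as (c1 & p1 & c2 & p2 & E). exists c1, p1, c2, p2. intros x. rewrite <- E. ring.
        - destruct (Nat.eqb_spec i m) as [->|Ei'].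
          + destruct (Hg m) as (c1 & p1 & c2 & p2 & E). exists c1, p1, c2, p2. intros x. rewrite <- E. ring.
          + destruct (trig_riesz (d i)) as (c1 & p1 & c2 & p2 & E). exists c1, p1, c2, p2. intros x. rewrite <- E. ring. }
      assert (M := has_mean_product l q a Hq N H).
      rewrite (prodR_zero a N n Hn) in M by (unfold a; now rewrite Nat.eqb_refl).
      revert M. apply has_mean_ext. intros t. unfold q, riesz. rewrite !prodR_mult.
      rewrite (prodR_single (fun i => g i (t * l i)) n N Hn), (prodR_single (fun i => g i (t * l i)) m N Hm). reflexivity. }
    assert (M1 := T (fun i x => cos x - d i / 2) (fun i => trig_riesz_cos (d i))).
    assert (M2 := T (fun i x => sin x) (fun i => trig_riesz_sin (d i))).
    assert (M := has_mean_scal (w n * w m) _ _ (has_mean_plus _ _ _ _ M1 M2)).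
    replace (w n * w m * (0 + 0)) with 0 in M by ring.
    revert M. apply has_mean_ext. intros t. rewrite rotating_product. ring.
Qed.

Lemma riesz_quad_form_mean l w d N : no_relation l N ->
  has_mean (fun t => riesz l d N t * quad_form kernel l (rotating l w d t) N)
    (sumR (fun n => w n ^ 2 * (1 - d n ^ 2 / 4) * kernel (l n * l n)) N).
Proof.
  intros H.
  assert (M : has_mean (fun t => sumR (fun n => sumR (fun m => kernel (l n * l m) *
      (riesz l d N t * Re (rotating l w d t n * Cconj (rotating l w d t m))%C)) N) N)
    (sumR (fun n => sumR (fun m => kernel (l n * l m) * (if Nat.eqb n m then w n ^ 2 * (1 - d n ^ 2 / 4) else 0)) N) N)).
  { apply (has_mean_sum (fun n t => sumR (fun m => kernel (l n * l m) *
      (riesz l d N t * Re (rotating l w d t n * Cconj (rotating l w d t m))%C)) N)).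
    intros n Hn. apply (has_mean_sum (fun m t => kernel (l n * l m) *
      (riesz l d N t * Re (rotating l w d t n * Cconj (rotating l w d t m))%C))).
    intros m Hm. apply has_mean_scal. now apply riesz_rotating_mean. }
  replace (sumR (fun n => w n ^ 2 * (1 - d n ^ 2 / 4) * kernel (l n * l n)) N) with
   (sumR (fun n => sumR (fun m => kernel (l n * l m) * (if Nat.eqb n m then w n ^ 2 * (1 - d n ^ 2 / 4) else 0)) N) N).
  - revert M. apply has_mean_ext. intros t. unfold quad_form. rewrite <- sumR_scal.
    apply sumR_ext; intros n _. rewrite <- sumR_scal. apply sumR_ext; intros m _. ring.
  - apply sumR_ext. intros n Hn.
    transitivity (kernel (l n * l n) * (w n ^ 2 * (1 - d n ^ 2 / 4))); [|ring].
    rewrite <- (sumR_delta (fun m => kernel (l n * l m) * (w n ^ 2 * (1 - d n ^ 2 / 4))) n N Hn).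
    apply sumR_ext. intros m _. destruct (Nat.eqb n m); ring.
Qed.

Lemma riesz_bounds l d N t : (forall i, Rabs (d i) <= 1) -> 0 <= riesz l d N t <= 2 ^ N.
Proof.
  intros H. unfold riesz. induction N as [|N IH]; cbn [prodR pow]; [lra|].
  assert (B : 0 <= 1 + d N * cos (t * l N) <= 2).
  { assert (Rabs (d N * cos (t * l N)) <= 1).
    { rewrite Rabs_mult. rewrite <- (Rmult_1_r 1). apply Rmult_le_compat; try apply Rabs_pos; [apply H|].
      apply Rabs_le, COS_bound. }
    apply Rabs_le_between in H0. lra. }
  split.
  - apply Rmult_le_pos; lra.
  - rewrite Rmult_comm. apply Rmult_le_compat; lra.
Qed.

Lemma tail_quad_form_primitive l w M :
  (forall n m, (n < M)%nat -> (m < M)%nat -> n <> m -> w n <> 0 -> w m <> 0 -> l n <> l m) ->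
  primitive_near (fun t => quad_form kernel l (rotating l w (fun _ => 0) t) M)
    (sumR (fun n => w n ^ 2 * kernel (l n * l n)) M)
    (sumR (fun n => sumR (fun m => if Nat.eqb n m then 0 else
        Rabs (w n * w m * kernel (l n * l m)) / Rabs (l n - l m)) M) M).
Proof.
  intros H.
  assert (P : primitive_near (fun t => sumR (fun n => sumR (fun m => w n * w m * kernel (l n * l m) * cos ((l n - l m) * t + 0)) M) M)
    (sumR (fun n => sumR (fun m => if Nat.eqb n m then w n ^ 2 * kernel (l n * l n) else 0) M) M)
    (sumR (fun n => sumR (fun m => if Nat.eqb n m then 0 else
        Rabs (w n * w m * kernel (l n * l m)) / Rabs (l n - l m)) M) M)).
  { apply (primitive_near_sum (fun n t => sumR (fun m => w n * w m * kernel (l n * l m) * cos ((l n - l m) * t + 0)) M)).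
    intros n Hn. apply (primitive_near_sum (fun m t => w n * w m * kernel (l n * l m) * cos ((l n - l m) * t + 0))).
    intros m Hm. destruct (Nat.eqb_spec n m) as [<-|D].
    - apply primitive_near_ext with (2 := primitive_near_const (w n ^ 2 * kernel (l n * l n))).
      intros t. replace ((l n - l n) * t + 0) with 0 by ring. rewrite cos_0. ring.
    - assert (Z : w n = 0 \/ w m = 0 \/ l n <> l m).
      { destruct (Req_dec (w n) 0), (Req_dec (w m) 0); auto. }
      destruct Z as [Z|[Z|Z]].
      + rewrite Z. replace (Rabs (0 * w m * kernel (l n * l m)) / Rabs (l n - l m)) with 0
          by (rewrite !Rmult_0_l, Rabs_R0; unfold Rdiv; ring).
        apply primitive_near_ext with (2 := primitive_near_const 0). intros; ring.
      + rewrite Z. replace (Rabs (w n * 0 * kernel (l n * l m)) / Rabs (l n - l m)) with 0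
          by (rewrite Rmult_0_r, !Rmult_0_l, Rabs_R0; unfold Rdiv; ring).
        apply primitive_near_ext with (2 := primitive_near_const 0). intros; ring.
      + assert (X := primitive_near_scal (w n * w m * kernel (l n * l m)) _ _ _ (primitive_near_cos (l n - l m) 0 ltac:(lra))).
        rewrite Rmult_0_r in X. exact X. }
  replace (sumR (fun n => w n ^ 2 * kernel (l n * l n)) M) with
   (sumR (fun n => sumR (fun m => if Nat.eqb n m then w n ^ 2 * kernel (l n * l n) else 0) M) M).
  - revert P. apply primitive_near_ext. intros t. unfold quad_form.
    apply sumR_ext; intros n _. apply sumR_ext; intros m _. rewrite rotating_product.
    replace ((l n - l m) * t + 0) with (t * l n - t * l m) by ring. rewrite cos_minus. field.
  - apply sumR_ext. intros n Hn.
    apply (sumR_delta (fun _ => w n ^ 2 * kernel (l n * l n)) n M Hn).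
Qed.

(** * Weights and frequencies *)

Lemma exp_small x : x <= 1 -> exp x <= 3.
Proof. intros H. apply Rle_trans with (exp 1); [now apply exp_le|apply exp_le_3]. Qed.

Lemma Rpower_base_1 p : Rpower 1 p = 1.
Proof. unfold Rpower. rewrite ln_1, Rmult_0_r. apply exp_0. Qed.

Lemma inv_le_ln_diff x y : 0 < x <= y -> (y - x) / y <= ln y - ln x.
Proof.
  intros [Hx Hy].
  assert (Hq : 0 < x / y) by (apply Rdiv_lt_0_compat; lra).
  generalize (exp_ineq1_le (ln (x / y))). rewrite exp_ln by exact Hq.
  unfold Rdiv. rewrite ln_mult, ln_Rinv by (try apply Rinv_0_lt_compat; lra).
  replace ((y - x) * / y) with (1 - x * / y) by (field; lra). lra.
Qed.

Lemma Rpower_telescope_pos q y : 0 < q <= 1 -> 0 < y ->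
  Rpower (y + 1) (q - 1) <= 2 / q * (Rpower (y + 1) q - Rpower y q).
Proof.
  intros [Hq Hq1] Hy.
  assert (L := inv_le_ln_diff y (y + 1) ltac:(lra)). replace (y + 1 - y) with 1 in L by ring.
  set (u := ln (y + 1) - ln y) in *.
  assert (u0 : 0 < / (y + 1)) by (apply Rinv_0_lt_compat; lra).
  assert (ui : / (y + 1) <= 1) by (rewrite <- Rinv_1; apply Rinv_le_contravar; lra).
  unfold Rdiv in L. rewrite Rmult_1_l in L.
  assert (E : Rpower y q = Rpower (y + 1) q * exp (- (q * u))).
  { unfold Rpower, u. rewrite <- exp_plus. f_equal. ring. }
  assert (E2 : Rpower (y + 1) (q - 1) = Rpower (y + 1) q * / (y + 1)).
  { unfold Rminus. rewrite Rpower_plus, (Rpower_Ropp _ 1), Rpower_1; lra. }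
  rewrite E, E2.
  set (v := q * / (y + 1)).
  assert (v0 : 0 < v) by (apply Rmult_lt_0_compat; lra). assert (v1 : v <= 1) by (unfold v; nra).
  assert (Q : exp (- (q * u)) <= 1 - v / 2).
  { apply Rle_trans with (exp (- v)); [apply exp_le; unfold v; nra|].
    rewrite exp_Ropp. apply Rle_trans with (/ (1 + v)).
    - apply Rinv_le_contravar; [lra|apply exp_ineq1_le].
    - apply Rmult_le_reg_l with (1 + v); [lra|]. rewrite Rinv_r by lra. nra. }
  apply Rle_trans with (2 / q * (Rpower (y + 1) q * (v / 2))).
  - right. unfold v. field. lra.
  - apply Rmult_le_compat_l; [apply Rdiv_le_0_compat; lra|].
    generalize (Rpower_pos (y + 1) q). nra.
Qed.

Section Weights.
Variable al : R.
Hypothesis Hal : 1 / 2 <= al <= 1.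

Definition freq (n : nat) : R := ln (INR n + al).
Definition weight (n : nat) : R := Rpower (INR n + al) (- (7 / 8)).

Lemma weight_pos n : 0 < weight n.
Proof. apply Rpower_pos. Qed.

Lemma half_pow_neg p : 0 <= p <= 1 -> forall x, 1 / 2 <= x -> Rpower x (- p) <= 2.
Proof.
  intros Hp x Hx. apply Rle_trans with (Rpower (1 / 2) (- p)); [apply Rpower_le_base; lra|].
  unfold Rpower. replace (1 / 2) with (/ 2) by field. rewrite ln_Rinv by lra.
  rewrite <- (exp_ln 2) at 2 by lra. apply exp_le.
  assert (0 < ln 2) by (rewrite <- ln_1; apply ln_increasing; lra). nra.
Qed.

Lemma weight_le_2 n : weight n <= 2.
Proof. apply half_pow_neg; [lra|]. generalize (pos_INR n); lra. Qed.

Lemma freq_le n m : (n <= m)%nat -> freq n <= freq m.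
Proof. intros H. apply le_INR in H. apply ln_le; generalize (pos_INR n); lra. Qed.

Lemma ln_2_bounds : 1 / 2 <= ln 2 <= 1.
Proof.
  split.
  - generalize (inv_le_ln_diff 1 2 ltac:(lra)). rewrite ln_1. lra.
  - generalize (exp_ineq1_le (ln 2)). rewrite exp_ln by lra. lra.
Qed.

Lemma freq_lower n : - 1 <= freq n.
Proof.
  apply Rle_trans with (ln (/ 2)); [rewrite ln_Rinv by lra; generalize ln_2_bounds; lra|].
  apply ln_le; generalize (pos_INR n); lra.
Qed.

Lemma weight_majorant n :
  weight n * kernel_majorant (freq n) <= 32 * Rpower (INR n + 1) (- (3 / 4)).
Proof.
  unfold kernel_majorant. destruct n as [|n].
  - assert (A := freq_lower 0).
    assert (B : freq 0 <= 0).
    { unfold freq. simpl. rewrite Rplus_0_l. rewrite <- ln_1. apply ln_le; lra. }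
    rewrite Rabs_left1 by exact B.
    assert (E : exp (- freq 0 / 32) <= 3) by (apply exp_small; lra).
    replace (INR 0 + 1) with 1 by (simpl; ring).
    rewrite Rpower_base_1.
    assert (W := weight_le_2 0). assert (W' := weight_pos 0). assert (X := exp_pos (- freq 0 / 32)).
    assert ((1 + - freq 0) * exp (- freq 0 / 32) <= 6) by nra.
    assert (0 <= (1 + - freq 0) * exp (- freq 0 / 32)) by nra. nra.
  - assert (P : 1 <= INR (S n)) by (apply (le_INR 1); lia).
    assert (L0 : 0 <= freq (S n)) by (apply ln_nonneg; lra).
    rewrite Rabs_pos_eq by exact L0.
    assert (E : 1 + freq (S n) <= 16 * exp (freq (S n) / 16))
      by (generalize (exp_ineq1_le (freq (S n) / 16)); lra).
    apply Rle_trans with (16 * Rpower (INR (S n) + al) (- (3 / 4))).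
    + apply Rle_trans with (weight (S n) * (16 * exp (freq (S n) / 16) * exp (freq (S n) / 32))).
      * apply Rmult_le_compat_l; [left; apply weight_pos|]. apply Rmult_le_compat_r; [left; apply exp_pos|exact E].
      * unfold weight, Rpower. fold (freq (S n)).
        replace (exp (- (7 / 8) * freq (S n)) * (16 * exp (freq (S n) / 16) * exp (freq (S n) / 32))) with
         (16 * (exp (- (7 / 8) * freq (S n)) * exp (freq (S n) / 16) * exp (freq (S n) / 32))) by ring.
        rewrite <- !exp_plus. apply Rmult_le_compat_l; [lra|]. apply exp_le. lra.
    + assert (H : Rpower (INR (S n) + al) (- (3 / 4)) <= 2 * Rpower (INR (S n) + 1) (- (3 / 4))); [|lra].
      apply Rle_trans with (Rpower (1 / 2 * (INR (S n) + 1)) (- (3 / 4))).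
      * apply Rpower_le_base; lra.
      * rewrite <- Rpower_mult_distr by lra. apply Rmult_le_compat_r; [left; apply Rpower_pos|].
        apply half_pow_neg; lra.
Qed.

Lemma freq_diff n m : (m < n)%nat -> INR (n - m) / (INR n + 1) <= freq n - freq m.
Proof.
  intros H. rewrite minus_INR by lia. apply lt_INR in H. assert (P := pos_INR m).
  eapply Rle_trans; [|apply inv_le_ln_diff; lra].
  replace (INR n + al - (INR m + al)) with (INR n - INR m) by ring.
  apply Rmult_le_compat_l; [lra|]. apply Rinv_le_contravar; lra.
Qed.

Lemma freq_inj n m : n <> m -> freq n <> freq m.
Proof.
  intros D E.
  assert (K : forall i j, (i < j)%nat -> freq i < freq j).
  { intros i j H. generalize (freq_diff j i H).
    assert (0 < INR (j - i) / (INR j + 1)); [|lra].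
    apply Rdiv_lt_0_compat; [apply lt_0_INR; lia|generalize (pos_INR j); lra]. }
  destruct (Nat.lt_gt_cases n m) as [X _]. destruct (X D) as [Y|Y]; apply K in Y; lra.
Qed.

Lemma majorant_nonneg x : 0 <= kernel_majorant x.
Proof.
  unfold kernel_majorant. apply Rmult_le_pos; [generalize (Rabs_pos x); lra|left; apply exp_pos].
Qed.

Lemma weight_kernel_bound n m :
  Rabs (weight n * weight m * kernel (freq n * freq m)) <=
  1024 * (Rpower (INR n + 1) (- (3 / 4)) * Rpower (INR m + 1) (- (3 / 4))).
Proof.
  rewrite !Rabs_mult, !(Rabs_pos_eq (weight _)) by (left; apply weight_pos).
  apply Rle_trans with ((weight n * kernel_majorant (freq n)) * (weight m * kernel_majorant (freq m))).
  - replace (weight n * kernel_majorant (freq n) * (weight m * kernel_majorant (freq m))) with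
     (weight n * weight m * (kernel_majorant (freq n) * kernel_majorant (freq m))) by ring.
    apply Rmult_le_compat_l; [|apply kernel_bound].
    apply Rmult_le_pos; left; apply weight_pos.
  - apply Rle_trans with ((32 * Rpower (INR n + 1) (- (3 / 4))) * (32 * Rpower (INR m + 1) (- (3 / 4)))); [|right; ring].
    apply Rmult_le_compat; try apply weight_majorant;
    (apply Rmult_le_pos; [left; apply weight_pos|apply majorant_nonneg]).
Qed.

Lemma weight_kernel_diag n :
  weight n ^ 2 * kernel (freq n * freq n) <= 1024 * Rpower (INR n + 1) (- (3 / 2)).
Proof.
  generalize (weight_kernel_bound n n). rewrite <- Rpower_plus.
  replace (- (3 / 4) + - (3 / 4)) with (- (3 / 2)) by field.
  generalize (Rle_abs (weight n * weight n * kernel (freq n * freq n))). simpl. lra.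
Qed.

Lemma diag_sum_le M : sumR (fun n => Rpower (INR n + 1) (- (3 / 2))) M <= 3.
Proof.
  destruct M as [|M]; [simpl; lra|].
  rewrite sumR_first. replace (INR 0 + 1) with 1 by (simpl; ring).
  rewrite Rpower_base_1.
  assert (H := sum_Rpower_le (1 / 2) 1 M ltac:(lra) ltac:(lra)).
  rewrite (sumR_ext _ (fun i => Rpower (1 + INR i + 1) (- (1 / 2 + 1)))).
  - rewrite Rpower_base_1 in H. lra.
  - intros i _. rewrite S_INR. f_equal; lra.
Qed.

Definition tail_weight (N' n : nat) : R := if Nat.ltb n N' then 0 else weight n.

Lemma tail_weight_le N' n : 0 <= tail_weight N' n <= weight n.
Proof. unfold tail_weight. generalize (weight_pos n). destruct (Nat.ltb n N'); lra. Qed.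

Lemma sumR_tail (f : nat -> R) N M : (N <= M)%nat ->
  sumR (fun n => if Nat.ltb n N then 0 else f n) M = sumR (fun i => f (N + i)%nat) (M - N).
Proof.
  intros H. replace M with (N + (M - N))%nat at 1 by lia.
  induction (M - N)%nat as [|j IH].
  - rewrite Nat.add_0_r. simpl. rewrite (sumR_ext _ (fun _ => 0 * 0)); [rewrite sumR_scal; ring|].
    intros i Hi. apply Nat.ltb_lt in Hi. rewrite Hi. ring.
  - rewrite Nat.add_succ_r. cbn [sumR]. rewrite IH.
    replace (Nat.ltb (N + j) N) with false by (symmetry; apply Nat.ltb_ge; lia). reflexivity.
Qed.

Lemma tail_diag_le N' M : (1 <= N')%nat -> (N' <= M)%nat ->
  sumR (fun n => tail_weight N' n ^ 2 * kernel (freq n * freq n)) M <= 2048 * Rpower (INR N') (- (1 / 2)).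
Proof.
  intros H1 H2.
  apply Rle_trans with (sumR (fun n => if Nat.ltb n N' then 0 else 1024 * Rpower (INR n + 1) (- (3 / 2))) M).
  - apply sumR_le. intros n _. unfold tail_weight. destruct (Nat.ltb n N'); [simpl; lra|apply weight_kernel_diag].
  - rewrite (sumR_tail (fun n => 1024 * Rpower (INR n + 1) (- (3 / 2)))) by exact H2.
    rewrite sumR_scal.
    assert (P : 0 < INR N') by (apply lt_0_INR; lia).
    assert (H := sum_Rpower_le (1 / 2) (INR N') (M - N') ltac:(lra) P).
    rewrite (sumR_ext _ (fun i => Rpower (INR N' + INR i + 1) (- (1 / 2 + 1)))).
    + lra.
    + intros i _. rewrite plus_INR. f_equal; lra.
Qed.

Lemma harmonic_le n : sumR (fun m => / (INR m + 1)) (S n) <= 1 + ln (INR n + 1).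
Proof.
  induction n as [|n IH].
  - simpl. rewrite Rplus_0_l. replace (0 + 1) with 1 by ring. rewrite ln_1. lra.
  - cbn [sumR] in *. rewrite S_INR in *.
    assert (P := pos_INR n).
    generalize (inv_le_ln_diff (INR n + 1) (INR n + 1 + 1) ltac:(lra)).
    replace (INR n + 1 + 1 - (INR n + 1)) with 1 by ring. unfold Rdiv. lra.
Qed.

Lemma sumR_incr f n m : (forall i, 0 <= f i) -> (n <= m)%nat -> sumR f n <= sumR f m.
Proof. intros P H. induction H; simpl; [lra|]. generalize (P m). lra. Qed.

Lemma sumR_rev f n : sumR (fun m => f (n - S m)%nat) n = sumR f n.
Proof.
  revert f. induction n as [|n IH]; intros f; [reflexivity|].
  rewrite sumR_first. replace (S n - 1)%nat with n by lia.
  rewrite (sumR_ext _ (fun m => f (n - S m)%nat)) by reflexivity.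
  rewrite IH. simpl. ring.
Qed.

Lemma sum_inv_sqrt_le M :
  sumR (fun n => Rpower (INR n + 1) (- (1 / 2))) (S M) <= 4 * Rpower (INR M + 1) (1 / 2).
Proof.
  induction M as [|M IH].
  - simpl. rewrite !Rplus_0_l. unfold Rpower. rewrite ln_1, !Rmult_0_r, exp_0. lra.
  - assert (P := pos_INR M).
    assert (T := Rpower_telescope_pos (1 / 2) (INR M + 1) ltac:(lra) ltac:(lra)).
    replace (1 / 2 - 1) with (- (1 / 2)) in T by field.
    change (sumR (fun n => Rpower (INR n + 1) (- (1 / 2))) (S (S M))) with
      (sumR (fun n => Rpower (INR n + 1) (- (1 / 2))) (S M) + Rpower (INR (S M) + 1) (- (1 / 2))).
    rewrite S_INR. lra.
Qed.

Lemma off_diag_half M :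
  sumR (fun n => sumR (fun m => if Nat.ltb m n then
     1024 * (Rpower (INR n + 1) (- (1 / 2)) * (/ (INR m + 1) + / INR (n - m))) else 0) (S M)) (S M)
  <= 8192 * ((1 + ln (INR M + 1)) * Rpower (INR M + 1) (1 / 2)).
Proof.
  set (H := 1 + ln (INR M + 1)).
  assert (H0 : 0 <= H) by (generalize (ln_nonneg (INR M + 1) ltac:(generalize (pos_INR M); lra)); unfold H; lra).
  apply Rle_trans with (sumR (fun n => 2048 * H * Rpower (INR n + 1) (- (1 / 2))) (S M)).
  2:{ rewrite sumR_scal. generalize (sum_inv_sqrt_le M). intros.
      apply Rle_trans with (2048 * H * (4 * Rpower (INR M + 1) (1 / 2))); [|right; ring].
      apply Rmult_le_compat_l; lra. }
  apply sumR_le. intros n Hn.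
  assert (E : sumR (fun m => if Nat.ltb m n then
     1024 * (Rpower (INR n + 1) (- (1 / 2)) * (/ (INR m + 1) + / INR (n - m))) else 0) (S M) =
     1024 * Rpower (INR n + 1) (- (1 / 2)) * (sumR (fun m => / (INR m + 1)) n + sumR (fun m => / INR (n - m)) n)).
  { rewrite <- sumR_plus, <- sumR_scal.
    assert (G : forall g K, (n <= K)%nat -> sumR (fun m => if Nat.ltb m n then g m else 0) K = sumR g n).
    { intros g K HK. induction HK as [|K HK IH].
      - apply sumR_ext. intros i Hi. apply Nat.ltb_lt in Hi. now rewrite Hi.
      - simpl. rewrite IH. replace (Nat.ltb K n) with false by (symmetry; apply Nat.ltb_ge; lia). ring. }
    rewrite G by lia. apply sumR_ext. intros; ring. }
  rewrite E.
  assert (N1 : sumR (fun m => / (INR m + 1)) n <= H).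
  { eapply Rle_trans; [|apply harmonic_le]. apply sumR_incr; [|lia].
    intros i. left. apply Rinv_0_lt_compat. generalize (pos_INR i); lra. }
  assert (N2 : sumR (fun m => / INR (n - m)) n = sumR (fun m => / (INR m + 1)) n).
  { rewrite <- (sumR_rev (fun m => / (INR m + 1))). apply sumR_ext. intros i Hi.
    rewrite <- S_INR. do 2 f_equal. lia. }
  rewrite N2.
  assert (P := Rpower_pos (INR n + 1) (- (1 / 2))). nra.
Qed.

(* With x = n + 1 and y = m + 1: x / (y (x - y)) = 1 / y + 1 / (x - y). *)
Lemma off_diag_term n m : (m < n)%nat ->
  Rabs (weight n * weight m * kernel (freq n * freq m)) / Rabs (freq n - freq m) <=
  1024 * (Rpower (INR n + 1) (- (1 / 2)) * (/ (INR m + 1) + / INR (n - m))).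
Proof.
  intros H. assert (D := freq_diff n m H).
  assert (P1 : 0 < INR (n - m)) by (apply lt_0_INR; lia).
  assert (Pn := pos_INR n). assert (Pm := pos_INR m).
  assert (D0 : 0 < INR (n - m) / (INR n + 1)) by (apply Rdiv_lt_0_compat; lra).
  rewrite (Rabs_pos_eq (freq n - freq m)) by lra.
  assert (B := weight_kernel_bound n m).
  set (A := Rabs (weight n * weight m * kernel (freq n * freq m))) in *.
  assert (A0 : 0 <= A) by apply Rabs_pos.
  set (x := INR n + 1) in *. set (y := INR m + 1) in *.
  assert (Hyx : 1 <= y <= x) by (unfold x, y; apply lt_INR in H; lra).
  assert (S0 : y + INR (n - m) = x) by (unfold x, y; rewrite minus_INR by lia; ring).
  apply Rle_trans with (1024 * (Rpower x (- (3 / 4)) * Rpower y (- (3 / 4))) * (x / INR (n - m))).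
  - unfold Rdiv at 1. apply Rmult_le_compat; [exact A0|left; apply Rinv_0_lt_compat; lra|exact B|].
    replace (x / INR (n - m)) with (/ (INR (n - m) / x)) by (field; lra).
    apply Rinv_le_contravar; lra.
  - assert (E : Rpower y (- (3 / 4)) <= Rpower x (1 / 4) * / y).
    { replace (- (3 / 4)) with (1 / 4 + - (1)) by field. rewrite Rpower_plus, Rpower_Ropp, Rpower_1 by lra.
      apply Rmult_le_compat_r; [left; apply Rinv_0_lt_compat; lra|]. apply Rpower_le_base_pos; lra. }
    apply Rle_trans with (1024 * (Rpower x (- (3 / 4)) * (Rpower x (1 / 4) * / y)) * (x / INR (n - m))).
    + apply Rmult_le_compat_r; [apply Rdiv_le_0_compat; lra|].
      apply Rmult_le_compat_l; [lra|]. apply Rmult_le_compat_l; [left; apply Rpower_pos|exact E].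
    + right. rewrite <- Rmult_assoc with (r2 := Rpower x (1 / 4)), <- Rpower_plus.
      replace (- (3 / 4) + 1 / 4) with (- (1 / 2)) by field.
      rewrite <- S0 at 2. field. split; lra.
Qed.

Lemma tail_off_diag_le N' M :
  sumR (fun n => sumR (fun m => if Nat.eqb n m then 0 else
    Rabs (tail_weight N' n * tail_weight N' m * kernel (freq n * freq m)) / Rabs (freq n - freq m)) (S M)) (S M)
  <= 16384 * ((1 + ln (INR M + 1)) * Rpower (INR M + 1) (1 / 2)).
Proof.
  set (phi := fun n m => if Nat.ltb m n then
     1024 * (Rpower (INR n + 1) (- (1 / 2)) * (/ (INR m + 1) + / INR (n - m))) else 0).
  apply Rle_trans with (sumR (fun n => sumR (fun m => phi n m) (S M)) (S M) + sumR (fun n => sumR (fun m => phi m n) (S M)) (S M)).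
  - rewrite <- sumR_plus. apply sumR_le. intros n _. rewrite <- sumR_plus. apply sumR_le. intros m _.
    assert (T : Rabs (tail_weight N' n * tail_weight N' m * kernel (freq n * freq m)) <=
      Rabs (weight n * weight m * kernel (freq n * freq m))).
    { rewrite !(Rabs_mult _ (kernel _)). apply Rmult_le_compat_r; [apply Rabs_pos|].
      destruct (tail_weight_le N' n), (tail_weight_le N' m).
      rewrite !Rabs_pos_eq; try (apply Rmult_le_pos; lra). apply Rmult_le_compat; lra. }
    unfold phi. destruct (Nat.eqb_spec n m) as [->|D].
    + rewrite Nat.ltb_irrefl. lra.
    + assert (F : 0 <= / Rabs (freq n - freq m)).
      { left. apply Rinv_0_lt_compat, Rabs_pos_lt. generalize (freq_inj n m D). lra. }
      apply (Rmult_le_compat_r _ _ _ F) in T.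
      eapply Rle_trans; [exact T|].
      destruct (Nat.ltb_spec m n) as [L|L].
      * replace (Nat.ltb n m) with false by (symmetry; apply Nat.ltb_ge; lia).
        rewrite Rplus_0_r. now apply off_diag_term.
      * replace (Nat.ltb n m) with true by (symmetry; apply Nat.ltb_lt; lia).
        rewrite Rplus_0_l. rewrite Rabs_minus_sym, (Rmult_comm (weight n)), (Rmult_comm (freq n)).
        apply off_diag_term. lia.
  - rewrite (sumR_swap (fun n m => phi m n)). generalize (off_diag_half M). fold phi. unfold phi. lra.
Qed.
End Weights.

(** * The head of the Dirichlet series *)

Lemma Cexp_second_order (a b : C) p : Cmod a <= p -> Cmod b <= p ->
  Cmod (Cexp a - Cexp b - (a - b))%C <= Cmod (a - b)%C * (p * exp p).
Proof.
  intros Ha Hb. assert (p0 : 0 <= p) by (generalize (Cmod_ge_0 a); lra).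
  set (D := Cmod (a - b)%C * (p * exp p)).
  assert (H := mean_value_RC (fun t => Cexp (b + RtoC t * (a - b)) - RtoC t * (a - b))%C
    (fun t => (a - b) * (Cexp (b + RtoC t * (a - b)) - 1))%C (fun t => t * D) (fun _ => D) 0 1). cbv beta in H.
  replace (b + RtoC 1 * (a - b))%C with a in H by ring.
  replace (b + RtoC 0 * (a - b))%C with b in H by ring.
  replace (Cexp a - Cexp b - (a - b))%C with (Cexp a - RtoC 1 * (a - b) - (Cexp b - RtoC 0 * (a - b)))%C by ring.
  replace D with (1 * D - 0 * D) by ring. apply H.
  - lra.
  - intros t Ht.
    apply is_derive_RC_ext with (f := fun u => (Cexp (b + RtoC u * (a - b)) + RtoC u * - (a - b))%C).
    { intros u; ring. }
    replace ((a - b) * (Cexp (b + RtoC t * (a - b)) - 1))%C with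
      ((0 + (RtoC 1 * (a - b) + RtoC t * 0)) * Cexp (b + RtoC t * (a - b)) + (RtoC 1 * - (a - b) + RtoC t * 0))%C by ring.
    assert (Id : is_derive_RC RtoC t (RtoC 1)).
    { apply (is_derive_RC_RtoC (fun u => u)). apply (is_derive_id (K := R_AbsRing)). }
    apply is_derive_RC_plus.
    + apply (is_derive_RC_Cexp (fun u => b + RtoC u * (a - b))%C).
      apply (is_derive_RC_plus (fun _ => b) (fun u => RtoC u * (a - b))%C); [apply is_derive_RC_const|].
      apply (is_derive_RC_mult RtoC (fun _ => a - b)%C); [exact Id|apply is_derive_RC_const].
    + apply (is_derive_RC_mult RtoC (fun _ => - (a - b))%C); [exact Id|apply is_derive_RC_const].
  - intros t Ht. auto_derive; trivial. ring.
  - intros t Ht. rewrite Cmod_mult. unfold D. apply Rmult_le_compat_l; [apply Cmod_ge_0|].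
    set (z := (b + RtoC t * (a - b))%C).
    assert (Hz : Cmod z <= p).
    { replace z with (RtoC t * a + RtoC (1 - t) * b)%C by (unfold z; rewrite RtoC_minus; ring).
      eapply Rle_trans; [apply Cmod_triangle|]. rewrite !Cmod_mult, !Cmod_RtoC_pos by lra. nra. }
    eapply Rle_trans; [apply Cexp_minus_1_bound|].
    apply Rmult_le_compat; [apply Cmod_ge_0|left; apply exp_pos|exact Hz|now apply exp_le].
Qed.

Definition sign_at (m n : nat) : R := if Nat.ltb n m then 1 else - 1.

Section Signs.
Variable al : R.
Hypothesis Hal : 1 / 2 <= al <= 1.
Notation w := (weight al).
Notation l := (freq al).

Lemma partial_sum_crossing N : forall c, 0 <= c <= sumR w N ->
  exists m, (m <= N)%nat /\ c <= sumR w m <= c + 2.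
Proof.
  induction N as [|N IH]; intros c Hc.
  - exists O. simpl in *. split; [lia|lra].
  - destruct (Rle_dec c (sumR w N)) as [H|H].
    + destruct (IH c ltac:(lra)) as [m [Hm E]]. exists m. split; [lia|exact E].
    + exists (S N). split; [lia|]. simpl in *. generalize (weight_le_2 al Hal N). lra.
Qed.

Lemma sum_sign m N : (m <= N)%nat -> sumR (fun n => sign_at m n * w n) N = 2 * sumR w m - sumR w N.
Proof.
  intros H. induction H as [|N H IH].
  - replace (2 * sumR w m - sumR w m) with (sumR w m) by ring. apply sumR_ext. intros i Hi.
    unfold sign_at. apply Nat.ltb_lt in Hi. rewrite Hi. ring.
  - simpl. rewrite IH. unfold sign_at. replace (Nat.ltb N m) with false by (symmetry; apply Nat.ltb_ge; lia). ring.
Qed.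

Lemma sumR_split f a b : sumR f (a + b) = sumR f a + sumR (fun i => f (a + i)%nat) b.
Proof.
  induction b as [|b IH]; [rewrite Nat.add_0_r; simpl; ring|].
  rewrite Nat.add_succ_r. simpl. rewrite IH. ring.
Qed.

Lemma sumR_const_ge c f n : (forall i, (i < n)%nat -> c <= f i) -> INR n * c <= sumR f n.
Proof.
  induction n as [|n IH]; intros H; [simpl; lra|]. rewrite S_INR. cbn [sumR].
  generalize (H n ltac:(lia)) (IH ltac:(intros; apply H; lia)). lra.
Qed.

Lemma spread_lower_bound P m : (1 <= P)%nat -> (m <= 4 * P)%nat ->
  Rpower (INR (4 * P)) (1 / 8) / 16 <= sumR (fun n => w n * Rabs (l n - l m)) (4 * P).
Proof.
  intros HP Hm. set (N := (4 * P)%nat) in *.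
  assert (EN : INR N = 4 * INR P) by (unfold N; rewrite mult_INR; simpl; ring).
  assert (P1 : 1 <= INR P) by (apply (le_INR 1); exact HP).
  assert (W : forall n, (n < N)%nat -> Rpower (INR N) (- (7 / 8)) <= w n).
  { intros n Hn. apply Rpower_le_base; [lra|].
    assert (H : INR n + 1 <= INR N) by (rewrite <- S_INR; apply le_INR; lia).
    generalize (pos_INR n). lra. }
  assert (E : Rpower (INR N) (1 / 8) / 16 = INR P * (Rpower (INR N) (- (7 / 8)) * (1 / 4))).
  { replace (1 / 8) with (- (7 / 8) + 1) by field. rewrite Rpower_plus, Rpower_1 by lra. rewrite EN. field. }
  rewrite E.
  assert (NN : forall n, 0 <= w n * Rabs (l n - l m)).
  { intros n. apply Rmult_le_pos; [left; apply weight_pos|apply Rabs_pos]. }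
  assert (Wp := Rpower_pos (INR N) (- (7 / 8))).
  destruct (Nat.le_gt_cases m (2 * P)) as [H|H].
  - replace N with (3 * P + P)%nat by (unfold N; lia). rewrite sumR_split.
    replace (3 * P + P)%nat with N by (unfold N; lia).
    assert (0 <= sumR (fun n => w n * Rabs (l n - l m)) (3 * P)) by (apply sumR_nonneg; auto).
    assert (G := sumR_const_ge (Rpower (INR N) (- (7 / 8)) * (1 / 4)) (fun i => w (3 * P + i)%nat * Rabs (l (3 * P + i)%nat - l m)) P).
    assert (INR P * (Rpower (INR N) (- (7 / 8)) * (1 / 4)) <= sumR (fun i => w (3 * P + i)%nat * Rabs (l (3 * P + i)%nat - l m)) P); [apply G|lra].
    intros i Hi. apply Rmult_le_compat; [lra|lra|apply W; unfold N; lia|].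
    apply Rle_trans with (2 := Rle_abs _).
    set (n := (3 * P + i)%nat).
    assert (Hn1 : INR n + 1 <= 4 * INR P) by (rewrite <- EN, <- S_INR; apply le_INR; unfold n, N; lia).
    assert (Hn2 : INR m + INR P <= INR n) by (rewrite <- plus_INR; apply le_INR; unfold n; lia).
    assert (Pm := pos_INR m).
    apply Rle_trans with ((INR n + al - (INR m + al)) / (INR n + al)); [|apply inv_le_ln_diff; lra].
    apply -> Rle_div_r; lra.
  - replace N with (P + 3 * P)%nat by (unfold N; lia). rewrite sumR_split.
    replace (P + 3 * P)%nat with N by (unfold N; lia).
    assert (0 <= sumR (fun i => w (P + i)%nat * Rabs (l (P + i)%nat - l m)) (3 * P)) by (apply sumR_nonneg; auto).
    assert (G := sumR_const_ge (Rpower (INR N) (- (7 / 8)) * (1 / 4)) (fun i => w i * Rabs (l i - l m)) P).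
    assert (INR P * (Rpower (INR N) (- (7 / 8)) * (1 / 4)) <= sumR (fun i => w i * Rabs (l i - l m)) P); [apply G|lra].
    intros n Hn. apply Rmult_le_compat; [lra|lra|apply W; unfold N; lia|].
    rewrite Rabs_minus_sym. apply Rle_trans with (2 := Rle_abs _).
    assert (Hn1 : INR n + 1 <= INR P) by (rewrite <- S_INR; apply le_INR; lia).
    assert (Hm1 : 2 * INR P <= INR m).
    { replace (2 * INR P) with (INR (2 * P)) by (rewrite mult_INR; simpl; ring). apply le_INR; lia. }
    assert (Pn := pos_INR n).
    apply Rle_trans with ((INR m + al - (INR n + al)) / (INR m + al)); [|apply inv_le_ln_diff; lra].
    apply -> Rle_div_r; lra.
Qed.

Lemma freq_abs_le n N : (n <= N)%nat -> Rabs (l n) <= 1 + ln (INR N + 1).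
Proof.
  intros H. assert (PN := pos_INR N). assert (L := ln_nonneg (INR N + 1) ltac:(lra)).
  assert (A := freq_lower al Hal n).
  assert (B : l n <= ln (INR N + 1)).
  { apply ln_le; [generalize (pos_INR n); lra|]. apply le_INR in H. lra. }
  apply Rabs_le. lra.
Qed.

Lemma sign_choice P : (1 <= P)%nat -> exists m,
  Rabs (sumR (fun n => sign_at m n * w n) (4 * P)) <= 4 /\
  Rpower (INR (4 * P)) (1 / 8) / 16 - 4 * (1 + ln (INR (4 * P) + 1)) <=
    Rabs (sumR (fun n => sign_at m n * w n * l n) (4 * P)).
Proof.
  intros HP. set (N := (4 * P)%nat).
  assert (T0 : 0 <= sumR w N) by (apply sumR_nonneg; intros; left; apply weight_pos).
  destruct (partial_sum_crossing N (sumR w N / 2)) as [m [Hm E]]; [lra|].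
  exists m.
  assert (S0 : Rabs (sumR (fun n => sign_at m n * w n) N) <= 4).
  { rewrite sum_sign by exact Hm. apply Rabs_le. lra. }
  split; [exact S0|].
  assert (L := spread_lower_bound P m HP Hm). fold N in L.
  (* the signs change exactly where [l n - l m] does *)
  assert (Eq : sumR (fun n => w n * Rabs (l n - l m)) N =
     l m * sumR (fun n => sign_at m n * w n) N - sumR (fun n => sign_at m n * w n * l n) N).
  { rewrite <- sumR_scal.
    replace (sumR (fun n => l m * (sign_at m n * w n)) N) with
     (sumR (fun n => w n * Rabs (l n - l m) + sign_at m n * w n * l n) N); [rewrite sumR_plus; ring|].
    apply sumR_ext. intros n _. unfold sign_at. destruct (Nat.ltb_spec n m) as [H|H].
    - rewrite Rabs_left1; [ring|]. generalize (freq_le al Hal n m ltac:(lia)). lra.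
    - rewrite Rabs_pos_eq; [ring|]. generalize (freq_le al Hal m n ltac:(lia)). lra. }
  rewrite Eq in L.
  assert (F := freq_abs_le m N Hm).
  assert (Q : Rabs (l m * sumR (fun n => sign_at m n * w n) N) <= 4 * (1 + ln (INR N + 1))).
  { rewrite Rabs_mult, Rmult_comm. apply Rmult_le_compat; try apply Rabs_pos; assumption. }
  generalize (Rle_abs (l m * sumR (fun n => sign_at m n * w n) N))
    (Rle_abs (- sumR (fun n => sign_at m n * w n * l n) N)). rewrite Rabs_Ropp. lra.
Qed.

Lemma weight_sum_le M : sumR w (S M) <= 2 + 16 * Rpower (INR M + 1) (1 / 8).
Proof.
  assert (H : sumR w (S M) <= 2 + 16 * Rpower (INR M + al) (1 / 8)).
  { induction M as [|M IH].
    - simpl. generalize (weight_le_2 al Hal 0) (Rpower_pos (0 + al) (1 / 8)). lra.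
    - change (sumR w (S (S M))) with (sumR w (S M) + w (S M)).
      assert (PM := pos_INR M).
      assert (T := Rpower_telescope_pos (1 / 8) (INR M + al) ltac:(lra) ltac:(lra)).
      unfold weight at 2. rewrite S_INR. replace (INR M + 1 + al) with (INR M + al + 1) by ring.
      replace (1 / 8 - 1) with (- (7 / 8)) in T by field. lra. }
  apply Rle_trans with (1 := H).
  assert (Rpower (INR M + al) (1 / 8) <= Rpower (INR M + 1) (1 / 8)); [|lra].
  apply Rpower_le_base_pos; generalize (pos_INR M); lra.
Qed.

Lemma dpoly_linear_approx (b : nat -> R) N r La (z z' : C) :
  (forall n, (n < N)%nat -> Rabs (b n) <= w n / 2) -> (forall n, (n < N)%nat -> Rabs (l n) <= La) ->
  0 <= r -> r * La <= 1 -> Cmod z <= r -> Cmod z' <= r ->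
  Cmod (dpoly l (fun n => RtoC (b n)) N z - dpoly l (fun n => RtoC (b n)) N z' -
        RtoC (- sumR (fun n => b n * l n)%R N) * (z - z'))%C
  <= sumR w N * (3 / 2 * r * La ^ 2) * Cmod (z - z')%C.
Proof.
  intros Hb Hl Hr HrL Hz Hz'. unfold dpoly.
  replace (RtoC (- sumR (fun n => b n * l n)%R N) * (z - z'))%C with
    (sumC (fun n => RtoC (b n) * (- (z - z') * RtoC (l n)))%C N).
  2:{ clear. induction N as [|N IH]; simpl; [apply C_eq; simpl; ring|]. rewrite IH.
      rewrite !RtoC_opp, RtoC_plus, RtoC_mult. ring. }
  rewrite <- !sumC_minus.
  eapply Rle_trans; [apply Cmod_sumC_le|].
  rewrite Rmult_assoc, Rmult_comm, <- sumR_scal. apply sumR_le. intros n Hn.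
  replace (RtoC (b n) * Cexp (- z * RtoC (l n)) - RtoC (b n) * Cexp (- z' * RtoC (l n)) - RtoC (b n) * (- (z - z') * RtoC (l n)))%C with
   (RtoC (b n) * (Cexp (- z * RtoC (l n)) - Cexp (- z' * RtoC (l n)) - (- z * RtoC (l n) - - z' * RtoC (l n))))%C by ring.
  rewrite Cmod_mult, Cmod_R.
  assert (Ll := Hl n Hn). assert (L0 := Rabs_pos (l n)).
  assert (Q := Cexp_second_order (- z * RtoC (l n)) (- z' * RtoC (l n)) (r * Rabs (l n))).
  rewrite !Cmod_mult, !Cmod_opp, !Cmod_R in Q.
  specialize (Q ltac:(now apply Rmult_le_compat_r) ltac:(now apply Rmult_le_compat_r)).
  replace (- z * RtoC (l n) - - z' * RtoC (l n))%C with (- (z - z') * RtoC (l n))%C in Q |- * by ring.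
  rewrite Cmod_mult, Cmod_opp, Cmod_R in Q.
  set (d := Cmod (z - z')%C) in *. assert (d0 : 0 <= d) by apply Cmod_ge_0.
  assert (Ex : exp (r * Rabs (l n)) <= 3) by (apply exp_small; nra).
  apply Rle_trans with (w n / 2 * (d * Rabs (l n) * (r * Rabs (l n) * 3))).
  - apply Rmult_le_compat; [apply Rabs_pos|apply Cmod_ge_0|now apply Hb|].
    eapply Rle_trans; [exact Q|]. apply Rmult_le_compat_l; [now apply Rmult_le_pos|].
    apply Rmult_le_compat_l; [now apply Rmult_le_pos|exact Ex].
  - replace (w n / 2 * (d * Rabs (l n) * (r * Rabs (l n) * 3))) with
     (d * (3 / 2 * r) * w n * (Rabs (l n) * Rabs (l n))) by field.
    replace (3 / 2 * r * La ^ 2 * d * w n) with (d * (3 / 2 * r) * w n * (La * La)) by ring.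
    apply Rmult_le_compat_l.
    + apply Rmult_le_pos; [|left; apply weight_pos]. apply Rmult_le_pos; [exact d0|lra].
    + apply Rmult_le_compat; assumption.
Qed.

Definition head_coef (m N n : nat) : R := if Nat.ltb n N then sign_at m n else 0.

Lemma head_coef_abs m N n : Rabs (head_coef m N n) <= 1.
Proof.
  unfold head_coef, sign_at. destruct (Nat.ltb n N); [destruct (Nat.ltb n m)|];
  [rewrite Rabs_R1|rewrite Rabs_left|rewrite Rabs_R0]; lra.
Qed.

Lemma head_function (V N' : nat) : let v := INR V in let N := (4 * V ^ 32)%nat in
  1000000 <= v -> (N <= N')%nat -> exists m (A : R),
  let g := dpoly l (fun n => RtoC (w n * (head_coef m N n / 2))) N' in
  let r := / (20000000 * v ^ 2) in
  v ^ 4 / 64 <= Rabs A /\ Cmod (g 0) <= 2 /\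
  forall z z', Cmod z <= r -> Cmod z' <= r ->
    Cmod (g z - g z' - RtoC A * (z - z'))%C <= v ^ 4 / 256 * Cmod (z - z')%C.
Proof.
  intros v N Hv HN.
  assert (v4 : 0 < v ^ 4) by (apply pow_lt; lra).
  assert (v32 : 1 <= v ^ 32) by (apply pow_R1_Rle; lra).
  assert (EN : INR N = 4 * v ^ 32).
  { unfold N. rewrite mult_INR, pow_INR. simpl (INR 4). unfold v. ring. }
  assert (HP : (1 <= V ^ 32)%nat).
  { apply INR_le. rewrite pow_INR. simpl (INR 1). exact v32. }
  destruct (sign_choice (V ^ 32) HP) as [m [S0 S1]]. fold N in S0, S1.
  assert (R8 : v ^ 4 <= Rpower (INR N) (1 / 8) <= 2 * v ^ 4).
  { rewrite EN, <- Rpower_mult_distr by lra.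
    assert (Ev : Rpower (v ^ 32) (1 / 8) = v ^ 4).
    { rewrite <- (Rpower_pow 32), Rpower_mult by lra. rewrite <- (Rpower_pow 4) by lra. f_equal. simpl. lra. }
    rewrite Ev.
    assert (1 <= Rpower 4 (1 / 8) <= 2); [|split; nra]. split.
    - apply Rle_trans with (Rpower 4 0); [right; symmetry; apply Rpower_O; lra|apply Rpower_le_exp; lra].
    - apply Rle_trans with (Rpower 4 (/ 2)); [apply Rpower_le_exp; lra|]. rewrite Rpower_sqrt by lra.
      replace 4 with (2 * 2) by ring. rewrite sqrt_square; lra. }
  assert (La : 1 + ln (INR N + 1) <= 34 * v).
  { assert (ln (INR N + 1) <= 33 * ln v).
    { replace (33 * ln v) with (ln (v ^ 33)) by (rewrite ln_pow by lra; simpl (INR 33); ring).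
      apply ln_le; [lra|]. rewrite EN. simpl pow. simpl pow in v32. nra. }
    assert (ln v <= v - 1) by (generalize (exp_ineq1_le (ln v)); rewrite exp_ln; lra). lra. }
  set (b := fun n => sign_at m n * w n / 2).
  set (A := - sumR (fun n => b n * l n) N).
  exists m, A. intros g r.
  assert (r0 : 0 < r) by (apply Rinv_0_lt_compat; nra).
  assert (Eg : forall z, g z = dpoly l (fun n => RtoC (b n)) N z).
  { intros z. unfold g, dpoly. clear -HN. induction HN as [|N' HN IH].
    - apply sumC_ext. intros n Hn. unfold head_coef, b. apply Nat.ltb_lt in Hn. rewrite Hn.
      do 2 f_equal. field.
    - cbn [sumC]. rewrite IH. unfold head_coef. replace (Nat.ltb N' N) with false by (symmetry; apply Nat.ltb_ge; lia).
      replace (w N' * (0 / 2)) with 0 by field. ring. }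
  assert (EA : A = - (sumR (fun n => sign_at m n * w n * l n) N / 2)).
  { unfold A. f_equal. unfold Rdiv. rewrite Rmult_comm, <- sumR_scal. apply sumR_ext. intros; unfold b; field. }
  split; [|split].
  - rewrite EA, Rabs_Ropp. unfold Rdiv at 2. rewrite Rabs_mult, (Rabs_pos_eq (/ 2)) by lra.
    assert (v ^ 4 / 16 - 4 * (34 * v) <= Rabs (sumR (fun n => sign_at m n * w n * l n) N)) by lra.
    assert (v * 1000000 <= v ^ 4).
    { replace (v ^ 4) with (v * (v * (v * v))) by ring. apply Rmult_le_compat_l; [lra|]. nra. }
    lra.
  - rewrite Eg. unfold dpoly.
    replace (sumC (fun n => RtoC (b n) * Cexp (- 0 * RtoC (l n)))%C N) with (RtoC (sumR (fun n => sign_at m n * w n) N / 2)).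
    + rewrite Cmod_R. unfold Rdiv. rewrite Rabs_mult, (Rabs_pos_eq (/ 2)) by lra. lra.
    + unfold b. clear. induction N as [|N IH]; simpl; [apply C_eq; simpl; field|]. rewrite <- IH.
      replace (- 0 * RtoC (l N))%C with (RtoC 0) by ring. rewrite Cexp_0. apply C_eq; simpl; field.
  - intros z z' Hz Hz'. rewrite !Eg.
    assert (rv : r * (34 * v) <= 1).
    { unfold r. apply Rmult_le_reg_l with (20000000 * v ^ 2); [nra|].
      rewrite <- Rmult_assoc, Rinv_r, Rmult_1_l, Rmult_1_r by nra. simpl. nra. }
    assert (Q := dpoly_linear_approx b N r (34 * v) z z').
    eapply Rle_trans; [apply Q; auto|].
    + intros n Hn. unfold b, Rdiv. rewrite !Rabs_mult, (Rabs_pos_eq (/ 2)), (Rabs_pos_eq (w n)) by (try left; try apply weight_pos; lra).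
      apply Rmult_le_compat_r; [lra|]. rewrite <- (Rmult_1_l (w n)) at 2. apply Rmult_le_compat_r; [left; apply weight_pos|].
      unfold sign_at. destruct (Nat.ltb n m); [rewrite Rabs_R1|rewrite Rabs_left]; lra.
    + intros n Hn. eapply Rle_trans; [apply (freq_abs_le n N); lia|exact La].
    + lra.
    + apply Rmult_le_compat_r; [apply Cmod_ge_0|].
      assert (W : sumR w N <= 34 * v ^ 4).
      { assert (N0 : exists M, N = S M).
        { destruct N as [|M]; [|now exists M]. simpl in EN. lra. }
        destruct N0 as [M EM]. rewrite EM. eapply Rle_trans; [apply weight_sum_le|].
        rewrite <- S_INR, <- EM.
        assert (1 <= v ^ 4) by (apply pow_R1_Rle; lra). lra. }
      assert (E2 : 3 / 2 * r * (34 * v) ^ 2 = 1734 / 20000000).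
      { unfold r. field. lra. }
      rewrite E2. lra.
Qed.
End Signs.

Lemma Cmod_le_abs_sum (z : C) : Cmod z <= Rabs (Re z) + Rabs (Im z).
Proof.
  assert (E : z = (RtoC (Re z) + Ci * RtoC (Im z))%C) by (apply C_eq; destruct z; simpl; ring).
  rewrite E at 1. eapply Rle_trans; [apply Cmod_triangle|]. rewrite Cmod_mult, Cmod_Ci, !Cmod_R. lra.
Qed.

Lemma is_lim_seqC_CSeries f : abs_summable f -> is_lim_seqC (fun N => sumC f N) (CSeries f).
Proof.
  intros H.
  assert (ER : is_lim_seq (fun N => Re (sumC f N) - Re (CSeries f)) 0).
  { replace (Finite 0) with (Finite (Re (CSeries f) - Re (CSeries f))) by (f_equal; ring).
    apply is_lim_seq_minus'; [|apply is_lim_seq_const]. apply is_lim_seq_incr_1.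
    apply is_lim_seq_ext with (u := sum_n (fun n => Re (f n))).
    - intros n. rewrite sum_n_sumR. generalize (S n). intros k. induction k as [|k IH]; simpl; [reflexivity|]. rewrite IH. reflexivity.
    - apply (Series_correct _ (abs_summable_Re _ H)). }
  assert (EI : is_lim_seq (fun N => Im (sumC f N) - Im (CSeries f)) 0).
  { replace (Finite 0) with (Finite (Im (CSeries f) - Im (CSeries f))) by (f_equal; ring).
    apply is_lim_seq_minus'; [|apply is_lim_seq_const]. apply is_lim_seq_incr_1.
    apply is_lim_seq_ext with (u := sum_n (fun n => Im (f n))).
    - intros n. rewrite sum_n_sumR. generalize (S n). intros k. induction k as [|k IH]; simpl; [reflexivity|]. rewrite IH. reflexivity.
    - apply (Series_correct _ (abs_summable_Im _ H)). }
  apply is_lim_seq_le_le with (u := fun _ => 0)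
    (w := fun N => Rabs (Re (sumC f N) - Re (CSeries f)) + Rabs (Im (sumC f N) - Im (CSeries f))).
  - intros N. split; [apply Cmod_ge_0|].
    exact (Cmod_le_abs_sum (sumC f N - CSeries f)%C).
  - apply is_lim_seq_const.
  - replace (Finite 0) with (Finite (Rabs 0 + Rabs 0)) by (rewrite Rabs_R0; f_equal; ring).
    apply is_lim_seq_plus'; apply is_lim_seq_abs with (l := Finite 0); assumption.
Qed.

Lemma newton_zero (f : C -> C) (A : C) r : A <> 0%C -> 0 < r ->
  (forall z w, Cmod z <= r -> Cmod w <= r -> Cmod (f z - f w - A * (z - w))%C <= Cmod A / 2 * Cmod (z - w)%C) ->
  Cmod (f 0) <= Cmod A * r / 2 ->
  exists z, Cmod z <= r /\ f z = 0%C.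
Proof.
  intros A0 Hr Hf H0. assert (PA : 0 < Cmod A) by now apply Cmod_gt_0.
  set (step := fun z => (z - f z / A)%C).
  set (zs := fun n => Nat.iter n step 0%C).
  assert (Inv : forall n, Cmod (zs n) <= r * (1 - (1 / 2) ^ n) /\ Cmod (f (zs n)) <= Cmod A * r / 2 * (1 / 2) ^ n).
  { induction n as [|n [I1 I2]].
    - unfold zs; simpl. rewrite Cmod_0. split; lra.
    - change (zs (S n)) with (step (zs n)). unfold step. set (z := zs n) in *.
      assert (h0 : 0 < (1 / 2) ^ n) by (apply pow_lt; lra).
      assert (D : Cmod (f z / A)%C <= r / 2 * (1 / 2) ^ n).
      { rewrite Cmod_div by exact A0. apply Rmult_le_reg_r with (Cmod A); [exact PA|].
        unfold Rdiv at 1. rewrite Rmult_assoc, Rinv_l by lra. lra. }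
      assert (B : Cmod (z - f z / A)%C <= r * (1 - (1 / 2) ^ S n)).
      { eapply Rle_trans; [apply Cmod_triangle_minus|]. simpl pow. lra. }
      split; [exact B|].
      assert (h1 : (1 / 2) ^ n <= 1) by (apply Rle_trans with (1 ^ n); [apply pow_incr; lra|rewrite pow1; lra]).
      assert (Bz : Cmod (z - f z / A)%C <= r).
      { eapply Rle_trans; [exact B|]. assert (0 < (1 / 2) ^ S n) by (apply pow_lt; lra). nra. }
      assert (Bz0 : Cmod z <= r) by nra.
      assert (Q := Hf (z - f z / A)%C z Bz Bz0).
      replace (f (z - f z / A) - f z - A * (z - f z / A - z))%C with (f (z - f z / A))%C in Q by (field; exact A0).
      replace (z - f z / A - z)%C with (- (f z / A))%C in Q by ring. rewrite Cmod_opp in Q.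
      eapply Rle_trans; [exact Q|]. simpl pow.
      apply Rle_trans with (Cmod A / 2 * (r / 2 * (1 / 2) ^ n)); [apply Rmult_le_compat_l; lra|lra]. }
  set (d := fun n => (- (f (zs n) / A))%C).
  assert (Bd : forall n, Cmod (d n) <= r / 2 * (1 / 2) ^ n).
  { intros n. unfold d. rewrite Cmod_opp, Cmod_div by exact A0. apply Rmult_le_reg_r with (Cmod A); [exact PA|].
    unfold Rdiv at 1. rewrite Rmult_assoc, Rinv_l by lra. generalize (proj2 (Inv n)). lra. }
  assert (Es : forall n, sumC d n = zs n).
  { induction n as [|n IH]; [reflexivity|]. simpl sumC. rewrite IH.
    change (zs (S n)) with (step (zs n)). unfold step, d. ring. }
  assert (Gs : is_series (fun n => r / 2 * (1 / 2) ^ n) (r / 2 * / (1 - 1 / 2))).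
  { apply (is_series_scal (V := R_NormedModule) (r / 2)). apply is_series_geom. rewrite Rabs_pos_eq; lra. }
  assert (Ad : abs_summable d) by (apply abs_summable_le with (1 := Bd); eexists; exact Gs).
  assert (Lz := is_lim_seqC_CSeries d Ad). set (z := CSeries d) in *.
  apply (is_lim_seqC_ext _ zs) in Lz; [|exact Es].
  assert (Hz : Cmod z <= r).
  { eapply Rle_trans; [apply (Cmod_CSeries_le d _ Bd); eexists; exact Gs|].
    rewrite (is_series_unique _ _ Gs). right; field. }
  exists z. split; [exact Hz|].
  assert (Rz : forall n, Cmod (zs n) <= r).
  { intros n. assert (h0 : 0 < (1 / 2) ^ n) by (apply pow_lt; lra). generalize (proj1 (Inv n)). nra. }
  assert (Lip : forall n, Cmod (f z) <= 2 * Cmod A * Cmod (zs n - z)%C + Cmod A * r / 2 * (1 / 2) ^ n).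
  { intros n. assert (Q := Hf (zs n) z (Rz n) Hz).
    replace (f z) with (f (zs n) - ((f (zs n) - f z - A * (zs n - z)) + A * (zs n - z)))%C by ring.
    eapply Rle_trans; [apply Cmod_triangle_minus|].
    generalize (Cmod_triangle (f (zs n) - f z - A * (zs n - z))%C (A * (zs n - z))%C) (proj2 (Inv n)).
    rewrite Cmod_mult. generalize (Cmod_ge_0 (zs n - z)%C). intros.
    assert (0 <= Cmod A * Cmod (zs n - z)%C) by (apply Rmult_le_pos; lra). lra. }
  assert (L2 : is_lim_seq (fun n => 2 * Cmod A * Cmod (zs n - z)%C + Cmod A * r / 2 * (1 / 2) ^ n)
     (2 * Cmod A * 0 + Cmod A * r / 2 * 0)).
  { apply is_lim_seq_plus'.
    - apply (is_lim_seq_scal_l _ _ 0 Lz).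
    - apply (is_lim_seq_scal_l _ _ 0). apply is_lim_seq_geom. rewrite Rabs_pos_eq; lra. }
  assert (F0 := is_lim_seq_le _ _ _ _ Lip (is_lim_seq_const (Cmod (f z))) L2). simpl in F0.
  apply Cmod_eq_0. generalize (Cmod_ge_0 (f z)). lra.
Qed.

(** * Multiplicative relations and algebraic parameters *)

Inductive is_poly : nat -> (R -> R) -> Prop :=
| is_poly_const c f : (forall x, f x = c) -> is_poly 0 f
| is_poly_horner n a g f : is_poly n g -> (forall x, f x = a + x * g x) -> is_poly (S n) f.

Lemma is_poly_ext n f g : (forall x, f x = g x) -> is_poly n f -> is_poly n g.
Proof.
  intros E H. destruct H as [c f H|n a h f H1 H2].
  - apply is_poly_const with c. intros x; now rewrite <- E.
  - apply is_poly_horner with a h; [exact H1|]. intros x; now rewrite <- E.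
Qed.

Lemma is_poly_scal n f c : is_poly n f -> is_poly n (fun x => c * f x).
Proof.
  intros H. induction H as [k f H|n a h f H1 IH H2].
  - apply is_poly_const with (c * k). intros x; now rewrite H.
  - apply is_poly_horner with (c * a) (fun x => c * h x); [exact IH|]. intros x. rewrite H2. ring.
Qed.

Lemma is_poly_S n f : is_poly n f -> is_poly (S n) f.
Proof.
  intros H. induction H as [k f H|n a h f H1 IH H2].
  - apply is_poly_horner with k (fun _ => 0); [now apply is_poly_const with 0|]. intros x; rewrite H; ring.
  - now apply is_poly_horner with a h.
Qed.

Lemma is_poly_plus n f g : is_poly n f -> is_poly n g -> is_poly n (fun x => f x + g x).
Proof.
  intros H. revert g. induction H as [k f H|n a h f H1 IH H2]; intros g Hg.
  - inversion Hg as [k' g' Hg'|]; subst. apply is_poly_const with (k + k'). intros x; now rewrite H, Hg'.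
  - inversion Hg as [|n' a' h' g' H1' H2']; subst.
    apply is_poly_horner with (a + a') (fun x => h x + h' x); [now apply IH|]. intros x. rewrite H2, H2'. ring.
Qed.

Lemma is_poly_le n m f : (n <= m)%nat -> is_poly n f -> is_poly m f.
Proof. intros H Hf. induction H; [exact Hf|now apply is_poly_S]. Qed.

Lemma is_poly_mult_linear n f a : is_poly n f -> is_poly (S n) (fun x => (a + x) * f x).
Proof.
  intros H. apply is_poly_ext with (f := fun x => a * f x + x * f x); [intros; ring|].
  apply (is_poly_plus (S n) (fun x => a * f x) (fun x => x * f x)).
  - apply is_poly_S, is_poly_scal, H.
  - apply is_poly_horner with 0 f; [exact H|]. intros x; ring.
Qed.

Lemma is_poly_factor n : forall f c, is_poly (S n) f ->
  exists h, is_poly n h /\ forall x, f x = f c + (x - c) * h x.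
Proof.
  induction n as [|n IH]; intros f c H; inversion H as [|n' a g f' Hg Hf]; subst.
  - inversion Hg as [k g' Hk|]; subst. exists (fun _ => k). split; [now apply is_poly_const with k|].
    intros x. rewrite !Hf, !Hk. ring.
  - destruct (IH g c Hg) as [h [Hh E]]. exists (fun x => g c + x * h x). split.
    + now apply is_poly_horner with (g c) h.
    + intros x. rewrite !Hf, (E x). ring.
Qed.

Lemma is_poly_roots_finite n : forall f, is_poly n f -> (exists x, f x <> 0) ->
  exists L : list R, forall x, f x = 0 -> In x L.
Proof.
  induction n as [|n IH]; intros f H [x0 Hx0].
  - inversion H as [k f' Hk|]; subst. exists nil. intros x Hx. rewrite Hk in Hx, Hx0. contradiction.
  - destruct (classic (exists c, f c = 0)) as [[c Hc]|N].
    + destruct (is_poly_factor n f c H) as [h [Hh E]].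
      destruct (IH h Hh) as [L HL].
      { exists x0. intros Z. apply Hx0. rewrite E, Hc, Z. ring. }
      exists (c :: L). intros x Hx. rewrite E, Hc, Rplus_0_l in Hx.
      apply Rmult_integral in Hx. destruct Hx as [Hx|Hx]; [left; lra|right; now apply HL].
    + exists nil. intros x Hx. apply N. now exists x.
Qed.

Definition shift_prod (e : nat -> nat) (M : nat) (x : R) : R := prodR (fun i => (INR i + x) ^ e i) M.

Lemma shift_prod_poly e M : exists n, is_poly n (shift_prod e M).
Proof.
  induction M as [|M [n IH]].
  - exists O. now apply is_poly_const with 1.
  - exists (e M + n)%nat.
    apply is_poly_ext with (f := fun x => (INR M + x) ^ e M * shift_prod e M x).
    { intros x. unfold shift_prod. simpl. ring. }
    induction (e M) as [|j IHj].
    + apply is_poly_ext with (2 := IH). intros; simpl; ring.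
    + apply is_poly_ext with (f := fun x => (INR M + x) * ((INR M + x) ^ j * shift_prod e M x)); [intros; simpl; ring|].
      apply is_poly_mult_linear, IHj.
Qed.

Lemma prodR_nonzero f n : (forall i, (i < n)%nat -> f i <> 0) -> prodR f n <> 0.
Proof.
  induction n as [|n IH]; intros H; simpl; [lra|].
  apply Rmult_integral_contrapositive_currified; [apply IH; intros; apply H; lia|apply H; lia].
Qed.

Lemma ln_shift_prod e M x : 0 < x -> 0 < shift_prod e M x /\
  ln (shift_prod e M x) = sumR (fun i => INR (e i) * ln (INR i + x)) M.
Proof.
  intros Hx. unfold shift_prod. induction M as [|M [P E]]; simpl.
  - split; [lra|apply ln_1].
  - assert (Q : 0 < INR M + x) by (generalize (pos_INR M); lra).
    assert (Q' : 0 < (INR M + x) ^ e M) by now apply pow_lt.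
    split; [now apply Rmult_lt_0_compat|]. rewrite ln_mult, E, ln_pow by assumption. reflexivity.
Qed.

Lemma shift_prod_root e M j : (j < M)%nat -> shift_prod e M (- INR j) = 0 <-> (j < M)%nat /\ e j <> O.
Proof.
  intros H. split.
  - intros Z. split; [exact H|]. intros E. revert Z. apply prodR_nonzero. intros i Hi.
    destruct (Nat.eq_dec i j) as [->|D]; [rewrite E; simpl; lra|].
    apply pow_nonzero. apply not_INR in D. lra.
  - intros [_ E]. apply prodR_zero with j; [exact H|].
    replace (INR j + - INR j) with 0 by ring. apply pow_i. lia.
Qed.

Lemma relation_roots_finite (k : nat -> Z) M j : (j < M)%nat -> k j <> 0%Z ->
  exists L : list R, forall x, 0 < x -> sumR (fun i => IZR (k i) * ln (INR i + x)) M = 0 -> In x L.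
Proof.
  intros Hj Kj.
  set (ep := fun i => Z.to_nat (k i)). set (em := fun i => Z.to_nat (- k i)).
  destruct (shift_prod_poly ep M) as [n1 P1]. destruct (shift_prod_poly em M) as [n2 P2].
  assert (P : is_poly (n1 + n2) (fun x => shift_prod ep M x + -1 * shift_prod em M x)).
  { apply (is_poly_plus _ (shift_prod ep M) (fun x => -1 * shift_prod em M x)).
    - apply is_poly_le with (2 := P1). lia.
    - apply is_poly_scal. apply is_poly_le with (2 := P2). lia. }
  destruct (is_poly_roots_finite _ _ P) as [L HL].
  - (* at x = - j exactly one of the two products vanishes *)
    exists (- INR j). intros Z.
    assert (Rp := shift_prod_root ep M j Hj). assert (Rm := shift_prod_root em M j Hj).
    assert (D : (0 < k j)%Z \/ (k j < 0)%Z) by lia. destruct D as [D|D].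
    + assert (E1 : shift_prod ep M (- INR j) = 0) by (apply Rp; split; [exact Hj|unfold ep; lia]).
      assert (E2 : shift_prod em M (- INR j) = 0) by lra. apply Rm in E2. unfold em in E2. lia.
    + assert (E1 : shift_prod em M (- INR j) = 0) by (apply Rm; split; [exact Hj|unfold em; lia]).
      assert (E2 : shift_prod ep M (- INR j) = 0) by lra. apply Rp in E2. unfold ep in E2. lia.
  - exists L. intros x Hx E. apply HL.
    destruct (ln_shift_prod ep M x Hx) as [Qp Ep]. destruct (ln_shift_prod em M x Hx) as [Qm Em].
    assert (EL : ln (shift_prod ep M x) = ln (shift_prod em M x)).
    { apply Rminus_diag_uniq. rewrite Ep, Em, <- E.
      unfold Rminus. replace (- sumR (fun i => INR (em i) * ln (INR i + x)) M) with
        (-1 * sumR (fun i => INR (em i) * ln (INR i + x)) M) by ring.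
      rewrite <- sumR_scal, <- sumR_plus. apply sumR_ext. intros i _. unfold ep, em.
      rewrite !INR_IZR_INZ. destruct (Z.le_gt_cases 0 (k i)) as [H|H].
      - rewrite Z2Nat.id by lia. replace (Z.to_nat (- k i)) with O by lia. simpl. ring.
      - replace (Z.to_nat (k i)) with O by lia. rewrite Z2Nat.id by lia. rewrite opp_IZR. simpl. ring. }
    apply ln_inv in EL; [rewrite EL; ring|assumption|assumption].
Qed.

Fixpoint small_vectors (M : nat) : list (nat -> Z) :=
  match M with
  | O => (fun _ => 0%Z) :: nil
  | S m => flat_map (fun k => map (fun j i => if Nat.eqb i m then j else k i) (-2 :: -1 :: 0 :: 1 :: 2 :: nil)%Z)
             (small_vectors m)
  end.

Lemma small_vectors_complete M (k : nat -> Z) : (forall i, (Z.abs (k i) <= 2)%Z) ->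
  exists k', In k' (small_vectors M) /\ forall i, (i < M)%nat -> k' i = k i.
Proof.
  intros H. induction M as [|M [k' [I E]]].
  - exists (fun _ => 0%Z). split; [now left|intros; lia].
  - exists (fun i => if Nat.eqb i M then k M else k' i). split.
    + simpl. apply in_flat_map. exists k'. split; [exact I|].
      apply (in_map (fun j i => if Nat.eqb i M then j else k' i) (-2 :: -1 :: 0 :: 1 :: 2 :: nil)%Z (k M)).
      specialize (H M). simpl. lia.
    + intros i Hi. destruct (Nat.eqb_spec i M) as [->|D]; [reflexivity|apply E; lia].
Qed.

Lemma finite_union {A B : Type} (Q : A -> B -> Prop) (ks : list A) :
  (forall k, exists L, forall x, Q k x -> In x L) ->
  exists L, forall k, In k ks -> forall x, Q k x -> In x L.
Proof.
  intros H. induction ks as [|k ks [L IH]].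
  - exists nil. intros k [].
  - destruct (H k) as [L' HL']. exists (L' ++ L). intros k' [->|I] x Hx; apply in_or_app; [left; now apply HL'|right; now apply (IH k')].
Qed.

Lemma no_relation_cofinite M : exists L : list R, forall al, 0 < al -> ~ In al L -> no_relation (freq al) M.
Proof.
  destruct (finite_union (fun (k : nat -> Z) al => 0 < al /\ (exists j, (j < M)%nat /\ k j <> 0%Z) /\
     sumR (fun i => IZR (k i) * ln (INR i + al)) M = 0) (small_vectors M)) as [L HL].
  - intros k. destruct (classic (exists j, (j < M)%nat /\ k j <> 0%Z)) as [[j [Hj Kj]]|N].
    + destruct (relation_roots_finite k M j Hj Kj) as [L HL]. exists L. intros x (H1 & _ & H2). now apply HL.
    + exists nil. intros x (_ & H & _). contradiction.
  - exists L. intros al Ha NI k Hk E i Hi.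
    destruct (Z.eq_dec (k i) 0) as [Z|Z]; [exact Z|]. exfalso. apply NI.
    destruct (small_vectors_complete M k Hk) as [k' [I Ek]].
    apply (HL k' I). split; [exact Ha|]. split.
    + exists i. split; [exact Hi|]. now rewrite Ek.
    + rewrite <- E. apply sumR_ext. intros j Hj. now rewrite Ek.
Qed.

Lemma two_squares_Z : forall n (a b : Z), (Z.abs_nat b <= n)%nat -> (a * a = 2 * (b * b))%Z -> b = 0%Z.
Proof.
  induction n as [|n IH]; intros a b Hn E; [lia|].
  destruct (Z.eq_dec b 0) as [Z|Z]; [exact Z|].
  destruct (Z.Even_or_Odd a) as [[c ->]|[c ->]]; [|exfalso; lia].
  destruct (Z.Even_or_Odd b) as [[d ->]|[d ->]]; [|exfalso; lia].
  assert (d = 0%Z); [|lia]. apply (IH c d); [lia|nia].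
Qed.

Definition quadratic_param (j : nat) : R := sqrt 2 * (INR (j + 10) / INR (2 * j + 21)).

Lemma quadratic_param_den j : 0 < INR (j + 10) /\ 0 < INR (2 * j + 21) /\ INR (2 * j + 21) = 2 * INR (j + 10) + 1 /\ 10 <= INR (j + 10).
Proof.
  assert (P := pos_INR j). rewrite !plus_INR, mult_INR. simpl (INR 10); simpl (INR 21); simpl (INR 2). lra.
Qed.

Lemma sqrt2_bounds : 7 / 5 < sqrt 2 < 3 / 2 /\ sqrt 2 * sqrt 2 = 2.
Proof.
  assert (E : sqrt 2 * sqrt 2 = 2) by (apply sqrt_sqrt; lra). assert (P := sqrt_pos 2).
  split; [split|exact E]; nra.
Qed.

Lemma quadratic_param_range j : 1 / 2 < quadratic_param j < 1.
Proof.
  destruct (quadratic_param_den j) as (P1 & P2 & E & P3). destruct sqrt2_bounds as [[B1 B2] _].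
  unfold quadratic_param. set (x := INR (j + 10)) in *. rewrite E.
  assert (H : 10 / 21 <= x / (2 * x + 1) < 1 / 2).
  { split; [apply -> Rle_div_r|apply <- Rlt_div_l]; lra. }
  nra.
Qed.

Lemma quadratic_param_inj i j : quadratic_param i = quadratic_param j -> i = j.
Proof.
  destruct (quadratic_param_den i) as (P1 & P2 & E & P3). destruct (quadratic_param_den j) as (P1' & P2' & E' & P3').
  destruct sqrt2_bounds as [[B1 B2] _].
  unfold quadratic_param. intros H. apply Rmult_eq_reg_l in H; [|lra].
  rewrite E, E' in H. rewrite !plus_INR in *. set (x := INR i + INR 10) in *. set (y := INR j + INR 10) in *.
  assert (Q : x * (2 * y + 1) = y * (2 * x + 1)).
  { apply (f_equal (fun t => t * ((2 * x + 1) * (2 * y + 1)))) in H. field_simplify in H; lra. }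
  apply INR_eq. unfold x, y in Q. lra.
Qed.

Lemma quadratic_param_calA j : calA (quadratic_param j).
Proof.
  destruct (quadratic_param_den j) as (P1 & P2 & E & P3). destruct sqrt2_bounds as [[B1 B2] SQ].
  split; [|split].
  - generalize (quadratic_param_range j). lra.
  - set (u := Z.of_nat (j + 10)). set (v := Z.of_nat (2 * j + 21)).
    exists (fun i => match i with O => - (2 * (u * u)) | 2%nat => v * v | _ => 0 end)%Z, 2%nat.
    split.
    + exists 2%nat. split; [lia|]. unfold v. lia.
    + cbn [sum_f_R0]. rewrite opp_IZR, !mult_IZR. unfold u, v. rewrite <- !INR_IZR_INZ. unfold quadratic_param.
      set (x := INR (j + 10)) in *. set (y := INR (2 * j + 21)) in *.
      replace (y * y * (sqrt 2 * (x / y)) ^ 2) with (sqrt 2 * sqrt 2 * (x * x)) by (field; lra).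
      rewrite SQ. simpl. ring.
  - intros (p & q & Hq & H).
    assert (Hq' : IZR q <> 0) by now apply not_0_IZR.
    unfold quadratic_param in H. rewrite !INR_IZR_INZ in *.
    set (u := Z.of_nat (j + 10)) in *. set (v := Z.of_nat (2 * j + 21)) in *.
    assert (S : sqrt 2 * (IZR u * IZR q) = IZR p * IZR v).
    { apply (f_equal (fun t => t * (IZR v * IZR q))) in H.
      replace (sqrt 2 * (IZR u / IZR v) * (IZR v * IZR q)) with (sqrt 2 * (IZR u * IZR q)) in H by (field; lra).
      rewrite H. field. exact Hq'. }
    assert (T : (p * v * (p * v) = 2 * (u * q * (u * q)))%Z).
    { apply eq_IZR. rewrite !mult_IZR, <- S. transitivity (sqrt 2 * sqrt 2 * (IZR u * IZR q * (IZR u * IZR q))); [ring|now rewrite SQ]. }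
    apply (two_squares_Z (Z.abs_nat (u * q))) in T; [|lia].
    assert (u <> 0)%Z by (unfold u; lia). nia.
Qed.

Lemma Finite_list (T : Type) (A : T -> Prop) : Finite_sets.Finite T A -> exists L : list T, forall x, A x -> In x L.
Proof.
  intros H. induction H as [|A H [L IH] x Hx].
  - exists nil. intros x [].
  - exists (x :: L). intros y Hy. destruct Hy as [y Hy|y Hy]; [right; now apply IH|left; now destruct Hy].
Qed.

Lemma infinite_set_of_cofinite (A : R -> Prop) (L : list R) :
  (forall j, ~ In (quadratic_param j) L -> A (quadratic_param j)) -> infinite_set R A.
Proof.
  intros H F. destruct (Finite_list R A F) as [L' HL'].
  assert (Inc : incl (map quadratic_param (seq 0 (S (length (L ++ L'))))) (L ++ L')).
  { intros x Hx. apply in_map_iff in Hx. destruct Hx as [j [<- _]]. apply in_or_app.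
    destruct (classic (In (quadratic_param j) L)) as [I|I]; [now left|right; apply HL', H, I]. }
  apply NoDup_incl_length in Inc.
  - rewrite length_map, length_seq in Inc. lia.
  - apply Injective_map_NoDup; [|apply seq_NoDup]. intros i j. apply quadratic_param_inj.
Qed.

(** * Zeros *)

Lemma riesz_truncate l d N N' t : (N <= N')%nat -> (forall i, (N <= i)%nat -> d i = 0) ->
  riesz l d N' t = riesz l d N t.
Proof.
  intros H Z. unfold riesz. induction H as [|N' H IH]; [reflexivity|].
  simpl. rewrite IH, Z by exact H. ring.
Qed.

Lemma quad_form_nonneg l b M : 0 <= quad_form kernel l b M.
Proof. eapply Rle_trans; [apply pow2_ge_0|apply quad_form_ge_sum]. Qed.

Lemma primitive_near_nonneg f m B t1 t2 : primitive_near f m B -> t1 <= t2 ->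
  (forall t, t1 <= t <= t2 -> 0 <= f t) -> 0 <= m * (t2 - t1) + 2 * B.
Proof.
  intros [G [D E]] H P.
  assert (M := nonpos_derive_le (fun t => - G t) (fun t => - f t) t1 t2 H).
  assert (- G t2 <= - G t1).
  { apply M.
    - intros t _. apply (is_derive_opp G), D.
    - intros t Ht. generalize (P t Ht). lra. }
  generalize (Rle_abs (- (G t1 - m * t1))) (Rle_abs (G t2 - m * t2)) (E t1) (E t2).
  rewrite Rabs_Ropp. lra.
Qed.

Section Selection.
Variables (al : R) (N N' m : nat).
Hypothesis Hal : 1 / 2 <= al <= 1.
Hypothesis HN : (N <= N')%nat.
Hypothesis HN1 : (1 <= N')%nat.
Hypothesis Htail : 2 ^ N * (2048 * Rpower (INR N') (- (1 / 2))) <= 1.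
Hypothesis Hrel : no_relation (freq al) N'.
Notation l := (freq al).
Notation d := (head_coef m N).

Definition head_energy (t : R) : R := quad_form kernel l (rotating l (weight al) d t) N'.
Definition tail_energy (k : nat) (t : R) : R :=
  quad_form kernel l (rotating l (tail_weight al N') (fun _ => 0) t) (S (k ^ 16)).

Lemma head_mean_le : exists c, c <= 3072 /\ has_mean (fun t => riesz l d N' t * head_energy t) c.
Proof.
  eexists. split; [|apply riesz_quad_form_mean; exact Hrel].
  apply Rle_trans with (sumR (fun n => 1024 * Rpower (INR n + 1) (- (3 / 2))) N').
  - apply sumR_le. intros n _.
    assert (D1 : 0 <= 1 - d n ^ 2 / 4 <= 1).
    { assert (H := head_coef_abs m N n). apply Rabs_le_between in H. nra. }
    assert (B := weight_kernel_bound al Hal n n). rewrite <- Rpower_plus in B.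
    replace (- (3 / 4) + - (3 / 4)) with (- (3 / 2)) in B by field.
    assert (A := Rle_abs (weight al n * weight al n * kernel (l n * l n))).
    set (x := weight al n * weight al n * kernel (l n * l n)) in *.
    replace (weight al n ^ 2 * (1 - d n ^ 2 / 4) * kernel (l n * l n)) with ((1 - d n ^ 2 / 4) * x) by (unfold x; ring).
    generalize (Rabs_pos x). nra.
  - rewrite sumR_scal. generalize (diag_sum_le N'). lra.
Qed.

Lemma small_energy_exists : exists k0 : nat, forall k, (k0 <= k)%nat -> exists t,
  3 / 2 * INR k ^ 10 <= t <= 5 / 2 * INR k ^ 10 /\ head_energy t + tail_energy k t <= 3075.
Proof.
  destruct head_mean_le as [c [Hc [B1 M1]]].
  destruct (riesz_mean l d N' Hrel) as [B2 M2].
  assert (p2 : 1 <= 2 ^ N) by (apply pow_R1_Rle; lra).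
  set (Cst := Rabs B1 + 3075 * Rabs B2 + 2 ^ N * 524288 + 1).
  destruct (INR_unbounded (Cst + INR N' + 1)) as [k0 Hk0].
  exists k0. intros k Hk.
  assert (K : Cst + INR N' + 1 < INR k) by (apply le_INR in Hk; lra).
  assert (N'0 := pos_INR N').
  assert (C0 : 1 <= Cst) by (unfold Cst; generalize (Rabs_pos B1) (Rabs_pos B2); nra).
  assert (K1 : 1 <= INR k) by lra.
  assert (HkN : (N' <= S (k ^ 16))%nat).
  { apply INR_le. rewrite S_INR, pow_INR. assert (INR k <= INR k ^ 16); [|lra].
    rewrite <- (pow_1 (INR k)) at 1. apply Rle_pow; [exact K1|lia]. }
  (* otherwise F (head + tail - 3075) > 0 on the window, where F <= 2^N and the mean is negative *)
  apply NNPP. intros NE.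
  assert (Big : forall t, 3 / 2 * INR k ^ 10 <= t <= 5 / 2 * INR k ^ 10 -> 3075 < head_energy t + tail_energy k t).
  { intros t Ht. apply Rnot_le_lt. intros H. apply NE. now exists t. }
  assert (Mt := tail_quad_form_primitive l (tail_weight al N') (S (k ^ 16))
    (fun n m' _ _ D _ _ => freq_inj al Hal n m' D)).
  set (d2 := sumR (fun n => tail_weight al N' n ^ 2 * kernel (l n * l n)) (S (k ^ 16))) in *.
  match type of Mt with primitive_near _ _ ?e => set (O2 := e) in * end.
  assert (Hd2 := tail_diag_le al Hal N' (S (k ^ 16)) HN1 HkN). fold d2 in Hd2.
  assert (HO2 : O2 <= 524288 * INR k ^ 9).
  { unfold O2. eapply Rle_trans; [apply (tail_off_diag_le al Hal)|].
    rewrite pow_INR. set (x := INR k) in *.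
    assert (x16 : 1 <= x ^ 16) by (apply pow_R1_Rle; exact K1).
    assert (L : 1 + ln (x ^ 16 + 1) <= 16 * x).
    { assert (ln (x ^ 16 + 1) <= ln 2 + 16 * ln x).
      { replace (16 * ln x) with (ln (x ^ 16)) by (rewrite ln_pow by lra; simpl (INR 16); ring).
        rewrite <- ln_mult by lra. apply ln_le; lra. }
      assert (ln x <= x - 1) by (generalize (exp_ineq1_le (ln x)); rewrite exp_ln; lra).
      generalize ln_2_bounds. lra. }
    assert (Sq : Rpower (x ^ 16 + 1) (1 / 2) <= 2 * x ^ 8).
    { apply Rle_trans with (Rpower ((2 * x ^ 8) ^ 2) (1 / 2)).
      - apply Rpower_le_base_pos; [lra|]. split; [lra|].
        replace ((2 * x ^ 8) ^ 2) with (4 * x ^ 16) by ring. lra.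
      - assert (0 < x ^ 8) by (apply pow_lt; lra).
        rewrite <- (Rpower_pow 2), Rpower_mult by lra.
        replace (INR 2 * (1 / 2)) with 1 by (simpl; field). rewrite Rpower_1 by lra. lra. }
    apply Rle_trans with (16384 * (16 * x * (2 * x ^ 8))); [|right; ring].
    apply Rmult_le_compat_l; [lra|]. apply Rmult_le_compat; [|left; apply Rpower_pos|exact L|exact Sq].
    generalize (ln_nonneg (x ^ 16 + 1) ltac:(lra)). lra. }
  assert (PD := primitive_near_plus _ _ _ _ _ _ M1 (primitive_near_plus _ _ _ _ _ _
    (primitive_near_scal (- 3075) _ _ _ M2) (primitive_near_scal (2 ^ N) _ _ _ Mt))).
  assert (x10 : 0 < INR k ^ 10) by (apply pow_lt; lra).
  assert (Pos := primitive_near_nonneg _ _ _ (3 / 2 * INR k ^ 10) (5 / 2 * INR k ^ 10) PD ltac:(lra)).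
  rewrite (Rabs_pos_eq (2 ^ N)) in Pos by lra.
  assert (A3075 : Rabs (- 3075) = 3075) by (rewrite Rabs_left; lra). rewrite A3075 in Pos.
  assert (Contr : 0 <= (c + (- 3075 * 1 + 2 ^ N * d2)) * (5 / 2 * INR k ^ 10 - 3 / 2 * INR k ^ 10) +
     2 * (B1 + (3075 * B2 + 2 ^ N * O2))).
  { apply Pos. intros t Ht. specialize (Big t Ht).
    destruct (riesz_bounds l d N t (head_coef_abs m N)) as [R1 R2].
    assert (ER : riesz l d N' t = riesz l d N t).
    { apply riesz_truncate; [exact HN|]. intros i Hi. unfold head_coef.
      replace (Nat.ltb i N) with false by (symmetry; apply Nat.ltb_ge; lia). reflexivity. }
    rewrite ER.
    assert (T0 : 0 <= tail_energy k t) by apply quad_form_nonneg.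
    fold (tail_energy k t). set (F := riesz l d N t) in *. nra. }
  assert (E1 : (c + (- 3075 * 1 + 2 ^ N * d2)) <= - 2).
  { assert (2 ^ N * d2 <= 1); [|lra]. eapply Rle_trans; [|exact Htail]. apply Rmult_le_compat_l; lra. }
  assert (E2 : B1 + (3075 * B2 + 2 ^ N * O2) < INR k ^ 10).
  { assert (x9 : 1 <= INR k ^ 9) by (apply pow_R1_Rle; exact K1).
    assert (2 ^ N * O2 <= 2 ^ N * 524288 * INR k ^ 9) by (rewrite Rmult_assoc; apply Rmult_le_compat_l; lra).
    generalize (Rle_abs B1) (Rle_abs B2) (Rabs_pos B1) (Rabs_pos B2). intros.
    replace (INR k ^ 10) with (INR k * INR k ^ 9) by ring.
    assert (Cst * INR k ^ 9 <= INR k * INR k ^ 9) by (apply Rmult_le_compat_r; lra).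
    unfold Cst in *. nra. }
  nra.
Qed.
End Selection.

Lemma dirichlet_term al tau z n :
  Rcpow (INR n + al) (- (RtoC (7 / 8) + Ci * RtoC tau + z)) =
  (RtoC (weight al n) * Cexp (- (Ci * RtoC tau) * RtoC (freq al n)) * Cexp (- z * RtoC (freq al n)))%C.
Proof.
  replace (- (RtoC (7 / 8) + Ci * RtoC tau + z))%C with (RtoC (- (7 / 8)) + (- (Ci * RtoC tau) + - z))%C
    by (rewrite RtoC_opp; ring).
  rewrite !Rcpow_plus, Rcpow_RtoC. unfold Rcpow, weight, freq. ring.
Qed.

Lemma dirichlet_split al N' X m N tau z : (N' <= X)%nat ->
  sumC (fun n => Rcpow (INR n + al) (- (RtoC (7 / 8) + Ci * RtoC tau + z))) X =
  (dpoly (freq al) (rotating (freq al) (weight al) (head_coef m N) tau) N' z +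
   dpoly (freq al) (fun n => RtoC (weight al n * (head_coef m N n / 2))) N' z +
   dpoly (freq al) (rotating (freq al) (tail_weight al N') (fun _ => 0%R) tau) X z)%C.
Proof.
  intros H. rewrite (sumC_ext _ _ _ (fun i _ => dirichlet_term al tau z i)).
  unfold dpoly. induction H as [|X H IH].
  - assert (Z : sumC (fun n => rotating (freq al) (tail_weight al N') (fun _ => 0%R) tau n * Cexp (- z * RtoC (freq al n)))%C N' = RtoC 0).
    { rewrite (sumC_ext _ (fun _ => RtoC 0 * RtoC 0)%C); [rewrite sumC_scal; ring|].
      intros i Hi. unfold rotating, tail_weight. apply Nat.ltb_lt in Hi. rewrite Hi. ring. }
    rewrite Z, Cplus_0_r, <- sumC_plus. apply sumC_ext. intros n _. unfold rotating.
    rewrite !RtoC_mult. ring.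
  - cbn [sumC]. rewrite IH.
    assert (E : rotating (freq al) (tail_weight al N') (fun _ => 0%R) tau X =
      (RtoC (weight al X) * Cexp (- (Ci * RtoC tau) * RtoC (freq al X)))%C).
    { unfold rotating, tail_weight. replace (Nat.ltb X N') with false by (symmetry; apply Nat.ltb_ge; lia).
      replace (0 / 2) with 0 by field. ring. }
    rewrite E. ring.
Qed.

Lemma Cmod_le_of_sqr z x : 0 <= x -> Cmod z ^ 2 <= x ^ 2 -> Cmod z <= x.
Proof. intros Hx H. generalize (Cmod_ge_0 z). nra. Qed.

Lemma dpoly_0 l b M : dpoly l b M 0 = sumC b M.
Proof.
  apply sumC_ext. intros n _. replace (- 0 * RtoC (l n))%C with (RtoC 0) by ring. rewrite Cexp_0. ring.
Qed.

Lemma energy_controls l b M : quad_form kernel l b M <= 3075 ->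
  Cmod (dpoly l b M 0) <= 56 /\
  forall z z', Cmod z <= 1 / 64 -> Cmod z' <= 1 / 64 ->
    Cmod (dpoly l b M z - dpoly l b M z')%C <= 79 * Cmod (z - z')%C.
Proof.
  intros H. split.
  - rewrite dpoly_0. apply Cmod_le_of_sqr; [lra|]. generalize (quad_form_ge_sum l b M). lra.
  - intros z z' Hz Hz'. generalize (Cmod_ge_0 (z - z')%C). intros D0.
    apply Cmod_le_of_sqr; [lra|]. assert (L := dpoly_lipschitz l b M z z' Hz Hz').
    rewrite Rpow_mult_distr. assert (0 <= Cmod (z - z')%C ^ 2) by apply pow2_ge_0. nra.
Qed.

Lemma zeros_of_no_relation (V N' : nat) al : let N := (4 * V ^ 32)%nat in
  1000000 <= INR V -> (N <= N')%nat -> 2 ^ N * (2048 * Rpower (INR N') (- (1 / 2))) <= 1 ->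
  1 / 2 < al < 1 -> no_relation (freq al) N' ->
  forall H : R, exists s, stripD s /\ hurwitz al s = RtoC 0 /\ H <= Im s.
Proof.
  intros N HV HN Htail Ha Hrel H.
  assert (Hal : 1 / 2 <= al <= 1) by lra.
  destruct (head_function al Hal V N' HV HN) as (m & A & HA & Hg0 & Hg). fold N in Hg0, Hg.
  set (v := INR V) in *. set (r := / (20000000 * v ^ 2)) in *.
  assert (v2 : 1000000000000 <= v ^ 2) by nra.
  assert (v4 : v ^ 4 = v ^ 2 * v ^ 2) by ring.
  assert (r0 : 0 < r) by (apply Rinv_0_lt_compat; lra).
  assert (r1 : r <= 1 / 64).
  { unfold r. replace (1 / 64) with (/ 64) by field. apply Rinv_le_contravar; lra. }
  assert (HN1 : (1 <= N')%nat).
  { apply Nat.le_trans with (2 := HN). unfold N. apply INR_le. rewrite mult_INR, pow_INR. fold v.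
    assert (1 <= v ^ 32) by (apply pow_R1_Rle; lra). simpl (INR 4). simpl (INR 1). lra. }
  destruct (small_energy_exists al N N' m Hal HN HN1 Htail Hrel) as [k0 Hk0].
  destruct (INR_unbounded (Rabs H + INR N' + 1)) as [k1 Hk1].
  set (k := (k0 + k1)%nat).
  destruct (Hk0 k ltac:(unfold k; lia)) as [tau [Ht HE]].
  assert (Kb : Rabs H + INR N' + 1 < INR k) by (unfold k; rewrite plus_INR; generalize (pos_INR k0); lra).
  assert (PN' := pos_INR N'). assert (PH := Rabs_pos H).
  assert (K1 : 1 <= INR k) by lra.
  assert (Hk : (1 <= k)%nat) by (apply INR_le; exact K1).
  assert (Kp : forall n, (1 <= n)%nat -> INR k <= INR k ^ n).
  { intros n Hn. rewrite <- (pow_1 (INR k)) at 1. apply Rle_pow; [exact K1|exact Hn]. }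
  assert (K10 := Kp 10%nat ltac:(lia)). assert (K16 := Kp 16%nat ltac:(lia)).
  assert (HX : (N' <= S (k ^ 16))%nat) by (apply INR_le; rewrite S_INR, pow_INR; lra).
  set (a := INR (S (k ^ 16)) + al).
  assert (Hcut : INR k ^ 16 + 1 <= a <= INR k ^ 16 + 2).
  { unfold a. rewrite S_INR, pow_INR. lra. }
  set (pt := fun z : C => (RtoC (7 / 8) + Ci * RtoC tau + z)%C).
  assert (Rpt : forall z, Re (pt z) = 7 / 8 + Re z /\ Im (pt z) = tau + Im z).
  { intros z. unfold pt. destruct z; simpl. split; ring. }
  assert (Reg : forall z, Cmod z <= r -> em_region k (pt z)).
  { intros z Hz. destruct (Rpt z) as [E1 E2].
    assert (B1 := re_le_Cmod z). assert (B2 := im_le_Cmod z). apply Rabs_le_between in B1, B2.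
    split; rewrite ?E1, ?E2; lra. }
  set (f := fun z => hurwitz al (pt z)).
  set (h := dpoly (freq al) (rotating (freq al) (weight al) (head_coef m N) tau) N') in *.
  set (g := dpoly (freq al) (fun n => RtoC (weight al n * (head_coef m N n / 2))) N') in *.
  set (q := dpoly (freq al) (rotating (freq al) (tail_weight al N') (fun _ => 0) tau) (S (k ^ 16))) in *.
  assert (Ef : forall z, Cmod z <= r -> f z = (h z + g z + q z + em_rem a (pt z))%C).
  { intros z Hz. destruct (Reg z Hz) as [Rg1 Rg2]. unfold f.
    rewrite (hurwitz_em al (pt z) (k ^ 16)).
    - unfold pt at 1. rewrite (dirichlet_split al N' (S (k ^ 16)) m N tau z HX). reflexivity.
    - lra.
    - lra.
    - intros E. rewrite E in Rg1. simpl in Rg1. lra. }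
  assert (T0 : 0 <= tail_energy al N' k tau) by apply quad_form_nonneg.
  assert (H0 : 0 <= head_energy al N N' m tau) by apply quad_form_nonneg.
  destruct (energy_controls (freq al) (rotating (freq al) (weight al) (head_coef m N) tau) N') as [h0 hl].
  { unfold head_energy, tail_energy in *. lra. }
  destruct (energy_controls (freq al) (rotating (freq al) (tail_weight al N') (fun _ => 0) tau) (S (k ^ 16))) as [q0 ql].
  { unfold head_energy, tail_energy in *. lra. }
  fold h in h0, hl. fold q in q0, ql.
  assert (ik : 0 < / INR k <= 1).
  { split; [apply Rinv_0_lt_compat; lra|]. rewrite <- Rinv_1. apply Rinv_le_contravar; lra. }
  assert (MA : Cmod (RtoC A) = Rabs A) by apply Cmod_R.
  destruct (newton_zero f (RtoC A) r) as [z [Hz Fz]].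
  - apply Cmod_gt_0. rewrite MA. nra.
  - exact r0.
  - intros z z' Hz Hz'. rewrite MA. rewrite (Ef z Hz), (Ef z' Hz').
    assert (Q1 := hl z z' ltac:(lra) ltac:(lra)). assert (Q2 := ql z z' ltac:(lra) ltac:(lra)).
    assert (Q3 := Hg z z' Hz Hz').
    assert (Q4 := em_rem_lipschitz k a Hk Hcut (pt z) (pt z') (Reg z Hz) (Reg z' Hz')).
    replace (pt z - pt z')%C with (z - z')%C in Q4 by (unfold pt; ring).
    set (D := Cmod (z - z')%C) in *. assert (D0 : 0 <= D) by apply Cmod_ge_0.
    assert (Q5 : 150 / INR k * D <= 150 * D) by (apply Rmult_le_compat_r; [exact D0|unfold Rdiv; lra]).
    replace (h z + g z + q z + em_rem a (pt z) - (h z' + g z' + q z' + em_rem a (pt z')) - RtoC A * (z - z'))%C with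
      ((h z - h z') + (g z - g z' - RtoC A * (z - z')) + (q z - q z') + (em_rem a (pt z) - em_rem a (pt z')))%C by ring.
    generalize (Cmod_triangle ((h z - h z') + (g z - g z' - RtoC A * (z - z')) + (q z - q z')) (em_rem a (pt z) - em_rem a (pt z')))%C
      (Cmod_triangle ((h z - h z') + (g z - g z' - RtoC A * (z - z'))) (q z - q z'))%C
      (Cmod_triangle (h z - h z') (g z - g z' - RtoC A * (z - z')))%C. intros.
    assert (Big : v ^ 4 / 256 + 308 <= Rabs A / 2) by nra.
    assert ((v ^ 4 / 256 + 308) * D <= Rabs A / 2 * D) by (apply Rmult_le_compat_r; lra). lra.
  - rewrite MA.
    assert (Cz : Cmod (RtoC 0) <= r) by (rewrite Cmod_0; lra).
    rewrite (Ef _ Cz).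
    assert (Q4 := em_rem_small k a Hk Hcut (pt (RtoC 0)) (Reg _ Cz)).
    generalize (Cmod_triangle (h (RtoC 0) + g (RtoC 0) + q (RtoC 0)) (em_rem a (pt (RtoC 0))))%C
      (Cmod_triangle (h (RtoC 0) + g (RtoC 0)) (q (RtoC 0)))%C (Cmod_triangle (h (RtoC 0)) (g (RtoC 0)))%C. intros.
    assert (10 / INR k <= 10) by (unfold Rdiv; lra).
    assert (390 <= Rabs A * r / 2).
    { apply Rle_trans with (v ^ 4 / 64 * r / 2).
      - unfold r. replace (v ^ 4 / 64 * / (20000000 * v ^ 2) / 2) with (v ^ 2 / 2560000000) by (field; lra). lra.
      - unfold Rdiv at 1. apply Rmult_le_compat_r; [lra|]. apply Rmult_le_compat_r; lra. }
    lra.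
  - exists (pt z). destruct (Reg z Hz) as [Rg1 Rg2]. split; [|split].
    + unfold stripD. lra.
    + exact Fz.
    + generalize (Rle_abs H). lra.
Qed.

Lemma infinite_set_unbounded (S : C -> Prop) : (forall H : R, exists s, S s /\ H <= Im s) -> infinite_set C S.
Proof.
  intros U F. destruct (Finite_list C S F) as [L HL].
  assert (B : exists M, forall s, In s L -> Im s <= M).
  { clear. induction L as [|s L [M IH]].
    - exists 0. intros s [].
    - exists (Rmax (Im s) M). intros s' [<-|I]; [apply Rmax_l|].
      eapply Rle_trans; [apply IH, I|apply Rmax_r]. }
  destruct B as [M HM]. destruct (U (M + 1)) as [s [Hs Is]].
  specialize (HM s (HL s Hs)). lra.
Qed.

Theorem theorem2 :
  infinite_set R (fun alpha : R =>
    calA alpha /\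
    exists zeta : C -> C,
      is_Hurwitz_zeta alpha zeta /\
      infinite_set C (fun s : C => stripD s /\ zeta s = RtoC 0)).
Proof.
  destruct (INR_unbounded 1000000) as [V HV].
  set (N := (4 * V ^ 32)%nat).
  assert (Ex : exists N', (N <= N')%nat /\ 2 ^ N * (2048 * Rpower (INR N') (- (1 / 2))) <= 1).
  { set (b := 2 ^ N * 2048). assert (b1 : 1 <= b) by (unfold b; generalize (pow_R1_Rle 2 N ltac:(lra)); lra).
    destruct (INR_unbounded (b ^ 2 + INR N)) as [N' HN']. exists N'.
    assert (b2 : 0 <= b ^ 2) by apply pow2_ge_0. assert (PN := pos_INR N).
    split; [apply INR_le; lra|].
    rewrite <- Rmult_assoc. fold b.
    apply Rle_trans with (b * Rpower (b ^ 2) (- (1 / 2))).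
    - apply Rmult_le_compat_l; [lra|]. apply Rpower_le_base; [lra|]. split; [apply pow_lt; lra|lra].
    - rewrite <- (Rpower_pow 2), Rpower_mult by lra. replace (INR 2 * - (1 / 2)) with (- (1)) by (simpl; field).
      rewrite Rpower_Ropp, Rpower_1 by lra. right; field; lra. }
  destruct Ex as [N' [HN Htail]].
  destruct (no_relation_cofinite N') as [L HL].
  apply infinite_set_of_cofinite with L. intros j Hj.
  assert (Ra := quadratic_param_range j).
  split; [apply quadratic_param_calA|].
  exists (hurwitz (quadratic_param j)). split; [apply hurwitz_is_zeta; lra|].
  apply infinite_set_unbounded. intros H.
  destruct (zeros_of_no_relation V N' (quadratic_param j) ltac:(lra) HN Htail Ra (HL (quadratic_param j) ltac:(lra) Hj) H) as (s & S1 & S2 & S3).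
  exists s. auto.
Qed.
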